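(* Let $X$ be a complex Hilbert space with open unit ball $B$, and let $0\le\alpha<1$. Then $K(B,\alpha)\subset S^{*}(B,\beta)$, where $$\beta=\beta(\alpha)=\frac{2\alpha-1+\sqrt{(2\alpha-1)^2+8}}{4}.$$
   Context: $X$ is a complex Hilbert space with inner product $\langle\cdot,\cdot\rangle$ and norm $\|\cdot\|$, and $B=\{z\in X:\|z\|<1\}$. $Df(z)$ and $D^2f(z)$ denote the first and second Fréchet derivatives of a holomorphic mapping $f$ at $z$; $I$ is the identity operator on $X$. A holomorphic mapping $f:B\to X$ is locally biholomorphic if every point of $B$ has a neighborhood on which $f$ is biholomorphic (onto its image, with holomorphic inverse); equivalently, $Df(z)$ has a bounded inverse at each $z\in B$. $N(B)$ is the class of all locally biholomorphic mappings $f:B\to X$ with $f(0)=0$ and $Df(0)=I$. For $0\le\alpha<1$, a locally biholomorphic mapping $f:B\to X$ is called a biholomorphic convex mapping of order $\alpha$ on $B$ if $$\|x\|^2-\mathrm{Re}\,\big\langle Df(z)^{-1}D^2f(z)(x,x),z\big\rangle>\alpha\|x\|^2$$ for all $z\in B\setminus\{0\}$ and $x\in X\setminus\{0\}$ with $\mathrm{Re}\,\langle x,z\rangle=0$. $K(B,\alpha)$ is the class of all biholomorphic convex mappings $f$ of order $\alpha$ on $B$ with $f(0)=0$ and $Df(0)=I$. For $0<\beta<1$, $S^{*}(B,\beta)$ (the starlike mappings of order $\beta$ on $B$) is the class of all $f\in N(B)$ such that $$\Big|\langle Df(z)^{-1}f(z),z\rangle-\frac{1}{2\beta}\|z\|^2\Big|<\frac{1}{2\beta}\|z\|^2\quad\text{for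 all } z\in B\setminus\{0\}.$$ *)

(* Defs.v *)
From HB Require Import structures.
From mathcomp Require Import all_boot all_order all_algebra.
From mathcomp Require Import sesquilinear complex.
From mathcomp Require Import boolp classical_sets functions reals.
From mathcomp Require Import topology normedtype landau derive.

Set Implicit Arguments.
Unset Strict Implicit.
Unset Printing Implicit Defensive.

Import Order.TTheory GRing.Theory Num.Theory Num.Def.
Import numFieldNormedType.Exports.

Local Open Scope classical_set_scope.
Local Open Scope ring_scope.
Local Open Scope complex_scope.

Section Holomorphy.
Context {R : realType} {X : completeNormedModType R[i]}.
Implicit Types (U : set X) (f : X -> X) (z : X).

Definition unit_ball : set X := [set z | `|z| < 1].

(* Mappings defined on a set U are total functions whose values outside U are
   irrelevant: U is always open, and derivatives only depend on germs. Since
   the scalars are R[i], [differentiable] is complex Frechet differentiability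
   and ['d f z] is a continuous R[i]-linear operator. *)
Definition holomorphic_on U f : Prop := forall z, U z -> differentiable f z.

Definition biholomorphic_on U f : Prop :=
  [/\ holomorphic_on U f, open (f @` U) &
      exists g : X -> X,
        holomorphic_on (f @` U) g /\ (forall z, U z -> g (f z) = z)].

Definition locally_biholomorphic U f : Prop :=
  holomorphic_on U f /\
  forall z, U z ->
    exists V : set X, [/\ open V, V z, V `<=` U & biholomorphic_on V f].

(* A is the Frechet derivative at z of w |-> Df(w), as a map into the bounded
   operators with the operator norm (the bound on the remainder is uniform in
   x); A h x stands for D^2 f(z)(h, x). *)
Definition is_diff2 f z (A : X -> X -> X) : Prop :=
  [/\ \forall w \near z, differentiable f w,
      forall h, linear (A h),
      forall x, linear (A^~ x),
      exists M : R[i], forall h x, `|A h x| <= M * `|h| * `|x| &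
      forall e : R[i], 0 < e ->
        \forall h \near (0 : X), forall x,
          `|'d f (z + h) x - 'd f z x - A h x| <= e * `|h| * `|x|].

Definition diff2 f z : X -> X -> X := get (is_diff2 f z).

(* The genuine inverse of Df(z) when that operator is bijective, which is the
   case at every point of a domain where f is locally biholomorphic. *)
Definition diff_inv f z : X -> X := 'pinv_(fun=> 0) [set: X] ('d f z).

Definition normalized f : Prop := f 0 = 0 /\ forall x, 'd f (0 : X) x = x.

Definition class_N : set (X -> X) :=
  [set f | locally_biholomorphic unit_ball f /\ normalized f].

(* The inner product [dot] is linear in its first argument; its compatibility
   with the norm of X is a hypothesis wherever these classes are used. *)
Definition convex_of_order (dot : {dot X for conjC}) (alpha : R) f : Prop :=
  locally_biholomorphic unit_ball f /\
  forall z x : X, unit_ball z -> z != 0 -> x != 0 -> 'Re (dot x z) = 0 ->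
    `|x| ^+ 2 - 'Re (dot (diff_inv f z (diff2 f z x x)) z)
      > alpha%:C * `|x| ^+ 2.

Definition class_K (dot : {dot X for conjC}) (alpha : R) : set (X -> X) :=
  [set f | convex_of_order dot alpha f /\ normalized f].

Definition class_Sstar (dot : {dot X for conjC}) (beta : R) : set (X -> X) :=
  [set f | class_N f /\
    forall z, unit_ball z -> z != 0 ->
      `|dot (diff_inv f z (f z)) z - ((2 * beta)^-1)%:C * `|z| ^+ 2|
        < ((2 * beta)^-1)%:C * `|z| ^+ 2].

End Holomorphy.

(* Main.v *)
Require Import Defs.
From HB Require Import structures.
From mathcomp Require Import all_boot all_order all_algebra.
From mathcomp Require Import sesquilinear complex.
From mathcomp Require Import boolp classical_sets functions reals.
From mathcomp Require Import topology normedtype landau derive.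
From mathcomp Require Import ring lra.

(** Write w z = Df(z)^-1 f(z), Q z x y = Df(z)^-1 D2f(z)(x, y) and k = 1/(2 beta);
    the value of beta is the one for which k (2 k - 1) = 1 - 2 k alpha
    ([order_beta]).  Starlikeness of order beta says that the defect
        h(z) = |<w z, z>|^2 - 2 k |z|^2 Re <w z, z>
    is negative on the punctured ball ([defect_lt0P]).  It is negative near 0
    because w z = z + o(|z|) and 1/2 < k <= 1, and it can be differentiated because
    Dw(z) x = x - Q z x (w z).

    Suppose that h is nonnegative somewhere.  A bad point of least norm need not
    exist in an infinite dimensional ball, but for every eps > 0 there are a
    centre c with |c| <= eps and a bad point z0 nearest to c ([nearest_point]).
    No bad point lies in the open ball around c through z0, so Dh(z0) is a
    nonnegative multiple of x |-> Re <x, z0 - c>; let t be the normalised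
    multiplier ([multiplier]).  Write w z0 = p z0 + v with v orthogonal to z0.
    Since h(z0) = 0, p = k (1 + e) with |e| = 1.  Two facts then collide.

    - Along the complex line through z0, the function
      l |-> <w (l z0), z0> / (k l |z0|^2) - 1 has modulus less than 1 on the disc
      cut out by the touching ball, and its value near l = 0 is close to (1 - k)/k.
      The boundary Schwarz-Pick inequality at l = 1 bounds t from below by
      k (2 k - 1), up to an error that is small with eps ([boundary_schwarz],
      [contact_slope]).

    - Put Y = p z0 + (1 - conj e)/2 v.  Convexity of order alpha controls
      <Q z0 Y Y, z0>, with alpha replaced by a constant a > alpha when |z0| <= r1 < 1
      ([convex_uniform], again by the Schwarz lemma).  For this Y the multiplier
      equations turn the control into
          a |v|^2 <= |z0|^2 Re p (1 - 2 k a - t) + O(t eps (|p| + |v|))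
      ([curvature_inequality]).

    As a > alpha, 1 - 2 k a < 1 - 2 k alpha = k (2 k - 1), so the first fact makes
    the bracket negative, and |p| + |v| = O(eps).  The radial part of the
    multiplier equation, conj e (1 - A - p) = t (1 - s) with
    A = <Q z0 z0 (w z0), z0>/|z0|^2 = O(|p| + |v|) and s = <z0, c>/|z0|^2 = O(eps), keeps
    |p| + |v| away from 0 ([touching_eps_ge]).

    The second derivative, its symmetry, and the holomorphy of z |-> Q z x y come
    from Cauchy estimates for difference quotients.  These in turn rest on the
    maximum principle in one complex variable, obtained from Goursat's theorem on
    squares with dyadic midpoint sums in place of integrals. *)

Set Implicit Arguments.
Unset Strict Implicit.
Unset Printing Implicit Defensive.

Import Order.TTheory GRing.Theory Num.Theory Num.Def.
Import numFieldNormedType.Exports.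
Local Open Scope classical_set_scope.
Local Open Scope ring_scope.
Local Open Scope complex_scope.

(** * Real-valued norms and complex arithmetic *)

Section RealNorm.
Context {R : realType}.
Local Notation C := R[i].

(** Norms over the complex field take their values in R[i]; the real part of that
    value is the form in which order arithmetic over R applies to it. *)
Definition nm {V : normedZmodType C} (x : V) : R := complex.Re `|x|.

Lemma nmE (V : normedZmodType C) (x : V) : `|x| = (nm x)%:C.
Proof. by rewrite /nm RRe_real ?normr_real. Qed.

Lemma nm_ge0 (V : normedZmodType C) (x : V) : 0 <= nm x.
Proof. by rewrite -ler0c -nmE. Qed.

Lemma nm0 (V : normedZmodType C) : nm (0 : V) = 0.
Proof. by rewrite /nm normr0. Qed.

Lemma nm_eq0 (V : normedZmodType C) (x : V) : (nm x == 0) = (x == 0).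
Proof. by rewrite -[RHS]normr_eq0 nmE -(inj_eq (@complexI R)). Qed.

Lemma nm_gt0 (V : normedZmodType C) (x : V) : (0 < nm x) = (x != 0).
Proof. by rewrite lt_def nm_ge0 nm_eq0 andbT. Qed.

Lemma nmN (V : normedZmodType C) (x : V) : nm (- x) = nm x.
Proof. by rewrite /nm normrN. Qed.

Lemma nmB (V : normedZmodType C) (x y : V) : nm (x - y) = nm (y - x).
Proof. by rewrite /nm distrC. Qed.

Lemma nmD (V : normedZmodType C) (x y : V) : nm (x + y) <= nm x + nm y.
Proof. by rewrite -lecR rmorphD/= -!nmE ler_normD. Qed.

Lemma nm_tri (V : normedZmodType C) (x y z : V) :
  nm (x - z) <= nm (x - y) + nm (y - z).
Proof. by have := nmD (x - y) (y - z); rewrite addrA subrK. Qed.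

Lemma nm_subl (V : normedZmodType C) (x y : V) : nm x <= nm y + nm (x - y).
Proof. by have := nmD y (x - y); rewrite addrCA subrr addr0. Qed.

Lemma nmM (x y : C) : nm (x * y) = nm x * nm y.
Proof. by apply: complexI; rewrite rmorphM/= -!nmE normrM. Qed.

Lemma nmX (x : C) n : nm (x ^+ n) = nm x ^+ n.
Proof. by apply: complexI; rewrite rmorphXn/= -!nmE normrX. Qed.

Lemma nmV (x : C) : nm (x^-1) = (nm x)^-1.
Proof. by apply: complexI; rewrite fmorphV/= -!nmE normfV. Qed.

Lemma nm1 : nm (1 : C) = 1.
Proof. by apply: complexI; rewrite -nmE normr1. Qed.

Lemma nmZ (V : normedModType C) (a : C) (x : V) : nm (a *: x) = nm a * nm x.
Proof. by apply: complexI; rewrite rmorphM/= -!nmE normrZ. Qed.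

Lemma nmJ (x : C) : nm x^*%C = nm x.
Proof. by rewrite /nm normcJ. Qed.

Lemma nm_real (x : R) : nm x%:C = `|x|.
Proof. by rewrite /nm/= expr0n addr0 sqrtr_sqr. Qed.

Lemma nm_sqr (x : C) : nm x ^+ 2 = complex.Re x ^+ 2 + complex.Im x ^+ 2.
Proof. by case: x => a b; rewrite /nm/= sqr_sqrtr// addr_ge0// sqr_ge0. Qed.

Lemma nm_sqrJ (x : C) : (nm x ^+ 2)%:C = x * x^*%C.
Proof. by rewrite rmorphXn/= -nmE sqr_normc. Qed.

Lemma Re_le_nm (x : C) : `|complex.Re x| <= nm x.
Proof. by rewrite -lecR -nmE normc_ge_Re. Qed.

Lemma Re_le (x : C) : complex.Re x <= nm x.
Proof. exact: le_trans (ler_norm _) (Re_le_nm x). Qed.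

Lemma Im_le_nm (x : C) : `|complex.Im x| <= nm x.
Proof.
by rewrite -(ler_pXn2r (ltn0Sn 1)) ?nnegrE ?nm_ge0// nm_sqr real_normK ?num_real// lerDr sqr_ge0.
Qed.

Lemma nm_le_ReIm (x : C) : nm x <= `|complex.Re x| + `|complex.Im x|.
Proof.
rewrite -(ler_pXn2r (ltn0Sn 1)) ?nnegrE ?nm_ge0 ?addr_ge0// nm_sqr sqrrD !real_normK ?num_real//.
by rewrite -addrA lerD2l lerDr mulrn_wge0// mulr_ge0.
Qed.

Lemma cReM (x y : C) :
  complex.Re (x * y) = complex.Re x * complex.Re y - complex.Im x * complex.Im y.
Proof. by case: x y => [a b] [c d]. Qed.

Lemma cImM (x y : C) :
  complex.Im (x * y) = complex.Re x * complex.Im y + complex.Im x * complex.Re y.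
Proof. by case: x y => [a b] [c d]. Qed.

Lemma cReD (x y : C) : complex.Re (x + y) = complex.Re x + complex.Re y.
Proof. by case: x y => [a b] [c d]. Qed.
Lemma cImD (x y : C) : complex.Im (x + y) = complex.Im x + complex.Im y.
Proof. by case: x y => [a b] [c d]. Qed.
Lemma cReN (x : C) : complex.Re (- x) = - complex.Re x.
Proof. by case: x. Qed.
Lemma cImN (x : C) : complex.Im (- x) = - complex.Im x.
Proof. by case: x. Qed.
Lemma cReB (x y : C) : complex.Re (x - y) = complex.Re x - complex.Re y.
Proof. by rewrite cReD cReN. Qed.
Lemma cImB (x y : C) : complex.Im (x - y) = complex.Im x - complex.Im y.
Proof. by rewrite cImD cImN. Qed.
Lemma cReJ (x : C) : complex.Re x^*%C = complex.Re x. Proof. by case: x. Qed.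
Lemma cImJ (x : C) : complex.Im x^*%C = - complex.Im x. Proof. by case: x. Qed.

Definition Cex := (cReM, cImM, cReB, cImB, cReD, cImD, cReN, cImN, cReJ, cImJ).

Lemma half_real : (2^-1 : C) = (2^-1 : R)%:C.
Proof. by rewrite fmorphV/= rmorph_nat. Qed.

Lemma Re_half (x : C) : complex.Re (x / 2) = complex.Re x / 2.
Proof. by rewrite half_real cReM/= mulr0 subr0. Qed.

Lemma Im_half (x : C) : complex.Im (x / 2) = complex.Im x / 2.
Proof. by rewrite half_real cImM/= mulr0 add0r. Qed.

Lemma C_gt0 (e : C) : 0 < e -> exists2 r : R, 0 < r & e = r%:C.
Proof. by case: e => a b; rewrite ltcE/= => /andP[/eqP -> a0]; exists a. Qed.

Lemma C_eqP (x y : C) :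
  complex.Re x = complex.Re y -> complex.Im x = complex.Im y -> x = y.
Proof. by case: x y => [a b] [c d] /= -> ->. Qed.

End RealNorm.

(** * Derivatives *)

Section Derivative.
Context {R : realType}.
Local Notation C := R[i].

(** Differentiability with a quantified remainder; linearity and boundedness of L
    are separate hypotheses, so that the notion serves scalar functions, mappings of
    X and the identity alike. *)
Definition hasd {V W : normedZmodType C} (F : V -> W) (a : V) (L : V -> W) :=
  forall e : R, 0 < e -> exists2 d : R, 0 < d &
    forall h, nm h < d -> nm (F (a + h) - F a - L h) <= e * nm h.

Lemma hasd_lip (V W : normedZmodType C) (F : V -> W) a L B :
  hasd F a L -> (forall h, nm (L h) <= B * nm h) ->
  exists2 d : R, 0 < d & forall h, nm h < d -> nm (F (a + h) - F a) <= (B + 1) * nm h.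
Proof.
move=> FL LB; have [d d0 dP] := FL _ ltr01; exists d => // h hd.
apply: (le_trans (nm_subl _ (L h))).
by rewrite mulrDl; apply: lerD; [exact: LB | exact: dP].
Qed.

Lemma hasd_near (V W : normedZmodType C) (F G : V -> W) a L d : 0 < d ->
  (forall h, nm h < d -> F (a + h) = G (a + h)) -> hasd F a L -> hasd G a L.
Proof.
move=> d0 FG FL e e0; have [d' d'0 d'P] := FL e e0.
exists (Num.min d d'); first by rewrite lt_min d0.
move=> h; rewrite lt_min => /andP[hd hd']; rewrite -FG//.
by have /(_ 0) := FG; rewrite nm0 addr0 => <-//; apply: d'P.
Qed.

Lemma hasd_comp (U V W : normedZmodType C) (F : V -> W) (G : U -> V) a L M B B' :
  hasd F (G a) L -> hasd G a M -> (forall x y, L (x - y) = L x - L y) ->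
  (forall h, nm (L h) <= B * nm h) -> (forall h, nm (M h) <= B' * nm h) ->
  hasd (F \o G) a (L \o M).
Proof.
move=> FL GM LB LbB MbB e e0.
have [B0 B'0] : 0 <= Num.max B 0 /\ 0 <= Num.max B' 0 by rewrite !le_max !lexx !orbT.
have LbB0 h : nm (L h) <= Num.max B 0 * nm h.
  by apply: (le_trans (LbB h)); rewrite ler_wpM2r ?nm_ge0// le_max lexx.
have MbB0 h : nm (M h) <= Num.max B' 0 * nm h.
  by apply: (le_trans (MbB h)); rewrite ler_wpM2r ?nm_ge0// le_max lexx.
move: (Num.max B 0) (Num.max B' 0) B0 B'0 LbB0 MbB0 => {LbB MbB}b b' b0 b'0 LbB MbB.
pose e1 := e / (2 * (b' + 1)); pose e2 := e / (2 * (b + 1)).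
have e10 : 0 < e1 by rewrite divr_gt0//; lra.
have e20 : 0 < e2 by rewrite divr_gt0//; lra.
have [d1 d10 d1P] := FL _ e10; have [d2 d20 d2P] := GM _ e20.
have [d3 d30 d3P] := hasd_lip GM MbB.
exists (Num.min (Num.min d2 d3) (d1 / (b' + 1))).
  by rewrite !lt_min d20 d30 divr_gt0//; lra.
move=> h; rewrite !lt_min => /andP[/andP[hd2 hd3]].
rewrite ltr_pdivlMr; last by lra.
move=> hd1; have := d3P h hd3 => klt.
set k := G (a + h) - G a in klt.
have kd1 : nm k < d1 by apply: (le_lt_trans klt); rewrite mulrC.
have := d1P k kd1; rewrite {1}/k addrCA subrr addr0 /= => F1.
have -> : F (G (a + h)) - F (G a) - L (M h) =
    (F (G (a + h)) - F (G a) - L k) + L (k - M h).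
  by rewrite (LB k) [RHS]addrA subrK.
apply: (le_trans (nmD _ _)).
have -> : e * nm h = e1 * ((b' + 1) * nm h) + (b + 1) * (e2 * nm h).
  by rewrite /e1 /e2; field; apply/andP; split; rewrite gt_eqF//; lra.
apply: lerD; first by apply: (le_trans F1); rewrite ler_pM2l.
apply: (le_trans (LbB _)).
have kM : nm (k - M h) <= e2 * nm h by exact: d2P.
apply: ler_pM => //; [exact: nm_ge0 | lra].
Qed.

Lemma hasdD (V W : normedZmodType C) (F G : V -> W) a L M :
  hasd F a L -> hasd G a M -> hasd (fun x => F x + G x) a (fun h => L h + M h).
Proof.
move=> FL GM e e0; have e20 : 0 < e / 2 by lra.
have [d d0 dP] := FL _ e20; have [d' d'0 d'P] := GM _ e20.
exists (Num.min d d'); first by rewrite lt_min d0.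
move=> h; rewrite lt_min => /andP[/dP hd /d'P hd'].
have -> : F (a + h) + G (a + h) - (F a + G a) - (L h + M h) =
  (F (a + h) - F a - L h) + (G (a + h) - G a - M h).
  by rewrite [RHS]addrACA -opprD; congr (_ - _); rewrite [RHS]addrACA -opprD.
by apply: (le_trans (nmD _ _)); lra.
Qed.

Lemma hasdN (V W : normedZmodType C) (F : V -> W) a L :
  hasd F a L -> hasd (fun x => - F x) a (fun h => - L h).
Proof.
move=> FL e e0; have [d d0 dP] := FL _ e0; exists d => // h /dP.
by rewrite -nmN !opprD !opprK.
Qed.

Lemma hasd_cst (V W : normedZmodType C) (c : W) (a : V) : hasd (fun=> c) a (fun=> 0).
Proof. by move=> e e0; exists 1 => // h _; rewrite !subrr nm0 mulr_ge0 ?nm_ge0// ltW. Qed.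

Definition cder (g : C -> C) (a d : C) := hasd g a (fun h => h * d).

Implicit Types (f g : C -> C) (a d : C).

Lemma mulr_bound d (h : C) : nm (h * d) <= nm d * nm h.
Proof. by rewrite nmM mulrC. Qed.

Lemma cder_lip g a d : cder g a d -> exists2 r : R, 0 < r &
  forall h, nm h < r -> nm (g (a + h) - g a) <= (nm d + 1) * nm h.
Proof. by move=> gd; apply: (hasd_lip gd); exact: mulr_bound. Qed.

Lemma cder_cst (c a : C) : cder (fun=> c) a 0.
Proof. by move=> e /(hasd_cst c a)[d d0 dP]; exists d => // h /dP; rewrite mulr0. Qed.

Lemma cder_id a : cder id a 1.
Proof.
move=> e e0; exists 1 => // h _; rewrite mulr1 (addrC a) addrK subrr nm0.
by rewrite mulr_ge0 ?nm_ge0// ltW.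
Qed.

Lemma cderD f g a d d' : cder f a d -> cder g a d' -> cder (fun z => f z + g z) a (d + d').
Proof.
move=> fd gd e e0; have [r r0 rP] := hasdD fd gd e0.
by exists r => // h /rP; rewrite mulrDr.
Qed.

Lemma cderN g a d : cder g a d -> cder (fun z => - g z) a (- d).
Proof.
by move=> gd e e0; have [r r0 rP] := hasdN gd e0; exists r => // h /rP; rewrite mulrN.
Qed.

Lemma cderB f g a d d' : cder f a d -> cder g a d' -> cder (fun z => f z - g z) a (d - d').
Proof. by move=> fd gd; apply: cderD => //; exact: cderN. Qed.

Lemma cderM f g a d d' : cder f a d -> cder g a d' ->
  cder (fun z => f z * g z) a (d * g a + f a * d').
Proof.
move=> fd gd e e0.
have S0 : 0 < nm (f a) + nm (g a) + 1 by rewrite ltr_wpDl// addr_ge0 ?nm_ge0.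
have D0 : 0 < (nm d + 1) * (nm d' + 1) by rewrite mulr_gt0// ltr_wpDl ?nm_ge0.
pose S := nm (f a) + nm (g a) + 1; pose D := (nm d + 1) * (nm d' + 1).
have e1 : 0 < e / (2 * S) by rewrite divr_gt0// mulr_gt0.
have [r1 r10 r1P] := fd _ e1; have [r2 r20 r2P] := gd _ e1.
have [r3 r30 r3P] := cder_lip fd; have [r4 r40 r4P] := cder_lip gd.
exists (Num.min (Num.min r1 r2) (Num.min (Num.min r3 r4) (e / (2 * D)))).
  by rewrite !lt_min r10 r20 r30 r40 divr_gt0// mulr_gt0.
move=> h; rewrite !lt_min => /andP[/andP[h1 h2] /andP[/andP[h3 h4] h5]].
have -> : f (a + h) * g (a + h) - f a * g a - h * (d * g a + f a * d') =
  (f (a + h) - f a - h * d) * g a + f a * (g (a + h) - g a - h * d') +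
  (f (a + h) - f a) * (g (a + h) - g a) by ring.
apply: (le_trans (nmD _ _)).
have -> : e * nm h = e / (2 * S) * nm h * S + e / (2 * D) * (D * nm h).
  have [Sn Dn] : S != 0 /\ D != 0 by split; rewrite gt_eqF.
  by field; rewrite Sn Dn.
apply: lerD.
  apply: (le_trans (nmD _ _)); rewrite !nmM.
  have := r1P h h1; have := r2P h h2.
  set x := nm (_ - _ - _); set y := nm (_ - _ - _); set q := e / _ * nm h => yq xq.
  have q0 : 0 <= q by rewrite mulr_ge0 ?nm_ge0// ltW.
  apply: (@le_trans _ _ (q * nm (g a) + nm (f a) * q)).
    by apply: lerD; [rewrite ler_wpM2r ?nm_ge0 | rewrite ler_wpM2l ?nm_ge0].
  by rewrite /S; nra.
rewrite nmM; have := r3P h h3; have := r4P h h4.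
move=> A1 A2; apply: (le_trans (ler_pM (nm_ge0 _) (nm_ge0 _) A2 A1)).
have -> : (nm d + 1) * nm h * ((nm d' + 1) * nm h) = nm h * (D * nm h) by rewrite /D; ring.
by apply: ler_wpM2r (ltW h5); rewrite mulr_ge0 ?nm_ge0// ltW.
Qed.

Lemma cderX g a d n : cder g a d -> cder (fun z => g z ^+ n) a (n%:R * g a ^+ n.-1 * d).
Proof.
move=> gd; elim: n => [|n IH].
  by rewrite !mul0r; apply: hasd_near (cder_cst 1 a) => [|h _]; rewrite ?expr0 ?ltr01.
have -> : n.+1%:R * g a ^+ n.+1.-1 * d = d * g a ^+ n + g a * (n%:R * g a ^+ n.-1 * d).
  by rewrite -natr1/=; case: n {IH} => [|n]; rewrite ?exprS; ring.
by apply: hasd_near (cderM gd IH) => [|h _]; rewrite ?exprS ?ltr01.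
Qed.

Lemma cder_inv a : a != 0 -> cder (fun z => z^-1) a (- a^-1 ^+ 2).
Proof.
move=> a0 e e0; have na : 0 < nm a by rewrite nm_gt0.
exists (Num.min (nm a / 2) (e * nm a ^+ 3 / 2)).
  by rewrite lt_min !divr_gt0// mulr_gt0// exprn_gt0.
move=> h; rewrite lt_min => /andP[h1 h2].
have ah : nm a / 2 <= nm (a + h).
  by have := nm_subl a (a + h); rewrite opprD addrA subrr add0r nmN; lra.
have ah0 : a + h != 0 by rewrite -nm_gt0; lra.
have -> : (a + h)^-1 - a^-1 - h * - a^-1 ^+ 2 = h ^+ 2 / (a ^+ 2 * (a + h)).
  by field; rewrite ah0.
rewrite nmM nmV nmM !nmX expr2 -mulrA mulrC ler_wpM2r ?nm_ge0//.
rewrite ler_pdivrMr; last by rewrite mulr_gt0 ?exprn_gt0 ?nm_gt0.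
apply: (le_trans (ltW h2)); rewrite -mulrA ler_pM2l//.
have -> : nm a ^+ 3 / 2 = nm a ^+ 2 * (nm a / 2) by ring.
by rewrite ler_pM2l// exprn_gt0.
Qed.

Lemma cderV g a d : cder g a d -> g a != 0 -> exists d', cder (fun z => (g z)^-1) a d'.
Proof.
move=> gd g0; exists (d * - (g a)^-1 ^+ 2) => e e0.
have := hasd_comp (cder_inv g0) gd (fun x y => mulrBl _ _ _) (mulr_bound _) (mulr_bound _) e0.
by case=> r r0 rP; exists r => // h /rP; rewrite /= mulrA.
Qed.

Lemma cder_comp_affine g (b c a d : C) : cder g (b + c * a) d ->
  cder (fun z => g (b + c * z)) a (c * d).
Proof.
move=> gd.
have h1 : cder (fun z => b + c * z) a c.
  have := cderD (cder_cst b a) (cderM (cder_cst c a) (cder_id a)).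
  by rewrite mul0r mulr1 !add0r.
move=> e e0.
have := hasd_comp gd h1 (fun x y => mulrBl _ _ _) (mulr_bound _) (mulr_bound _) e0.
by case=> r r0 rP; exists r => // h /rP; rewrite /= mulrA.
Qed.

End Derivative.

(** * Goursat's theorem on squares *)

Section Bisection.
Context {R : realType}.
Local Notation C := R[i].

(** The supremum of the left endpoints lies in all the intervals. *)
Lemma nested_intervals (x h : nat -> R) :
  (forall n, 0 <= h n) ->
  (forall n, x n <= x n.+1 /\ x n.+1 + h n.+1 <= x n + h n) ->
  exists s, forall n, x n <= s <= x n + h n.
Proof.
move=> h0 mono.
have lo m n : x n <= x (n + m)%N.
  by elim: m => [|m IH]; rewrite ?addn0// addnS (le_trans IH)// (mono _).1.
have hi m n : x (n + m)%N + h (n + m)%N <= x n + h n.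
  by elim: m => [|m IH]; rewrite ?addn0// addnS (le_trans (mono _).2).
have xh m n : x m <= x n + h n.
  have [mn|/ltnW nm] := leqP m n.
    by rewrite -(subnKC mn) (le_trans (lo (n - m)%N m))// lerDl.
  by rewrite -(subnKC nm) (le_trans _ (hi (m - n)%N n))// lerDl.
exists (sup [set x n | n in setT]) => n; apply/andP; split.
  apply: sup_upper_bound; last by exists n.
  by split; [exists (x 0%N), 0%N | exists (x 0%N + h 0%N) => _ [m _ <-]].
by apply: ge_sup; [exists (x 0%N), 0%N | move=> _ [m _ <-]].
Qed.

Definition square (c : C) (h : R) : set C :=
  [set z | complex.Re c <= complex.Re z <= complex.Re c + h /\
           complex.Im c <= complex.Im z <= complex.Im c + h].

(** A property that every square passes on to one of its quarters holds on
    squares shrinking to a point.  It is used for Goursat's theorem and, in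
    place of compactness, for the attainment of maxima on discs. *)
Lemma square_bisection (P : C -> R -> Prop) (c : C) (h : R) :
  0 < h -> P c h ->
  (forall c h, 0 < h -> P c h ->
     exists c', square c (h / 2) c' /\ P c' (h / 2)) ->
  exists a, square c h a /\ forall d, 0 < d ->
    exists c' h', [/\ 0 < h', h' < d, square c' h' a, P c' h' &
      square c' h' `<=` square c h].
Proof.
move=> h0 Pch step.
pose good (s : C * R) := 0 < s.2 /\ P s.1 s.2.
have nxP (s : C * R) : exists s' : C * R, good s ->
    [/\ good s', s'.2 = s.2 / 2 & square s.1 (s.2 / 2) s'.1].
  case: (pselect (good s)) => [[s0 Ps]|ng]; last by exists s.
  have [c' [c'q Pc']] := step _ _ s0 Ps.
  by exists (c', s.2 / 2) => _; split => //; split => //=; rewrite divr_gt0.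
have [nx nxE] := choice nxP.
pose s n := iter n nx (c, h).
have gs n : good (s n).
  by elim: n => [|n IH]; [split | have [] := nxE _ IH].
have sS n : (s n.+1).2 = (s n).2 / 2 /\ square (s n).1 ((s n).2 / 2) (s n.+1).1.
  by have [_ ? ?] := nxE _ (gs n).
have hn n : (s n).2 = h / 2 ^+ n.
  elim: n => [|n IH]; first by rewrite expr0 divr1.
  by rewrite (sS n).1 IH exprS invfM; ring.
have [x xP] : exists x, forall n,
    complex.Re (s n).1 <= x <= complex.Re (s n).1 + (s n).2.
  apply: nested_intervals => n; first by rewrite ltW// (gs n).1.
  by have [-> [/andP[]]] := sS n; lra.
have [y yP] : exists x, forall n,
    complex.Im (s n).1 <= x <= complex.Im (s n).1 + (s n).2.
  apply: nested_intervals => n; first by rewrite ltW// (gs n).1.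
  by have [-> [_ /andP[]]] := sS n; lra.
have sub n : square (s n).1 (s n).2 `<=` square c h.
  elim: n => [//|n IH] z zs; apply: IH; move: zs; rewrite /square/=.
  have := sS n; have := (gs n).1.
  by move=> ? [-> [/andP[? ?] /andP[? ?]]] [/andP[? ?] /andP[? ?]]; split; lra.
exists (x +i* y); split; first by have := conj (xP 0%N) (yP 0%N).
move=> d d0; pose n := (Num.truncn (h / d)).+1.
have hd : h / d < 2 ^+ n.
  have h1 : h / d < n%:R.
    by have := truncnS_gt (h / d); rewrite /n -natr1; lra.
  by apply: (lt_le_trans h1); rewrite -natrX ler_nat ltnW// ltn_expl.
exists (s n).1, (s n).2; split.
- exact: (gs n).1.
- by rewrite hn ltr_pdivrMr ?exprn_gt0// mulrC -ltr_pdivrMr.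
- by split; [exact: xP | exact: yP].
- exact: (gs n).2.
- exact: sub.
Qed.

End Bisection.

Section Goursat.
Context {R : realType}.
Local Notation C := R[i].
Implicit Types (g : C -> C) (u v c z : C) (h : R) (m : nat).

(** A Riemann sum of g along the segment from u to v with 2 ^ m equal pieces, g
    being sampled at their midpoints.  Midpoints make the sum exact for affine g, and
    the dyadic recursion makes the subdivision of squares an algebraic identity. *)
Fixpoint pathsum g m u v : C :=
  if m is m'.+1 then pathsum g m' u ((u + v) / 2) + pathsum g m' ((u + v) / 2) v
  else g ((u + v) / 2) * (v - u).

Lemma pathsum_rev g m u v : pathsum g m v u = - pathsum g m u v.
Proof.
elim: m u v => [|m IH] u v /=; first by (rewrite (addrC v u); ring).
by rewrite (addrC v u) (IH _ v) (IH u); ring.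
Qed.

Lemma pathsumB g1 g2 m u v :
  pathsum (fun z => g1 z - g2 z) m u v = pathsum g1 m u v - pathsum g2 m u v.
Proof. by elim: m u v => [|m IH] u v /=; rewrite ?IH; ring. Qed.

Lemma pathsum_affine (a b : C) m u v :
  pathsum (fun z => a + z * b) m u v = a * (v - u) + (v ^+ 2 - u ^+ 2) / 2 * b.
Proof. by elim: m u v => [|m IH] u v /=; rewrite ?IH; field. Qed.

Lemma pathsum_le g m u v (K : set C) (M : R) :
  (forall a b, K a -> K b -> K ((a + b) / 2)) -> (forall z, K z -> nm (g z) <= M) ->
  K u -> K v -> nm (pathsum g m u v) <= M * nm (v - u).
Proof.
move=> Kmid KM; have Khalf a b : nm (b - (a + b) / 2) = nm (b - a) / 2 :> R.
  have -> : b - (a + b) / 2 = (b - a) * (2^-1 : R)%:C.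
    by rewrite -half_real; field.
  by rewrite nmM nm_real ger0_norm// invr_ge0.
elim: m u v => [|m IH] u v Ku Kv /=.
  by rewrite nmM; apply: ler_wpM2r; [exact: nm_ge0 | apply: KM; exact: Kmid].
have Kuv := Kmid _ _ Ku Kv.
apply: (le_trans (nmD _ _)).
apply: (le_trans (lerD (IH _ _ Ku Kuv) (IH _ _ Kuv Kv))).
have := Khalf v u; rewrite nmB (addrC v u) (nmB u v) => ->.
by rewrite Khalf -mulrDr -splitr.
Qed.

Definition contour g m c h : C :=
  pathsum g m c (c + h%:C) + pathsum g m (c + h%:C) (c + h%:C + 'i%C * h%:C) +
  pathsum g m (c + h%:C + 'i%C * h%:C) (c + 'i%C * h%:C) + pathsum g m (c + 'i%C * h%:C) c.

(** Each of the four inner half-sides is traversed once in each direction, and these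
    contributions cancel. *)
Lemma contour_subdiv g m c h : let t := (h / 2)%:C in
  contour g m.+1 c h = contour g m c (h / 2) + contour g m (c + t) (h / 2) +
    contour g m (c + t + 'i%C * t) (h / 2) + contour g m (c + 'i%C * t) (h / 2).
Proof.
move=> t; have ht : h%:C = t + t by rewrite -rmorphD -splitr.
rewrite /contour /= -/t ht.
set i := 'i%C.
have -> : (c + (c + (t + t))) / 2 = c + t by field.
have -> : (c + (t + t) + (c + (t + t) + i * (t + t))) / 2 = c + (t + t) + i * t.
  by field.
have -> : (c + (t + t) + i * (t + t) + (c + i * (t + t))) / 2 = c + t + i * (t + t).
  by field.
have -> : (c + i * (t + t) + c) / 2 = c + i * t by field.
rewrite !mulrDr !addrA (addrAC c (i * t) t).
rewrite (addrAC (c + t) (i * t) t).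
rewrite (pathsum_rev _ _ (c + t) (c + t + i * t)).
rewrite (pathsum_rev _ _ (c + t + i * t) (c + t + t + i * t)).
rewrite (pathsum_rev _ _ (c + t + i * t) (c + t + i * t + i * t)).
rewrite (pathsum_rev _ _ (c + i * t) (c + t + i * t)).
ring.
Qed.

Definition boundary c h : set C := [set z | square c h z /\
  [\/ complex.Im z = complex.Im c, complex.Re z = complex.Re c + h,
      complex.Im z = complex.Im c + h | complex.Re z = complex.Re c]].

(** The four sides are treated uniformly through the last clause: about the
    centre of the square each of them sweeps the same oriented area. *)
Lemma contour_sides (Q : C -> C -> Prop) c h : 0 <= h ->
  (forall u v (K : set C), (forall a b, K a -> K b -> K ((a + b) / 2)) ->
     (K `<=` boundary c h) -> K u -> K v -> nm (v - u) = h ->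
     (forall z, K z -> complex.Im ((v - u) * (z - (c + (h / 2)%:C + 'i%C * (h / 2)%:C))^*%C)
        = h ^+ 2 / 2) ->
     Q u v) ->
  [/\ Q c (c + h%:C), Q (c + h%:C) (c + h%:C + 'i%C * h%:C),
      Q (c + h%:C + 'i%C * h%:C) (c + 'i%C * h%:C) & Q (c + 'i%C * h%:C) c].
Proof.
move=> h0 QK.
have i1 : nm ('i%C : C) = 1 by rewrite /nm/= expr0n expr1n add0r sqrtr1.
split.
- apply: (QK _ _ [set z | square c h z /\ complex.Im z = complex.Im c]).
  + by move=> a b [[? ?] ?] [[? ?] ?]; rewrite /square /mkset !Re_half !Im_half !Cex; split; [split|]; lra.
  + by move=> z [? ?]; split => //; constructor 1.
  + by rewrite /square/=; split; [split|]; lra.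
  + by rewrite /square/= !Cex/=; split; [split|]; lra.
  + by rewrite addrAC subrr add0r nm_real ger0_norm.
  + by move=> z [_ ze]; rewrite !Cex/= ze; field.
- apply: (QK _ _ [set z | square c h z /\ complex.Re z = complex.Re c + h]).
  + by move=> a b [[? ?] ?] [[? ?] ?]; rewrite /square /mkset !Re_half !Im_half !Cex; split; [split|]; lra.
  + by move=> z [? ?]; split => //; constructor 2.
  + by rewrite /square/= !Cex/=; split; [split|]; lra.
  + by rewrite /square/= !Cex/=; split; [split|]; lra.
  + by rewrite addrAC subrr add0r nmM i1 mul1r nm_real ger0_norm.
  + by move=> z [_ ze]; rewrite !Cex/= ze; field.
- apply: (QK _ _ [set z | square c h z /\ complex.Im z = complex.Im c + h]).
  + by move=> a b [[? ?] ?] [[? ?] ?]; rewrite /square /mkset !Re_half !Im_half !Cex; split; [split|]; lra.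
  + by move=> z [? ?]; split => //; constructor 3.
  + by rewrite /square/= !Cex/=; split; [split|]; lra.
  + by rewrite /square/= !Cex/=; split; [split|]; lra.
  + have -> : c + 'i%C * h%:C - (c + h%:C + 'i%C * h%:C) = - h%:C by ring.
    by rewrite nmN nm_real ger0_norm.
  + by move=> z [_ ze]; rewrite !Cex/= ze; field.
- apply: (QK _ _ [set z | square c h z /\ complex.Re z = complex.Re c]).
  + by move=> a b [[? ?] ?] [[? ?] ?]; rewrite /square /mkset !Re_half !Im_half !Cex; split; [split|]; lra.
  + by move=> z [? ?]; split => //; constructor 4.
  + by rewrite /square/= !Cex/=; split; [split|]; lra.
  + by rewrite /square/=; split; [split|]; lra.
  + have -> : c - (c + 'i%C * h%:C) = - ('i%C * h%:C) by ring.
    by rewrite nmN nmM i1 mul1r nm_real ger0_norm.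
  + by move=> z [_ ze]; rewrite !Cex/= ze; field.
Qed.

Lemma contour_le g m c h (M : R) : 0 <= h ->
  (forall z, boundary c h z -> nm (g z) <= M) -> nm (contour g m c h) <= 4 * M * h.
Proof.
move=> h0 gM.
have [||q1 q2 q3 q4] := @contour_sides (fun u v => nm (pathsum g m u v) <= M * h) c h.
- by [].
- move=> u v K Kmid Kb Ku Kv vuh _; rewrite -vuh.
  by apply: (pathsum_le _ Kmid) => // z /Kb; exact: gM.
rewrite /contour.
set p1 := pathsum g m c _ in q1 *; set p2 := pathsum g m (c + h%:C) _ in q2 *.
set p3 := pathsum _ _ _ (c + _ * _) in q3 *; set p4 := pathsum _ _ _ c in q4 *.
have := nmD (p1 + p2 + p3) p4; have := nmD (p1 + p2) p3; have := nmD p1 p2; lra.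
Qed.

Lemma contour_affine (a b : C) m c h : contour (fun z => a + z * b) m c h = 0.
Proof. by rewrite /contour !pathsum_affine; field. Qed.

Lemma contourB g1 g2 m c h :
  contour (fun z => g1 z - g2 z) m c h = contour g1 m c h - contour g2 m c h.
Proof. by rewrite /contour !pathsumB; ring. Qed.

(** If the contour sums did not tend to 0, bisection would produce small squares
    around a point a whose sums exceed k h ^ 2.  Affine functions have zero contour
    sums and g is affine at a up to o(h), which bounds those sums by a smaller
    multiple of h ^ 2. *)
Lemma goursat g c h : 0 < h ->
  (forall z, square c h z -> exists d, cder g z d) ->
  forall e : R, 0 < e -> exists N, forall m, (N <= m)%N -> nm (contour g m c h) <= e.
Proof.
move=> h0 dg e e0; apply/not_existsP => bad.
pose k := e / h ^+ 2.
have k0 : 0 < k by rewrite divr_gt0// exprn_gt0.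
(* contour sums of arbitrarily fine level stay large relative to the area h ^ 2 *)
pose P c h := forall N, exists2 m, (N <= m)%N & k * h ^+ 2 < nm (contour g m c h).
have Pch : P c h.
  move=> N; have /existsNP[m /not_implyP[Nm /negP]] := bad N.
  by rewrite -ltNge => lt; exists m => //; rewrite /k divfK// expf_neq0// gt_eqF.
have [|a [aq al]] := square_bisection h0 Pch.
  move=> c1 h1 h10 Pc1; apply: contrapT => no.
  have N_of c1' : square c1 (h1 / 2) c1' -> exists N, forall m, (N <= m)%N ->
      nm (contour g m c1' (h1 / 2)) <= k * (h1 / 2) ^+ 2.
    move=> qc'; apply: contrapT => noN; apply: no; exists c1'; split=> // N.
    apply: contrapT => noM; apply: noN; exists N => m Nm; rewrite leNgt.
    by apply/negP => lt; apply: noM; exists m.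
  have [N1 N1P] : exists N, forall m, (N <= m)%N ->
      nm (contour g m c1 (h1 / 2)) <= k * (h1 / 2) ^+ 2.
    by apply: N_of; rewrite /square/=; split; lra.
  have [N2 N2P] : exists N, forall m, (N <= m)%N ->
      nm (contour g m (c1 + (h1 / 2)%:C) (h1 / 2)) <= k * (h1 / 2) ^+ 2.
    by apply: N_of; rewrite /square/= !Cex/=; split; lra.
  have [N3 N3P] : exists N, forall m, (N <= m)%N ->
      nm (contour g m (c1 + (h1 / 2)%:C + 'i%C * (h1 / 2)%:C) (h1 / 2)) <= k * (h1 / 2) ^+ 2.
    by apply: N_of; rewrite /square/= !Cex/=; split; lra.
  have [N4 N4P] : exists N, forall m, (N <= m)%N ->
      nm (contour g m (c1 + 'i%C * (h1 / 2)%:C) (h1 / 2)) <= k * (h1 / 2) ^+ 2.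
    by apply: N_of; rewrite /square/= !Cex/=; split; lra.
  have [[//|m] Nm] := Pc1 (maxn (maxn N1 N2) (maxn N3 N4)).+1.
  rewrite ltnS !geq_max -andbA in Nm; case/and4P: Nm => /N1P b1 /N2P b2 /N3P b3 /N4P b4.
  apply/negP; rewrite -leNgt contour_subdiv.
  apply: (le_trans (nmD _ _)).
  have := nmD (contour g m c1 (h1 / 2) + contour g m (c1 + (h1 / 2)%:C) (h1 / 2))
    (contour g m (c1 + (h1 / 2)%:C + 'i%C * (h1 / 2)%:C) (h1 / 2)).
  have := nmD (contour g m c1 (h1 / 2)) (contour g m (c1 + (h1 / 2)%:C) (h1 / 2)).
  have -> : k * h1 ^+ 2 = 4 * (k * (h1 / 2) ^+ 2) by field.
  move: b1 b2 b3 b4; lra.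
have [d dP] := dg a aq.
have k9 : 0 < k / 9 by rewrite divr_gt0.
have [dl dl0 dlP] := dP _ k9.
have [c' [h' [h'0 h'd qa Pc' _]]] := al (dl / 2) ltac:(lra).
have [m _] := Pc' 0%N; apply/negP; rewrite -leNgt.
have -> : contour g m c' h' =
    contour (fun z => g z - (g a - a * d + z * d)) m c' h'.
  by rewrite contourB contour_affine subr0.
apply: (@le_trans _ _ (4 * (k / 9 * (2 * h')) * h')); last first.
  by rewrite expr2; have := mulr_gt0 k0 (mulr_gt0 h'0 h'0); lra.
apply: contour_le (ltW h'0) _ => z [qz _].
have za : nm (z - a) <= 2 * h'.
  apply: (le_trans (nm_le_ReIm _)).
  move: qa qz; rewrite /square/= !Cex => -[/andP[? ?] /andP[? ?]] [/andP[? ?] /andP[? ?]].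
  have : `|complex.Re z - complex.Re a| <= h' by rewrite ler_norml; lra.
  have : `|complex.Im z - complex.Im a| <= h' by rewrite ler_norml; lra.
  by lra.
have -> : g z - (g a - a * d + z * d) = g (a + (z - a)) - g a - (z - a) * d.
  by rewrite addrCA subrr addr0; ring.
apply: (le_trans (dlP _ _)); first by lra.
by rewrite ler_wpM2l// ltW.
Qed.

Lemma pathsum_Im_ge g m u v (K : set C) (k : R) :
  (forall a b, K a -> K b -> K ((a + b) / 2)) ->
  (forall z, K z -> k <= complex.Im ((v - u) * g z)) ->
  K u -> K v -> k <= complex.Im (pathsum g m u v).
Proof.
move=> Kmid; have Khalf a b : b - (a + b) / 2 = (b - a) / 2 :> C by field.
elim: m u v k => [|m IH] u v k Kk Ku Kv /=; first by rewrite mulrC; apply: Kk; exact: Kmid.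
have Kuv := Kmid _ _ Ku Kv; rewrite cImD.
have H1 : k / 2 <= complex.Im (pathsum g m u ((u + v) / 2)).
  apply: IH => // z /Kk; have -> : (u + v) / 2 - u = (v - u) / 2 by field.
  by rewrite mulrAC Im_half; lra.
have H2 : k / 2 <= complex.Im (pathsum g m ((u + v) / 2) v).
  apply: IH => // z /Kk; have -> : v - (u + v) / 2 = (v - u) / 2 by field.
  by rewrite mulrAC Im_half; lra.
by lra.
Qed.

(** The discrete counterpart of the residue 2 pi i of 1/z.  A positive lower
    bound for the imaginary part suffices, so that neither integrals nor pi occur. *)
Lemma contour_inv_ge m c h : 0 < h ->
  4 <= complex.Im (contour (fun z => (z - (c + (h / 2)%:C + 'i%C * (h / 2)%:C))^-1) m c h).
Proof.
move=> h0; set a := c + _ + _.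
have [||q1 q2 q3 q4] := @contour_sides
  (fun u v => 1 <= complex.Im (pathsum (fun z => (z - a)^-1) m u v)) c h.
- exact: ltW.
- move=> u v K Kmid Kb Ku Kv vuh KI; apply: (pathsum_Im_ge _ Kmid) => // z Kz.
  have := KI z Kz; rewrite -/a => zI.
  have n2 : 0 < nm (z - a) ^+ 2 <= h ^+ 2 / 2.
    have [[/andP[? ?] /andP[? ?]] side] := Kb z Kz.
    have eR : complex.Re (z - a) = complex.Re z - complex.Re c - h / 2.
      by rewrite /a !Cex/=; ring.
    have eI : complex.Im (z - a) = complex.Im z - complex.Im c - h / 2.
      by rewrite /a !Cex/=; ring.
    rewrite nm_sqr eR eI.
    have sqle t : - (h / 2) <= t <= h / 2 -> t ^+ 2 <= h ^+ 2 / 4.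
      move=> /andP[t1 t2]; have : 0 <= (h / 2 - t) * (h / 2 + t) by apply: mulr_ge0; lra.
      by rewrite !expr2; lra.
    set x := complex.Re z - _ - _; set y := complex.Im z - _ - _.
    have hx : x ^+ 2 <= h ^+ 2 / 4 by apply: sqle; rewrite /x; lra.
    have hy : y ^+ 2 <= h ^+ 2 / 4 by apply: sqle; rewrite /y; lra.
    apply/andP; split; last by lra.
    have pos t : t = h / 2 \/ t = - (h / 2) -> 0 < t ^+ 2.
      by move=> [->|->]; rewrite ?sqrrN exprn_gt0// divr_gt0.
    case: side => e; [apply: ltr_wpDl|apply: ltr_wpDr|apply: ltr_wpDl|apply: ltr_wpDr];
      rewrite ?sqr_ge0//; apply: pos; rewrite /x /y e; [right|left|left|right]; lra.
  have zn : z - a != 0 by rewrite -nm_gt0; case/andP: n2; rewrite exprn_even_gt0//= lt_def nm_ge0 andbT.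
  have -> : (v - u) * (z - a)^-1 = (v - u) * (z - a)^*%C * ((nm (z - a) ^+ 2)^-1)%:C.
    rewrite fmorphV/= nm_sqrJ.
    have wn : (z - a)^*%C != 0 by rewrite conjc_eq0.
    move: (v - u) wn; move: (z - a)^*%C (z - a) zn => w q qn p wn.
    by field; rewrite qn wn.
  rewrite cImM/= mulr0 add0r zI; case/andP: n2 => p1 p2.
  by rewrite ler_pdivlMr// mul1r.
by rewrite /contour !cImD; lra.
Qed.

End Goursat.

(** * The maximum principle on discs *)

Section MaximumPrinciple.
Context {R : realType}.
Local Notation C := R[i].
Implicit Types (g : C -> C) (a z : C) (s l M : R).

(** Bernoulli's inequality for 1/t. *)
Lemma exp_small (t e : R) : 0 <= t < 1 -> 0 < e -> exists n, t ^+ n < e.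
Proof.
move=> /andP[t0 t1] e0; have [->|tn] := eqVneq t 0; first by exists 1%N; rewrite expr1.
have tp : 0 < t by rewrite lt_def tn.
pose q := t^-1 - 1; have q0 : 0 < q by rewrite subr_gt0 invf_gt1.
have tq : t^-1 = 1 + q by rewrite /q; ring.
have bern n : 1 + n%:R * q <= t^-1 ^+ n.
  rewrite tq; elim: n => [|n IH]; first by rewrite mul0r addr0.
  have nq : 0 <= n%:R * q * q by rewrite !mulr_ge0// ltW.
  rewrite exprS -natr1; have := ler_wpM2l (_ : 0 <= 1 + q) IH.
  by move=> /(_ ltac:(lra)); lra.
pose n := (Num.truncn (e^-1 / q)).+1; exists n.
have : e^-1 / q < n%:R by exact: truncnS_gt.
rewrite ltr_pdivrMr// => h.
rewrite -[t ^+ n]invrK -exprVn -[e]invrK ltf_pV2 ?posrE ?exprn_gt0 ?invr_gt0//.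
by apply: lt_le_trans (bern n); lra.
Qed.

(** The double zero cancels the simple pole, so the quotient is differentiable at a
    whatever value the division by zero gives there. *)
Lemma cder_sqr_div (u : C -> C) a d : cder u a d -> u a = 0 ->
  cder (fun z => u z ^+ 2 / (z - a)) a (d ^+ 2).
Proof.
move=> ud ua e e0.
pose e1 := Num.min 1 (e / (2 * nm d + 1)).
have D0 : 0 < 2 * nm d + 1 by have := nm_ge0 d; lra.
have e10 : 0 < e1 by rewrite lt_min ltr01 divr_gt0.
have [r r0 rP] := ud _ e10; exists r => // h hr.
have [->|hn] := eqVneq h 0.
  by rewrite addr0 [X in nm (X - _)]subrr mul0r subrr nm0 mulr0.
rewrite ua [a + h]addrC addrK subrr expr0n mul0r subr0.
have := rP h hr; rewrite ua subr0 (addrC a h); set w := u (h + a) - h * d => wh.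
have -> : u (h + a) = h * d + w by rewrite /w [RHS]addrC subrK.
have -> : (h * d + w) ^+ 2 / h - h * d ^+ 2 = w * (2 * d + w / h) by field.
rewrite nmM; have q : nm (2 * d + w / h) <= 2 * nm d + e1.
  apply: (le_trans (nmD _ _)); rewrite !nmM nmV.
  have -> : nm (2 : C) = 2.
    by rewrite -(rmorph_nat (real_complex R)) nm_real ger0_norm.
  by rewrite lerD2l ler_pdivrMr ?nm_gt0.
have e11 : e1 <= 1 by rewrite ge_min lexx.
have e1e : e1 * (2 * nm d + 1) <= e by rewrite -ler_pdivlMr// ge_min lexx orbT.
apply: (le_trans (ler_pM (nm_ge0 _) (nm_ge0 _) wh q)).
rewrite mulrAC ler_wpM2r ?nm_ge0//; apply: le_trans e1e.
by rewrite ler_pM2l// lerD2l.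
Qed.

(** Normalise G = g / g(a).  For large n the function H = (G ^ n - 1)^2 / (z - a)
    is holomorphic on the square, a included, and on the boundary it is uniformly close to
    1/(z - a).  Goursat's theorem makes the contour sums of H small, whereas those of
    1/(z - a) have imaginary part at least 4. *)
Lemma no_peak_square g a l (t : R) : 0 < l -> 0 <= t < 1 -> g a != 0 ->
  let c := a - (l%:C + 'i%C * l%:C) in
  (forall z, square c (2 * l) z -> exists d, cder g z d) ->
  (forall z, boundary c (2 * l) z -> nm (g z) <= t * nm (g a)) -> False.
Proof.
move=> l0 t01 ga c dg gt; have l20 : 0 < 2 * l by lra.
have ac : a = c + (2 * l / 2)%:C + 'i%C * (2 * l / 2)%:C.
  by have -> : 2 * l / 2 = l; [field | rewrite /c; ring].
(* on the boundary H differs from 1/(z - a) by at most 3 * t ^ n / l; with 3 * t ^ n <= 1/4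
   the contour sums differ by at most 2, and 1 + 2 < 4 *)
have [//|n tn] := exp_small t01 (_ : 0 < 24^-1); first by rewrite invr_gt0.
have [t0 _] := andP t01.
pose G z := g z / g a.
have Ga : G a = 1 by rewrite /G divff.
have dG z : square c (2 * l) z -> exists d, cder (fun z => G z ^+ n - 1) z d.
  move=> /dg[d gd]; eexists.
  by apply: (cderB (cderX n (cderM gd (cder_cst (g a)^-1 z))) (cder_cst 1 z)).
pose H z := (G z ^+ n - 1) ^+ 2 / (z - a).
have dH z : square c (2 * l) z -> exists d, cder H z d.
  move=> qz; have [d Gd] := dG z qz; have [za|za] := eqVneq z a.
    exists (d ^+ 2); rewrite za in Gd *; apply: cder_sqr_div Gd _.
    by rewrite Ga expr1n subrr.
  have [|d' dV] := cderV (cderB (cder_id z) (cder_cst a z)) _.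
    by rewrite subr_eq0.
  by eexists; apply: cderM (cderX 2 Gd) dV.
have [N NP] := goursat l20 dH ltr01.
have := NP N (leqnn _); set S := contour H N c (2 * l) => S1.
pose rest z := H z - (z - a)^-1.
have restS : nm (contour rest N c (2 * l)) <= 2.
  apply: (@le_trans _ _ (4 * (4^-1 / l) * (2 * l))); last first.
    by rewrite le_eqVlt; apply/orP; left; apply/eqP; field; rewrite gt_eqF.
  apply: contour_le (ltW l20) _ => z bz.
  have nza : l <= nm (z - a).
    case: bz => [_ side]; have eR : complex.Re (z - a) = complex.Re z - complex.Re c - l.
      by rewrite ac !Cex/=; field.
    have eI : complex.Im (z - a) = complex.Im z - complex.Im c - l.
      by rewrite ac !Cex/=; field.
    case: side => e.
    + by apply: le_trans (Im_le_nm _); rewrite eI e ler_normr; apply/orP; right; lra.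
    + by apply: le_trans (Re_le_nm _); rewrite eR e ler_normr; apply/orP; left; lra.
    + by apply: le_trans (Im_le_nm _); rewrite eI e ler_normr; apply/orP; left; lra.
    + by apply: le_trans (Re_le_nm _); rewrite eR e ler_normr; apply/orP; right; lra.
  have -> : rest z = G z ^+ n * (G z ^+ n - 2) / (z - a) by rewrite /rest /H; ring.
  have Gz : nm (G z) <= t.
    by rewrite /G nmM nmV ler_pdivrMr ?nm_gt0//; exact: gt.
  have Gzn : nm (G z ^+ n) <= t ^+ n by rewrite nmX lerXn2r ?nnegrE ?nm_ge0.
  have G3 : nm (G z ^+ n - 2) <= 3.
    apply: (le_trans (nmD _ _)); rewrite nmN.
    have -> : nm (2 : C) = 2.
      by rewrite -(rmorph_nat (real_complex R)) nm_real ger0_norm.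
    by lra.
  rewrite !nmM nmV; apply: ler_pM; rewrite ?invr_ge0 ?mulr_ge0 ?nm_ge0//.
    have := ler_pM (nm_ge0 _) (nm_ge0 _) Gzn G3; lra.
  by rewrite lef_pV2 ?posrE//; lra.
have := contour_inv_ge N c l20; rewrite -ac.
have -> : contour (fun z => (z - a)^-1) N c (2 * l) =
    S - contour rest N c (2 * l).
  rewrite /S -contourB; congr contour; apply/funext => z; rewrite /rest; ring.
rewrite cImB; have := ler_norm (complex.Im S); have := Im_le_nm S.
have := ler_norm (- complex.Im (contour rest N c (2 * l))); rewrite normrN.
have := Im_le_nm (contour rest N c (2 * l)); move: restS S1.
lra.
Qed.

Lemma square_quarters (c y : C) (h : R) : square c h y ->
  [\/ square c (h / 2) y, square (c + (h / 2)%:C) (h / 2) y,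
      square (c + (h / 2)%:C + 'i%C * (h / 2)%:C) (h / 2) y |
      square (c + 'i%C * (h / 2)%:C) (h / 2) y].
Proof.
rewrite /square/mkset !Cex/= => -[/andP[r1 r2] /andP[i1 i2]].
case: (lerP (complex.Re y) (complex.Re c + h / 2)) => [r3|/ltW r3];
case: (lerP (complex.Im y) (complex.Im c + h / 2)) => [i3|/ltW i3].
- by constructor 1; split; lra.
- by constructor 4; split; lra.
- by constructor 2; split; lra.
- by constructor 3; split; lra.
Qed.

(** Bisection: if for each quarter of a square some value of f exceeded all values on that
    quarter, the largest of these four values would exceed f on the whole square. *)
Lemma disc_max (f : C -> R) s : 0 < s ->
  (forall z, nm z <= s -> forall e : R, 0 < e -> exists2 d : R, 0 < d &
    forall w, nm (w - z) < d -> `|f w - f z| < e) ->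
  exists2 a, nm a <= s & forall z, nm z <= s -> f z <= f a.
Proof.
move=> s0 cf.
(* the supremum of f over the disc is approached inside the square *)
pose P c h := forall x, nm x <= s -> exists y, [/\ nm y <= s, square c h y & f x <= f y].
pose c0 : C := - (s%:C + 'i%C * s%:C).
have [||c h h0 Pch|a [_ al]] := @square_bisection _ P c0 (2 * s).
- by lra.
- move=> x xs; exists x; split => //; rewrite /square /mkset /c0 !Cex/=.
  have := le_trans (Re_le_nm x) xs; have := le_trans (Im_le_nm x) xs.
  by rewrite !ler_norml; split; lra.
- apply: contrapT => no.
  have bad c' : square c (h / 2) c' -> exists x, nm x <= s /\
      forall y, nm y <= s -> square c' (h / 2) y -> f y < f x.
    move=> qc'; apply: contrapT => nox; apply: no; exists c'; split => // x xs.
    apply: contrapT => noy; apply: nox; exists x; split => // y ys qy.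
    by rewrite ltNge; apply/negP => xy; apply: noy; exists y.
  have top x1 x2 : nm x1 <= s -> nm x2 <= s ->
      exists x, [/\ nm x <= s, f x1 <= f x & f x2 <= f x].
    by move=> s1 s2; case: (lerP (f x1) (f x2)) => [?|/ltW ?]; [exists x2|exists x1].
  have [x1 [s1 b1]] : exists x, nm x <= s /\
      forall y, nm y <= s -> square c (h / 2) y -> f y < f x.
    by apply: bad; rewrite /square/=; split; lra.
  have [x2 [s2 b2]] : exists x, nm x <= s /\
      forall y, nm y <= s -> square (c + (h / 2)%:C) (h / 2) y -> f y < f x.
    by apply: bad; rewrite /square/= !Cex/=; split; lra.
  have [x3 [s3 b3]] : exists x, nm x <= s /\
      forall y, nm y <= s -> square (c + (h / 2)%:C + 'i%C * (h / 2)%:C) (h / 2) y -> f y < f x.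
    by apply: bad; rewrite /square/= !Cex/=; split; lra.
  have [x4 [s4 b4]] : exists x, nm x <= s /\
      forall y, nm y <= s -> square (c + 'i%C * (h / 2)%:C) (h / 2) y -> f y < f x.
    by apply: bad; rewrite /square/= !Cex/=; split; lra.
  have [x12 [s12 h1 h2]] := top _ _ s1 s2; have [x34 [s34 h3 h4]] := top _ _ s3 s4.
  have [x [xs h12 h34]] := top _ _ s12 s34.
  have [y [ys /square_quarters yq xy]] := Pch x xs.
  have up x' : f x' <= f x -> f y < f x' -> False.
    by move=> x'x yx'; have := lt_le_trans yx' (le_trans x'x xy); rewrite ltxx.
  case: yq => [/(b1 y ys)|/(b2 y ys)|/(b3 y ys)|/(b4 y ys)]; apply: up.
  + exact: le_trans h1 h12.
  + exact: le_trans h2 h12.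
  + exact: le_trans h3 h34.
  + exact: le_trans h4 h34.
have near (d : R) : 0 < d -> forall x, nm x <= s ->
    exists y, [/\ nm y <= s, nm (y - a) < d & f x <= f y].
  move=> d0 x xs; have [c' [h' [h'0 h'd qa Pc' _]]] := al (d / 2) ltac:(lra).
  have [y [ys qy xy]] := Pc' x xs; exists y; split => //.
  apply: (le_lt_trans (nm_le_ReIm _)).
  move: qa qy; rewrite /square/= !Cex => -[/andP[? ?] /andP[? ?]] [/andP[? ?] /andP[? ?]].
  have : `|complex.Re y - complex.Re a| <= h' by rewrite ler_norml; lra.
  have : `|complex.Im y - complex.Im a| <= h' by rewrite ler_norml; lra.
  by lra.
have as_ : nm a <= s.
  rewrite leNgt; apply/negP => sa; have s00 : nm (0 : C) <= s by rewrite nm0 ltW.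
  have [y [ys ya _]] := near (nm a - s) ltac:(lra) 0 s00.
  by have := nm_subl a y; rewrite nmB; lra.
exists a => // z zs; rewrite leNgt; apply/negP => az.
have [d d0 dP] := cf a as_ (f z - f a) ltac:(lra).
have [y [ys ya zy]] := near d d0 z zs.
by have := dP y ya; have := ler_norm (f y - f a); lra.
Qed.

End MaximumPrinciple.

Section MaximumPrinciple2.
Context {R : realType}.
Local Notation C := R[i].
Implicit Types (g : C -> C) (a z : C) (s l M : R).

Lemma nm_sqr_D (a d : C) :
  nm (a + d) ^+ 2 = nm a ^+ 2 + 2 * complex.Re (a^*%C * d) + nm d ^+ 2.
Proof. by rewrite !nm_sqr !Cex; ring. Qed.

Lemma cder_sqr_cont g z d : cder g z d -> forall e : R, 0 < e ->
  exists2 r : R, 0 < r & forall w, nm (w - z) < r -> `|nm (g w) ^+ 2 - nm (g z) ^+ 2| < e.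
Proof.
move=> gd e e0; have [r r0 rP] := cder_lip gd.
pose K := nm d + 1; have K0 : 0 < K by rewrite /K; have := nm_ge0 d; lra.
pose D := 2 * nm (g z) + 1; have D0 : 0 < D by rewrite /D; have := nm_ge0 (g z); lra.
exists (Num.min r (Num.min (1 / K) (e / (K * D)))).
  by rewrite !lt_min r0 !divr_gt0// mulr_gt0.
move=> w; rewrite !lt_min => /andP[wr /andP[w1 w2]].
have := rP _ wr; rewrite (addrC z) subrK -/K => gw.
rewrite ltr_pdivlMr// mulrC in w1; rewrite ltr_pdivlMr ?mulr_gt0// mulrA (mulrC _ K) in w2.
have t1 : `|nm (g w) - nm (g z)| <= nm (g w - g z).
  have := nm_subl (g w) (g z); have := nm_subl (g z) (g w); rewrite (nmB (g z)).
  by rewrite ler_norml; lra.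
rewrite subr_sqr normrM (ger0_norm (addr_ge0 (nm_ge0 _) (nm_ge0 _))).
apply: le_lt_trans w2; apply: ler_pM => //; rewrite ?addr_ge0 ?nm_ge0//.
  exact: le_trans t1 gw.
by have := nm_subl (g w) (g z); rewrite /D; lra.
Qed.

(** If g exceeded M inside, |g|^2 + eta |z|^2 would for small eta attain its maximum
    at an interior point a.  The factor 1 + tau conj(a) (z - a) compensates the first
    order change of eta |z|^2 there, and what remains is a strict peak of
    |g (1 + tau conj(a) (z - a))| at the centre of a small square. *)
Lemma max_disc g s M : 0 < s -> (forall z, nm z <= s -> exists d, cder g z d) ->
  (forall z, nm z = s -> nm (g z) <= M) -> forall z, nm z <= s -> nm (g z) <= M.
Proof.
move=> s0 dg gM b bs; rewrite leNgt; apply/negP => Mb.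
have M0 : 0 <= M.
  by apply: le_trans (nm_ge0 _) (gM s%:C _); rewrite nm_real ger0_norm// ltW.
have s20 : 0 < s ^+ 2 by rewrite exprn_gt0.
have Mb2 : M ^+ 2 < nm (g b) ^+ 2 by rewrite ltrXn2r// nnegrE ?nm_ge0.
(* eta |z|^2 moves values by at most a quarter of the gap, so the perturbed maximum is
   not attained on the circle *)
pose eta := (nm (g b) ^+ 2 - M ^+ 2) / (4 * s ^+ 2).
have eta0 : 0 < eta by rewrite divr_gt0 ?subr_gt0 ?mulr_gt0.
have etas : eta * s ^+ 2 = (nm (g b) ^+ 2 - M ^+ 2) / 4 by rewrite /eta; field; rewrite gt_eqF.
pose f z := nm (g z) ^+ 2 + eta * nm z ^+ 2.
have [z zs e e0|a as_ amax] := @disc_max R f s s0.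
  have e20 : 0 < e / 2 by lra.
  have [d gd] := dg z zs; have [r1 r10 r1P] := cder_sqr_cont gd e20.
  have e30 : 0 < e / 2 / eta by rewrite divr_gt0.
  have [r2 r20 r2P] := cder_sqr_cont (cder_id z) e30.
  exists (Num.min r1 r2); first by rewrite lt_min r10.
  move=> w; rewrite lt_min => /andP[/r1P h1 /r2P h2].
  have -> : f w - f z = (nm (g w) ^+ 2 - nm (g z) ^+ 2) + eta * (nm w ^+ 2 - nm z ^+ 2).
    by rewrite /f; ring.
  apply: (le_lt_trans (ler_normD _ _)); rewrite normrM (gtr0_norm eta0).
  by move: h2; rewrite ltr_pdivlMr// mulrC; lra.
have n2s z : nm z <= s -> nm z ^+ 2 <= s ^+ 2 by move=> ?; rewrite lerXn2r// nnegrE ?nm_ge0// ltW.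
have n2e z : nm z <= s -> eta * nm z ^+ 2 <= eta * s ^+ 2 by move=> /n2s ?; rewrite ler_pM2l.
pose A := nm (g a) ^+ 2.
have bA : nm (g b) ^+ 2 <= A + eta * s ^+ 2.
  have := amax b bs; rewrite /f -/A; have := n2e a as_.
  have : 0 <= eta * nm b ^+ 2 by rewrite mulr_ge0 ?sqr_ge0// ltW.
  by lra.
have M20 : 0 <= M ^+ 2 by rewrite sqr_ge0.
have A0 : 0 < A by lra.
have asl : nm a < s.
  rewrite lt_neqAle as_ andbT; apply/negP => /eqP as'.
  have : A <= M ^+ 2 by rewrite lerXn2r ?nnegrE ?nm_ge0// gM.
  by lra.
have ga0 : g a != 0 by rewrite -nm_gt0 lt_def nm_ge0 andbT; apply: contraTneq A0 => g0; rewrite /A g0 expr0n ltxx.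
pose tau := eta / A; have tau0 : 0 < tau by rewrite divr_gt0.
have taus : tau * s ^+ 2 <= 3^-1.
  by rewrite /tau mulrAC etas ler_pdivrMr//; lra.
pose l := Num.min ((s - nm a) / 4) ((16 * tau * s)^-1).
have ts0 : 0 < 16 * tau * s by do 2![apply: mulr_gt0 => //].
have l0 : 0 < l by rewrite lt_min invr_gt0 ts0 andbT; lra.
have l1 : 2 * l <= (s - nm a) / 2.
  have : l <= (s - nm a) / 4 by rewrite ge_min lexx.
  by lra.
have l2 : tau * s * (2 * l) <= 8^-1.
  have : l <= (16 * tau * s)^-1 by rewrite ge_min lexx orbT.
  rewrite -(ler_pM2l ts0) mulfV ?gt_eqF//.
  by lra.
have l3 : tau * l ^+ 2 < 1.
  have ls : l <= s by have := nm_ge0 a; lra.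
  have : tau * l ^+ 2 <= tau * s ^+ 2 by rewrite ler_pM2l// lerXn2r// nnegrE ltW.
  by lra.
have l30 : 0 < tau * l ^+ 2 by rewrite mulr_gt0// exprn_gt0.
pose w z := 1 + tau%:C * a^*%C * (z - a).
pose t := Num.sqrt (1 - tau * l ^+ 2 / 3).
have t2 : t ^+ 2 = 1 - tau * l ^+ 2 / 3 by rewrite sqr_sqrtr//; lra.
have t0 : 0 <= t by rewrite sqrtr_ge0.
have near z : square (a - (l%:C + 'i%C * l%:C)) (2 * l) z -> nm (z - a) <= 2 * l.
  move=> [/andP[q1 q2] /andP[q3 q4]]; apply: (le_trans (nm_le_ReIm _)).
  move: q1 q2 q3 q4; rewrite !Cex/= => q1 q2 q3 q4.
  have : `|complex.Re z - complex.Re a| <= l by rewrite ler_norml; lra.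
  have : `|complex.Im z - complex.Im a| <= l by rewrite ler_norml; lra.
  by lra.
have nears z : nm (z - a) <= 2 * l -> nm z <= s.
  by move=> za; have := nm_subl z a; lra.
apply: (@no_peak_square R (fun z => g z * w z) a l t l0).
- rewrite t0/=; apply: contraTT (_ : t ^+ 2 < 1); last by rewrite t2; lra.
  by rewrite -!leNgt => ?; rewrite -[leLHS](expr1n _ 2) lerXn2r ?nnegrE.
- by rewrite /w subrr mulr0 addr0 mulr1.
- move=> z /near/nears/dg[d gd]; eexists; apply: cderM gd _.
  apply: cderD (cder_cst 1 z) _; apply: cderM (cder_cst _ z) _.
  exact: cderB (cder_id z) (cder_cst a z).
move=> z [qz side].
have za := near z qz; have zs := nears z za; set d := z - a in za.
have dl : l <= nm d.
  have eR : complex.Re d = complex.Re z - complex.Re (a - (l%:C + 'i%C * l%:C)) - l.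
    by rewrite /d !Cex/=; ring.
  have eI : complex.Im d = complex.Im z - complex.Im (a - (l%:C + 'i%C * l%:C)) - l.
    by rewrite /d !Cex/=; ring.
  case: side => e.
  + by apply: le_trans (Im_le_nm _); rewrite eI e ler_normr; apply/orP; right; lra.
  + by apply: le_trans (Re_le_nm _); rewrite eR e ler_normr; apply/orP; left; lra.
  + by apply: le_trans (Im_le_nm _); rewrite eI e ler_normr; apply/orP; left; lra.
  + by apply: le_trans (Re_le_nm _); rewrite eR e ler_normr; apply/orP; right; lra.
have -> : w a = 1 by rewrite /w subrr mulr0 addr0.
rewrite mulr1 -(@ler_pXn2r _ 2)// ?nnegrE ?nm_ge0 ?mulr_ge0 ?nm_ge0//.
rewrite exprMn -/A t2 nmM exprMn.
pose rho := complex.Re (a^*%C * d); pose D := nm d ^+ 2.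
have gz : nm (g z) ^+ 2 <= A * (1 - (2 * rho * tau + tau * D)).
  have := amax z zs; rewrite /f -/A.
  have -> : nm z ^+ 2 = nm a ^+ 2 + 2 * rho + D by rewrite -nm_sqr_D /d addrC subrK.
  have -> : A * (1 - (2 * rho * tau + tau * D)) = A - eta * (2 * rho + D).
    by rewrite /tau; field; rewrite gt_eqF.
  by lra.
have wz : nm (w z) ^+ 2 = 1 + 2 * rho * tau + tau ^+ 2 * nm a ^+ 2 * D.
  rewrite /w -/d -mulrA nm_sqr_D nm1 expr1n rmorph1 mul1r nmM nm_real gtr0_norm//.
  have -> : complex.Re (tau%:C * (a^*%C * d)) = tau * rho by rewrite cReM/= mul0r subr0.
  by rewrite nmM nmJ /D; ring.
rewrite wz.
have rhod : `|2 * rho * tau| <= 4^-1.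
  rewrite (normrM (2 * rho)) (normrM 2 rho) (gtr0_norm tau0) (ger0_norm (ler0n _ 2)).
  have : `|rho| <= s * (2 * l).
    apply: (le_trans (Re_le_nm _)); rewrite nmM nmJ.
    by apply: ler_pM => //; exact: nm_ge0.
  have : tau * (s * (2 * l)) <= 8^-1 by rewrite mulrA.
  by move=> h1 h2; have := ler_wpM2l (ltW tau0) h2; lra.
set x := 2 * rho * tau in rhod gz *.
pose X := tau * D; pose Y := tau ^+ 2 * nm a ^+ 2 * D.
have D0 : l ^+ 2 <= D by rewrite /D lerXn2r ?nnegrE ?nm_ge0// ltW.
have X0 : tau * l ^+ 2 <= X by rewrite /X ler_pM2l.
have Y0 : 0 <= Y <= X / 3.
  have Yp : 0 <= Y by apply: mulr_ge0 (sqr_ge0 _); apply: mulr_ge0 (sqr_ge0 _) (sqr_ge0 _).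
  rewrite Yp /Y /=.
  have -> : tau ^+ 2 * nm a ^+ 2 * D = (tau * nm a ^+ 2) * X by rewrite /X; ring.
  have : tau * nm a ^+ 2 <= 3^-1.
    by apply: le_trans taus; rewrite ler_pM2l//; exact: n2s.
  by move=> h; have X00 : 0 <= X := le_trans (ltW l30) X0; have := ler_wpM2r X00 h; lra.
have W0 : 0 <= 1 + x + Y by clear -rhod Y0; move: rhod Y0; rewrite ler_norml; lra.
rewrite -/Y; apply: (le_trans (ler_wpM2r W0 gz)).
rewrite -(mulrA A) (mulrC _ A); apply: (ler_wpM2l (ltW A0)); rewrite -/X.
clear -rhod Y0 X0 l30.
have xXY : - (x * (X + Y)) <= X / 3.
  have XY : 0 <= X + Y <= 4 / 3 * X by lra.
  apply: le_trans (ler_norm _) _; rewrite normrN normrM (ger0_norm (_ : 0 <= X + Y)); last by lra.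
  apply: (@le_trans _ _ (4^-1 * (4 / 3 * X))); last by lra.
  by apply: ler_pM => //; lra.
have XY0 : 0 <= X * Y by apply: mulr_ge0; lra.
have x20 : 0 <= x ^+ 2 by exact: sqr_ge0.
have -> : (1 - (x + X)) * (1 + x + Y) =
  1 - x ^+ 2 + Y - X - x * (X + Y) - X * Y by ring.
by lra.
Qed.

End MaximumPrinciple2.

(** * Schwarz lemmas with exceptional points *)

Section Schwarz.
Context {R : realType}.
Local Notation C := R[i].
Implicit Types (g phi : C -> C) (a z e : C) (s M : R).

Lemma cder_quadratic g a (K r : R) : 0 < r -> g a = 0 ->
  (forall h, nm h < r -> nm (g (a + h)) <= K * nm h ^+ 2) -> cder g a 0.
Proof.
move=> r0 ga gK e e0; pose K' := Num.max K 1.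
have K0 : 0 < K' by rewrite lt_max ltr01 orbT.
exists (Num.min r (e / K')); first by rewrite lt_min r0 divr_gt0.
move=> h; rewrite lt_min => /andP[/gK hr he]; rewrite ga mulr0 !subr0.
apply: (le_trans hr); rewrite expr2 mulrA ler_wpM2r ?nm_ge0//.
rewrite ltr_pdivlMr// in he; apply: le_trans (ltW he); rewrite mulrC.
by apply: ler_wpM2l; [exact: nm_ge0 | rewrite le_max lexx].
Qed.

(** Boundedness of g near e makes the product O(|z - e|^2), hence differentiable
    at e with derivative 0, whatever the value of g at e. *)
Lemma cder_power_punctured g e e' n (B r : R) : 0 < r ->
  (forall z, nm (z - e) < r -> z != e -> z != e' -> nm (g z) <= B) ->
  exists d, cder (fun z => g z ^+ n * ((z - e) * (z - e')) ^+ 2) e d.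
Proof.
move=> r0 gB; exists 0.
pose K := nm (e - e') + 1.
apply: (@cder_quadratic _ _ (Num.max B 0 ^+ n * K ^+ 2) (Num.min r 1)).
- by rewrite lt_min r0 ltr01.
- by rewrite subrr mul0r expr0n mulr0.
move=> h; rewrite lt_min => /andP[hr h1].
rewrite [e + h]addrC addrK.
have B0 : 0 <= Num.max B 0 by rewrite le_max lexx orbT.
have R0 : 0 <= Num.max B 0 ^+ n * K ^+ 2 * nm h ^+ 2.
  by apply: mulr_ge0 (sqr_ge0 _); apply: mulr_ge0 (sqr_ge0 _); exact: exprn_ge0.
have [->|hn] := eqVneq h 0; first by rewrite mul0r expr0n/= mulr0 nm0 expr0n mulr0.
have [->|hn'] := eqVneq (h + e) e'; first by rewrite subrr mulr0 expr0n/= mulr0 nm0.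
have gz : nm (g (h + e)) <= Num.max B 0.
  rewrite le_max; apply/orP; left; apply: gB => //; first by rewrite addrK.
  by rewrite -subr_eq0 addrK.
have zK : nm (h + e - e') <= K.
  by rewrite -addrA; apply: (le_trans (nmD _ _)); rewrite /K; lra.
rewrite nmM !nmX nmM exprMn -(mulrA (Num.max B 0 ^+ n)) (mulrC (nm h ^+ 2)).
apply: ler_pM; rewrite ?exprn_ge0 ?mulr_ge0 ?sqr_ge0 ?nm_ge0//.
  by rewrite lerXn2r ?nnegrE ?nm_ge0.
apply: ler_wpM2r; first exact: sqr_ge0.
by rewrite lerXn2r ?nnegrE ?nm_ge0// (le_trans (nm_ge0 _) zK).
Qed.

(** The n-th power trick: g ^ n times a fixed square vanishing at the exceptional
    points obeys the ordinary maximum principle, and letting n grow removes the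
    constant coming from the fixed factor. *)
Lemma max_disc_punctured g s M e1 e2 : 0 < s -> nm e1 < s -> nm e2 < s ->
  (forall z, nm z <= s -> z != e1 -> z != e2 -> exists d, cder g z d) ->
  (forall e, e = e1 \/ e = e2 -> exists B r : R, 0 < r /\
     forall z, nm (z - e) < r -> z != e1 -> z != e2 -> nm (g z) <= B) ->
  (forall z, nm z = s -> nm (g z) <= M) ->
  forall z, nm z <= s -> z != e1 -> z != e2 -> nm (g z) <= M.
Proof.
move=> s0 e1s e2s dg gb gM z0 z0s z01 z02; rewrite leNgt; apply/negP => Mg.
have M0 : 0 <= M.
  by apply: le_trans (nm_ge0 _) (gM s%:C _); rewrite nm_real ger0_norm// ltW.
pose G n z := g z ^+ n * ((z - e1) * (z - e2)) ^+ 2.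
have dG n z : nm z <= s -> exists d, cder (G n) z d.
  move=> zs; have [->|z1] := eqVneq z e1.
    have [B [r [r0 gB]]] := gb e1 (or_introl erefl).
    exact: cder_power_punctured r0 gB.
  have [->|z2] := eqVneq z e2.
    have [B [r [r0 gB]]] := gb e2 (or_intror erefl).
    have -> : G n = fun z => g z ^+ n * ((z - e2) * (z - e1)) ^+ 2.
      by apply/funext => w; rewrite /G (mulrC (w - e1)).
    by apply: cder_power_punctured r0 _ => w ? ? ?; apply: gB.
  have [d gd] := dg z zs z1 z2; eexists; apply: cderM (cderX n gd) _.
  apply: cderX; apply: cderM; apply: cderB; (exact: cder_id || exact: cder_cst).
pose Q := ((2 * s) * (2 * s)) ^+ 2; pose P := nm ((z0 - e1) * (z0 - e2)) ^+ 2.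
have Q0 : 0 < Q by rewrite exprn_gt0// !mulr_gt0.
have P0 : 0 < P.
  by rewrite exprn_gt0// nm_gt0 mulf_neq0// subr_eq0.
have GM n : nm (G n z0) <= M ^+ n * Q.
  apply: (max_disc s0 (dG n) _ z0s) => z zs.
  rewrite nmM !nmX nmM; apply: ler_pM; rewrite ?exprn_ge0 ?mulr_ge0 ?nm_ge0//.
    by rewrite lerXn2r ?nnegrE ?nm_ge0// gM.
  rewrite lerXn2r ?nnegrE ?mulr_ge0 ?nm_ge0//; try lra.
  apply: ler_pM; rewrite ?nm_ge0//; apply: (le_trans (nmD _ _)); rewrite nmN; lra.
have g0 : 0 < nm (g z0) by exact: le_lt_trans Mg.
have [|n] := @exp_small R (M / nm (g z0)) (P / Q) _ (divr_gt0 P0 Q0).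
  by rewrite divr_ge0 ?nm_ge0//= ltr_pdivrMr// mul1r.
rewrite expr_div_n ltr_pdivrMr ?exprn_gt0// mulrAC ltr_pdivlMr// => lt.
have := GM n; rewrite nmM !nmX -/P leNgt => /negP; apply.
by rewrite [X in _ < X]mulrC.
Qed.

Lemma le_mul_lim (x y s t : R) : 0 <= x -> t < s ->
  (forall s', t < s' < s -> x * s' <= y) -> x * s <= y.
Proof.
move=> x0 ts xy; rewrite leNgt; apply/negP => lt.
have xp : 0 < x.
  rewrite lt_def x0 andbT; apply: contraTneq lt => x00.
  have := xy ((t + s) / 2) ltac:(lra); rewrite x00 !mul0r => ?.
  by rewrite -leNgt.
pose s' := Num.max ((t + s) / 2) ((y / x + s) / 2).
have ys : y / x < s by rewrite ltr_pdivrMr// mulrC.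
have : x * s' <= y by apply: xy; rewrite lt_max gt_max; apply/andP; split; [apply/orP; left|apply/andP; split]; lra.
have : (y / x + s) / 2 <= s' by rewrite le_max lexx orbT.
move=> h; have := ler_pM2l xp ((y / x + s) / 2) s'; rewrite h => h2.
have : x * ((y / x + s) / 2) = (y + x * s) / 2 by field; rewrite gt_eqF.
by lra.
Qed.

(** The maximum principle for phi z / z, which is bounded near its exceptional
    points 0 and c, on circles of radius tending to s. *)
Lemma schwarz_punctured phi s M (c : C) (K r : R) : 0 < s -> 0 < r -> nm c < s ->
  (forall z, nm z < s -> z != 0 -> z != c -> exists d, cder phi z d) ->
  (forall z, nm z < s -> z != 0 -> z != c -> nm (phi z) <= M) ->
  (forall z, nm z < r -> z != c -> nm (phi z) <= K * nm z) ->
  forall t, nm t < s -> t != 0 -> t != c -> nm (phi t) * s <= M * nm t.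
Proof.
move=> s0 r0 cs dphi phiM phiK t ts t0 tc.
apply: (@le_mul_lim (nm (phi t)) (M * nm t) s (Num.max (nm c) (nm t))).
- exact: nm_ge0.
- by rewrite gt_max cs ts.
move=> s'; rewrite gt_max => /andP[/andP[cs' ts'] s's].
have s'0 : 0 < s' by apply: le_lt_trans (nm_ge0 c) cs'.
have M0 : 0 <= M by apply: le_trans (nm_ge0 _) (phiM t ts t0 tc).
rewrite -ler_pdivlMr// mulrAC -ler_pdivrMr ?nm_gt0// -nmV -nmM.
have zero : nm (0 : C) < s' by rewrite nm0.
apply: (@max_disc_punctured (fun z => phi z / z) s' (M / s') 0 c s'0 zero cs') => //.
- move=> z zs z0 zc; have [d pd] := dphi z (le_lt_trans zs s's) z0 zc.
  by have [d' vd] := cderV (cder_id z) z0; eexists; apply: cderM pd vd.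
- have near0 : forall z, nm (z - 0) < r -> z != 0 -> z != c -> nm (phi z / z) <= K.
    move=> z; rewrite subr0 => zr z0 zc; rewrite nmM nmV ler_pdivrMr ?nm_gt0//.
    exact: phiK.
  move=> e [->|->]; first by exists K, r.
  have [c00|c0] := eqVneq c 0.
    by rewrite c00; exists K, r; split => // z zr z0 _; apply: near0; rewrite ?c00.
  have nc : 0 < nm c by rewrite nm_gt0.
  exists (M / (nm c / 2)), (Num.min (nm c / 2) (s - nm c)); split.
    by rewrite lt_min divr_gt0// subr_gt0.
  move=> z; rewrite lt_min => /andP[z1 z2] z0 zc.
  have zs : nm z < s by have := nm_subl z c; lra.
  rewrite nmM nmV; apply: ler_pM; rewrite ?nm_ge0 ?invr_ge0 ?nm_ge0//; first exact: phiM.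
  rewrite lef_pV2 ?posrE ?nm_gt0 ?divr_gt0//.
  by have := nm_subl c z; rewrite nmB; lra.
- move=> z zs'; have z0 : z != 0 by rewrite -nm_gt0 zs'.
  have zc : z != c by apply: contraTneq cs' => <-; rewrite zs' ltxx.
  by rewrite nmM nmV zs' ler_wpM2r ?invr_ge0 ?(ltW s'0)// phiM// zs'.
- exact: ltW.
Qed.

Lemma schwarz phi s M : 0 < s ->
  (forall z, nm z < s -> exists d, cder phi z d) ->
  (forall z, nm z < s -> nm (phi z) <= M) -> phi 0 = 0 ->
  forall t, nm t < s -> nm (phi t) * s <= M * nm t.
Proof.
move=> s0 dphi phiM phi0 t ts.
have [->|t0] := eqVneq t 0; first by rewrite phi0 nm0 mul0r mulr0.
have zero : nm (0 : C) < s by rewrite nm0.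
have [d pd] := dphi 0 zero; have [r r0 rP] := cder_lip pd.
apply: (@schwarz_punctured phi s M 0 (nm d + 1) r s0 r0) => //.
- by move=> z zs _ _; exact: dphi.
- by move=> z zs _ _; exact: phiM.
- by move=> z /rP; rewrite add0r phi0 subr0.
Qed.

Lemma cauchy_lipschitz phi s M : 0 < s ->
  (forall z, nm z < s -> exists d, cder phi z d) ->
  (forall z, nm z < s -> nm (phi z) <= M) ->
  forall t, nm t < s -> nm (phi t - phi 0) * s <= 2 * M * nm t.
Proof.
move=> s0 dphi phiM; apply: (@schwarz (fun z => phi z - phi 0)) => //.
- by move=> z /dphi[d pd]; eexists; apply: cderB pd (cder_cst _ z).
- move=> z /phiM zM; apply: (le_trans (nmD _ _)); rewrite nmN.
  by have := phiM 0; rewrite nm0 => /(_ s0); lra.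
- exact: subrr.
Qed.

(** The maximum principle for z |-> (psi z - psi t') / (z - t'), with exceptional
    points 0 and t'.  It is applied to difference quotients, which are holomorphic in
    the step t except at t = 0. *)
Lemma lipschitz_punctured psi s M : 0 < s ->
  (forall z, nm z < s -> z != 0 -> exists d, cder psi z d) ->
  (forall z, nm z < s -> z != 0 -> nm (psi z) <= M) ->
  forall t t', nm t <= s / 4 -> nm t' <= s / 4 -> t != 0 -> t' != 0 ->
  nm (psi t - psi t') <= 8 * M / s * nm (t - t').
Proof.
move=> s0 dpsi psiM t t' ts t's t0 t'0.
have [->|tt'] := eqVneq t t'; first by rewrite !subrr nm0 mulr0.
have M0 : 0 <= M by apply: le_trans (nm_ge0 _) (psiM t _ t0); lra.
rewrite -ler_pdivrMr ?nm_gt0 ?subr_eq0// -nmV -nmM.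
have s20 : 0 < s / 2 by lra.
have zero : nm (0 : C) < s / 2 by rewrite nm0.
have t'2 : nm t' < s / 2 by lra.
apply: (@max_disc_punctured (fun z => (psi z - psi t') / (z - t')) (s / 2) _ 0 t') => //; last by lra.
- move=> z zs z0 zt'; have [|d pd] := dpsi z _ z0; first by lra.
  have [|d' vd] := cderV (cderB (cder_id z) (cder_cst t' z)) _; first by rewrite subr_eq0.
  by eexists; apply: cderM (cderB pd (cder_cst _ z)) vd.
- have n0 : 0 < nm t' by rewrite nm_gt0.
  have bd z : nm z < s -> z != 0 -> nm (psi z - psi t') <= 2 * M.
    move=> zs z0; apply: (le_trans (nmD _ _)); rewrite nmN.
    by have := psiM z zs z0; have := psiM t' ltac:(lra) t'0; lra.
  move=> e [->|->].
    exists (2 * M / (nm t' / 2)), (nm t' / 2); split; first by lra.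
    move=> z; rewrite subr0 => z1 z0 _; rewrite nmM nmV.
    apply: ler_pM; rewrite ?nm_ge0 ?invr_ge0 ?nm_ge0//; first by apply: bd => //; lra.
    have zt : nm t' / 2 <= nm (z - t') by rewrite nmB; have := nm_subl t' z; lra.
    by rewrite lef_pV2 ?posrE//; lra.
  have [|d pd] := dpsi t' _ t'0; first by lra.
  have [r r0 rP] := cder_lip pd.
  exists (nm d + 1), r; split => // z zr _ zt'.
  rewrite nmM nmV ler_pdivrMr ?nm_gt0 ?subr_eq0//.
  by have := rP _ zr; rewrite (addrC t') subrK.
- move=> z zs; have z0 : z != 0 by rewrite -nm_gt0 zs.
  rewrite nmM nmV; have -> : 8 * M / s = 2 * M * (s / 4)^-1 by field; rewrite gt_eqF.
  have zt : s / 4 <= nm (z - t') by have := nm_subl z t'; rewrite zs; lra.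
  apply: ler_pM; rewrite ?nm_ge0 ?invr_ge0 ?nm_ge0//; last by rewrite lef_pV2 ?posrE//; lra.
  apply: (le_trans (nmD _ _)); rewrite nmN.
  by have := psiM z ltac:(lra) z0; have := psiM t' ltac:(lra) t'0; lra.
Qed.

End Schwarz.

(** * The inner product and Frechet derivatives *)

Section InnerProduct.
Context {R : realType} {X : completeNormedModType R[i]}.
Context (dot : {dot X for conjC}) (dot_norm : forall x : X, dot x x = `|x| ^+ 2).
Local Notation C := R[i].
Implicit Types (x y z : X) (a : C).

Lemma dotDl x y z : dot (x + y) z = dot x z + dot y z.
Proof. by rewrite linearDl. Qed.
Lemma dotNl x z : dot (- x) z = - dot x z.
Proof. by rewrite linearNl. Qed.
Lemma dotBl x y z : dot (x - y) z = dot x z - dot y z.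
Proof. by rewrite linearBl. Qed.
Lemma dotZl a x z : dot (a *: x) z = a * dot x z.
Proof. by rewrite linearZl_LR. Qed.
Lemma dotDr x y z : dot x (y + z) = dot x y + dot x z.
Proof. by rewrite linearD. Qed.
Lemma dotNr x z : dot x (- z) = - dot x z.
Proof. by rewrite linearN. Qed.
Lemma dotBr x y z : dot x (y - z) = dot x y - dot x z.
Proof. by rewrite linearB. Qed.
Lemma dotZr a x z : dot x (a *: z) = a^*%C * dot x z.
Proof. by rewrite linearZr_LR. Qed.
Lemma dotC x y : dot x y = (dot y x)^*%C.
Proof. by rewrite [LHS]hermC/= expr0 mul1r. Qed.
Lemma dot0l y : dot 0 y = 0.
Proof. by rewrite linear0l. Qed.
Lemma dot0r y : dot y 0 = 0.
Proof. by rewrite linear0. Qed.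
Lemma dot_sqr x : dot x x = (nm x ^+ 2)%:C.
Proof. by rewrite dot_norm nmE rmorphXn. Qed.

Lemma Re_dotC x y : complex.Re (dot x y) = complex.Re (dot y x).
Proof. by rewrite dotC cReJ. Qed.

Lemma nm_sqr_dotD x y :
  nm (x + y) ^+ 2 = nm x ^+ 2 + 2 * complex.Re (dot x y) + nm y ^+ 2.
Proof.
have := dot_sqr (x + y); rewrite dotDl !dotDr => /(congr1 (@complex.Re R)).
by rewrite !cReD !dot_sqr/= (Re_dotC y x) => <-; ring.
Qed.

Lemma cauchy_schwarz x y : nm (dot x y) <= nm x * nm y.
Proof.
have [->|y0] := eqVneq y 0; first by rewrite dot0r !nm0 mulr0.
have ny : 0 < nm y by rewrite nm_gt0.
pose c := dot x y / (nm y ^+ 2)%:C.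
have ny2 : (nm y ^+ 2)%:C != 0 :> C by rewrite -nm_gt0 nm_real gtr0_norm exprn_gt0.
have := sqr_ge0 (nm (x - c *: y)); rewrite nm_sqr_dotD nmN nmZ dotNr dotZr cReN.
have -> : c^*%C * dot x y = (nm (dot x y) ^+ 2 / nm y ^+ 2)%:C.
  have -> : c^*%C = (dot x y)^*%C / (nm y ^+ 2)%:C.
    by rewrite /c rmorphM fmorphV; congr (_ * _^-1); exact: conjc_real.
  have -> : (nm (dot x y) ^+ 2 / nm y ^+ 2)%:C = (nm (dot x y) ^+ 2)%:C / (nm y ^+ 2)%:C.
    by rewrite -fmorphV -rmorphM.
  by rewrite nm_sqrJ; ring.
have -> : nm c = nm (dot x y) / nm y ^+ 2.
  by rewrite /c nmM nmV nm_real ger0_norm ?exprn_ge0 ?nm_ge0.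
have -> : (nm (dot x y) / nm y ^+ 2 * nm y) ^+ 2 = nm (dot x y) ^+ 2 / nm y ^+ 2.
  by field; rewrite gt_eqF.
rewrite /= => h; have : nm (dot x y) ^+ 2 / nm y ^+ 2 <= nm x ^+ 2 by lra.
rewrite ler_pdivrMr ?exprn_gt0// -exprMn => h2.
by rewrite -(@ler_pXn2r _ 2)// nnegrE ?mulr_ge0 ?nm_ge0.
Qed.

(** Reduces a norm estimate for a vector x to an estimate of the scalar <x, x>, in
    which the first factor can be replaced by a holomorphic function. *)
Lemma nm_le_of_dot x (K : R) : nm (dot x x) <= K * nm x -> 0 <= K -> nm x <= K.
Proof.
rewrite dot_sqr nm_real ger0_norm ?sqr_ge0// => h K0.
have [->|x0] := eqVneq x 0; first by rewrite nm0.
by move: h; rewrite expr2 ler_pM2r// nm_gt0.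
Qed.

End InnerProduct.

Section Frechet.
Context {R : realType} {X : completeNormedModType R[i]}.
Context (dot : {dot X for conjC}) (dot_norm : forall x : X, dot x x = `|x| ^+ 2).
Local Notation C := R[i].
Implicit Types (F G : X -> X) (L : X -> X) (a b h k x y z : X) (s t : C).

Definition fder F a L := [/\ hasd F a L, linear L & exists B : R, forall h, nm (L h) <= B * nm h].

Lemma linD L x y : linear L -> L (x + y) = L x + L y.
Proof. by move=> /(_ 1 x y); rewrite !scale1r. Qed.
Lemma lin0 L : linear L -> L 0 = 0.
Proof. by move=> /(_ (-1) 0 0); rewrite addr0 scaler0 scaleN1r addNr. Qed.
Lemma linZ L t x : linear L -> L (t *: x) = t *: L x.
Proof. by move=> lL; have := lL t x 0; rewrite !addr0 lin0// addr0. Qed.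
Lemma linN L x : linear L -> L (- x) = - L x.
Proof. by move=> lL; rewrite -scaleN1r linZ// scaleN1r. Qed.
Lemma linB L x y : linear L -> L (x - y) = L x - L y.
Proof. by move=> lL; rewrite linD// linN. Qed.

Lemma fderB F G a L M : fder F a L -> fder G a M ->
  fder (fun x => F x - G x) a (fun h => L h - M h).
Proof.
move=> [FL lL [B LB]] [GM lM [B' MB]]; split.
- by have := hasdD FL (hasdN GM).
- by move=> t x y; rewrite lL lM scalerBr opprD addrACA.
- exists (B + B') => h; apply: (le_trans (nmD _ _)).
  by rewrite nmN mulrDl; apply: lerD.
Qed.

Lemma fderZ F a L t : fder F a L -> fder (fun x => t *: F x) a (fun h => t *: L h).
Proof.
move=> [FL lL [B LB]]; split.
- have [->|t0] := eqVneq t 0.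
    move=> e /(hasd_cst (0 : X) a)[r r0 rP]; exists r => // h /rP.
    by rewrite !scale0r.
  move=> e e0; have nt : 0 < nm t by rewrite nm_gt0.
  have [r r0 rP] := FL _ (divr_gt0 e0 nt); exists r => // h /rP.
  by rewrite -!scalerBr nmZ mulrAC ler_pdivlMr// mulrC.
- by move=> s x y; rewrite lL scalerDr !scalerA (mulrC t).
- exists (nm t * B) => h; rewrite nmZ -mulrA; apply: ler_wpM2l (LB h).
  exact: nm_ge0.
Qed.

Lemma fder_shift F a k L : fder F (a + k) L -> fder (fun x => F (x + k)) a L.
Proof.
move=> [FL lL LB]; split => // e /FL[r r0 rP]; exists r => // h /rP.
by rewrite (addrAC a h).
Qed.

Lemma fder_scalar F a h y s L : fder F (a + s *: h) L ->
  cder (fun s => dot (F (a + s *: h)) y) s (dot (L h) y).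
Proof.
move=> [FL lL [B LB]] e e0.
pose K := nm h * nm y + 1.
have K0 : 0 < K by rewrite /K; have := mulr_ge0 (nm_ge0 h) (nm_ge0 y); lra.
have [r r0 rP] := FL _ (divr_gt0 e0 K0).
exists (r / (nm h + 1)); first by rewrite divr_gt0//; have := nm_ge0 h; lra.
move=> t; rewrite ltr_pdivlMr; last by have := nm_ge0 h; lra.
move=> tr; have thr : nm (t *: h) < r.
  by rewrite nmZ; apply: le_lt_trans tr; rewrite ler_wpM2l ?nm_ge0//; lra.
rewrite scalerDl addrA -dotBl -dotZl -linZ// -dotBl.
apply: (le_trans (cauchy_schwarz dot_norm _ _)).
apply: (le_trans (ler_wpM2r (nm_ge0 y) (rP _ thr))).
rewrite nmZ.
have -> : e / K * (nm t * nm h) * nm y = e * nm t * ((nm h * nm y) / K) by field; rewrite gt_eqF.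
rewrite -[leRHS]mulr1; apply: ler_wpM2l; first by rewrite mulr_ge0 ?nm_ge0 ?ltW.
by rewrite ler_pdivrMr// /K; lra.
Qed.

Lemma hasd_bound F a L (K r : R) : 0 < r -> hasd F a L -> linear L ->
  (forall h, nm h < r -> nm (F (a + h) - F a) <= K * nm h) ->
  forall h, nm (L h) <= K * nm h.
Proof.
move=> r0 FL lL FK h; rewrite leNgt; apply/negP => lt.
have hn : 0 < nm h.
  by rewrite nm_gt0; apply: contraTneq lt => ->; rewrite lin0// nm0 mulr0 ltxx.
pose e := (nm (L h) - K * nm h) / (2 * nm h).
have e0 : 0 < e by rewrite divr_gt0 ?mulr_gt0// subr_gt0.
have [d d0 dP] := FL e e0.
pose t : R := Num.min r d / (2 * nm h).
have md : 0 < Num.min r d by rewrite lt_min r0.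
have t0 : 0 < t by rewrite divr_gt0// mulr_gt0.
have th : nm (t%:C *: h) = Num.min r d / 2.
  by rewrite nmZ nm_real gtr0_norm// /t; field; rewrite gt_eqF.
have thr : nm (t%:C *: h) < r.
  have mr : Num.min r d <= r by rewrite ge_min lexx.
  by rewrite th; lra.
have thd : nm (t%:C *: h) < d.
  have mr : Num.min r d <= d by rewrite ge_min lexx orbT.
  by rewrite th; lra.
have := FK _ thr; have := dP _ thd; set u := F _ - F a => h1 h2.
have := nm_subl (L (t%:C *: h)) u; rewrite nmB => h3.
have : nm (L (t%:C *: h)) <= (K + e) * nm (t%:C *: h) by rewrite mulrDl; lra.
rewrite linZ// !nmZ nm_real gtr0_norm// mulrCA ler_pM2l// mulrDl.
have -> : e * nm h = (nm (L h) - K * nm h) / 2 by rewrite /e; field; rewrite gt_eqF.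
by lra.
Qed.

(** The difference of the two derivatives is a linear derivative of the zero
    mapping. *)
Lemma hasd_unique F a L M : hasd F a L -> hasd F a M -> linear L -> linear M ->
  forall h, L h = M h.
Proof.
move=> FL FM lL lM h.
have lN : linear (fun h => L h - M h).
  by move=> t x y; rewrite lL lM scalerBr opprD addrACA.
have N0 : hasd (fun=> 0) a (fun h => L h - M h).
  move=> e e0; have [d d0 dP] := hasdD FL (hasdN FM) e0; exists d => // k /dP.
  by rewrite !subrr.
have := hasd_bound ltr01 N0 lN _ h.
move=> /(_ 0) b; have : nm (L h - M h) <= 0.
  by rewrite -(mul0r (nm h)); apply: b => k _; rewrite subrr nm0 mul0r.
by move=> n0; apply/eqP; rewrite -subr_eq0 -nm_eq0 eq_le n0 nm_ge0.
Qed.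

(** Cauchy's estimate for vector valued mappings: pair the increment with itself
    and apply the scalar estimate along the line through a and a + h. *)
Lemma increment_le F a (r M : R) : 0 < r ->
  (forall b, nm (b - a) < r -> exists L, fder F b L) ->
  (forall b, nm (b - a) < r -> nm (F b) <= M) ->
  forall h, nm h < r -> nm (F (a + h) - F a) <= 2 * M / r * nm h.
Proof.
move=> r0 dF FM h hr.
have M0 : 0 <= M by apply: le_trans (nm_ge0 _) (FM a _); rewrite subrr nm0.
have [->|hn] := eqVneq h 0; first by rewrite addr0 subrr !nm0 mulr0.
have nh : 0 < nm h by rewrite nm_gt0.
pose y := F (a + h) - F a; rewrite -/y.
pose phi s := dot (F (a + s *: h)) y.
have K0 : 0 <= 2 * M / r * nm h by apply: mulr_ge0 (nm_ge0 _); apply: divr_ge0 (ltW r0); apply: mulr_ge0.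
apply: (nm_le_of_dot dot_norm) K0.
have inr s : nm s < r / nm h -> nm (a + s *: h - a) < r.
  by rewrite ltr_pdivlMr// (addrC a) addrK nmZ.
have s1 : nm (1 : C) < r / nm h by rewrite nm1 ltr_pdivlMr// mul1r.
have dphi s : nm s < r / nm h -> exists d, cder phi s d.
  by move=> /inr/dF[L FL]; eexists; exact: fder_scalar FL.
have phiM s : nm s < r / nm h -> nm (phi s) <= M * nm y.
  move=> /inr/FM sM; apply: (le_trans (cauchy_schwarz dot_norm _ _)).
  by rewrite ler_wpM2r ?nm_ge0.
have := cauchy_lipschitz (divr_gt0 r0 nh) dphi phiM s1.
rewrite nm1 mulr1 /phi scale1r scale0r addr0 -dotBl -/y => h1.
have -> : 2 * M / r * nm h * nm y = 2 * (M * nm y) * (nm h / r) by field; rewrite gt_eqF.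
by rewrite -[_ / r]invrK invf_div ler_pdivlMr ?divr_gt0.
Qed.

End Frechet.

(** * Difference quotients of bounded holomorphic mappings *)

Lemma subACA (V : zmodType) (x y z t : V) : x - y - (z - t) = x - z - (y - t).
Proof. by rewrite !opprB addrACA [RHS]addrACA (addrC (- y)). Qed.

Section SecondDerivative.
Context {R : realType} {X : completeNormedModType R[i]}.
Context (dot : {dot X for conjC}) (dot_norm : forall x : X, dot x x = `|x| ^+ 2).
Local Notation C := R[i].
Implicit Types (F G : X -> X) (L : X -> X) (a b h k x y z : X) (s t : C).

Lemma complete_seq (u : nat -> X) :
  (forall e : R, 0 < e -> exists N, forall m n, (N <= m)%N -> (N <= n)%N -> nm (u m - u n) < e) ->
  exists l, forall e : R, 0 < e -> exists N, forall n, (N <= n)%N -> nm (u n - l) < e.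
Proof.
move=> cu.
have uc : cvg (u @ \oo).
  apply: cauchy_cvg; apply: cauchy_exP => e /C_gt0[r r0 ->].
  have [N NP] := cu r r0; exists (u N); exists N => // n Nn.
  by rewrite -ball_normE/= nmE ltcR; exact: NP.
exists (lim (u @ \oo)) => e e0.
have /cvgrPdist_lt/(_ e%:C) := uc; rewrite ltcR => /(_ e0)[N _ NP].
by exists N => n Nn; have := NP n Nn; rewrite /= nmE ltcR nmB.
Qed.

Lemma inv_nat_small (e : R) : 0 < e -> exists N, forall n, (N <= n)%N -> n.+1%:R^-1 < e.
Proof.
move=> e0; exists (Num.truncn e^-1) => n Nn.
rewrite -[e]invrK ltf_pV2 ?posrE ?invr_gt0//.
apply: (lt_le_trans (truncnS_gt _)); by rewrite ler_nat.
Qed.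

(** A Lipschitz family q on a punctured disc is Cauchy along t = r / (n + 1), and
    its limit inherits the rate. *)
Lemma punctured_limit (q : C -> X) (r K : R) : 0 < r ->
  (forall t t', t != 0 -> t' != 0 -> nm t <= r -> nm t' <= r ->
     nm (q t - q t') <= K * nm (t - t')) ->
  exists v, forall t, t != 0 -> nm t <= r -> nm (q t - v) <= K * nm t.
Proof.
move=> r0 qK; pose K' := Num.max K 0 + 1.
have [m1 m2] : K <= Num.max K 0 /\ 0 <= Num.max K 0 by rewrite !le_max !lexx orbT.
have K'0 : 0 < K' by rewrite /K'; lra.
have KK' : K <= K' by rewrite /K'; lra.
pose T n : C := (r * n.+1%:R^-1)%:C.
have Tn n : nm (T n) = r * n.+1%:R^-1.
  by rewrite nm_real ger0_norm// mulr_ge0 ?invr_ge0// ltW.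
have T0 n : T n != 0 by rewrite -nm_gt0 Tn mulr_gt0// invr_gt0.
have Tr n : nm (T n) <= r by rewrite Tn; apply: ler_piMr; [exact: ltW | rewrite invf_le1 ?ler1n].
have small (e : R) : 0 < e -> exists N, forall n, (N <= n)%N -> nm (T n) < e.
  move=> e0; have [N NP] := inv_nat_small (divr_gt0 e0 r0).
  by exists N => n /NP; rewrite Tn ltr_pdivlMr// mulrC.
have [|v vP] := @complete_seq (q \o T).
  move=> e e0; have K2 : 0 < 2 * K' by lra.
  have [N NP] := small _ (divr_gt0 e0 K2).
  exists N => m n /NP Nm /NP Nn.
  apply: (le_lt_trans (qK _ _ (T0 m) (T0 n) (Tr m) (Tr n))).
  apply: (le_lt_trans (ler_wpM2r (nm_ge0 _) KK')).
  have : nm (T m - T n) < e / K'.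
    apply: (le_lt_trans (nmD _ _)); rewrite nmN.
    have -> : e / K' = e / (2 * K') + e / (2 * K') by field; rewrite gt_eqF.
    apply: ltrD; [apply: Nm|apply: Nn]; lra.
  by rewrite ltr_pdivlMr// mulrC.
exists v => t t0 tr; apply/ler_addgt0Pr => e e0.
have e20 : 0 < e / 2 by lra.
have [N1 N1P] := vP _ e20.
have eK : 0 < e / (2 * K') by rewrite divr_gt0// mulr_gt0.
have [N2 N2P] := small _ eK.
pose n := maxn N1 N2.
have h1 : nm (q (T n) - v) < e / 2 by apply: N1P; exact: leq_maxl.
have h2 : nm (T n) < e / (2 * K') by apply: N2P; exact: leq_maxr.
apply: (le_trans (nm_tri _ (q (T n)) _)).
have h3 := qK _ _ t0 (T0 n) tr (Tr n).
have K0 : 0 <= K.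
  have := le_trans (nm_ge0 _) (qK _ _ (T0 0%N) (T0 1%N) (Tr _) (Tr _)).
  rewrite pmulr_lge0// nm_gt0 subr_eq0; apply/eqP => /(congr1 nm).
  by rewrite !Tn => /(mulfI (lt0r_neq0 r0))/invr_inj/eqP; rewrite eqr_nat.
have h4 : K * nm (t - T n) <= K * nm t + K' * nm (T n).
  apply: (le_trans (ler_wpM2l K0 (nmD _ _))); rewrite nmN mulrDr lerD2l.
  by apply: ler_wpM2r; first exact: nm_ge0.
have h5 : K' * nm (T n) < e / 2.
  rewrite mulrC -ltr_pdivlMr//.
  by have -> : e / 2 / K' = e / (2 * K') by field; rewrite gt_eqF.
lra.
Qed.

Lemma punctured_limit_unique (q : C -> X) (r K K' : R) v v' : 0 < r ->
  (forall t, t != 0 -> nm t <= r -> nm (q t - v) <= K * nm t) ->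
  (forall t, t != 0 -> nm t <= r -> nm (q t - v') <= K' * nm t) -> v = v'.
Proof.
move=> r0 qv qv'; apply/eqP; rewrite -subr_eq0 -nm_eq0 eq_le nm_ge0 andbT leNgt.
apply/negP => lt; pose S := Num.max (K + K') 1.
have S0 : 0 < S by rewrite lt_max ltr01 orbT.
pose t : R := Num.min r (nm (v - v') / (2 * S)).
have t0 : 0 < t by rewrite lt_min r0 divr_gt0// mulr_gt0.
have tn : nm (t%:C : C) = t by rewrite nm_real gtr0_norm.
have tC : t%:C != 0 :> C by rewrite -nm_gt0 tn.
have tr : nm (t%:C : C) <= r by rewrite tn ge_min lexx.
have := qv _ tC tr; have := qv' _ tC tr; rewrite tn => h1 h2.
have := nm_tri v (q t%:C) v'; rewrite (nmB v (q _)) => h3.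
have : (K + K') * t <= S * t by rewrite ler_pM2r// le_max lexx.
have : t <= nm (v - v') / (2 * S) by rewrite ge_min lexx orbT.
rewrite ler_pdivlMr ?mulr_gt0// => h4 h5.
by clearbody S t; clear -h1 h2 h3 h4 h5 lt; lra.
Qed.

Section Ball.
Context (F : X -> X) (D : X -> X -> X) (a : X) (r M : R).
Context (rp : 0 < r)
        (FD : forall b, nm (b - a) < r -> fder F b (D b))
        (FM : forall b, nm (b - a) < r -> nm (F b) <= M).

Let M0 : 0 <= M.
Proof. by apply: le_trans (nm_ge0 _) (FM (b := a) _); rewrite subrr nm0. Qed.

Definition dquot t k b := t^-1 *: (F (b + t *: k) - F b).

Let sub b h : nm (b - a) < r / 2 -> nm h < r / 2 -> nm (b + h - a) < r.
Proof. by move=> br hr; rewrite addrAC; apply: (le_lt_trans (nmD _ _)); lra. Qed.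

Lemma dquot_le t k b : t != 0 -> nm (b - a) < r / 2 -> nm t * nm k < r / 2 ->
  nm (dquot t k b) <= 4 * M / r * nm k.
Proof.
have r0 := rp; move=> t0 br tk; have r20 : 0 < r / 2 by lra.
have inb c : nm (c - b) < r / 2 -> nm (c - a) < r.
  by move=> cb; have := nm_tri c b a; lra.
have dF c : nm (c - b) < r / 2 -> exists L, fder F c L by move=> /inb/FD; exists (D c).
have Fb c : nm (c - b) < r / 2 -> nm (F c) <= M by move=> /inb/FM.
have := increment_le dot_norm r20 dF Fb (_ : nm (t *: k) < r / 2).
rewrite nmZ => /(_ tk) h; rewrite /dquot nmZ nmV ler_pdivrMl ?nm_gt0//.
by apply: (le_trans h); rewrite le_eqVlt; apply/orP; left; apply/eqP; field; rewrite gt_eqF.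
Qed.

(** For fixed b the difference quotient is holomorphic and bounded in t away from
    t = 0, hence Lipschitz up to the puncture. *)
Lemma dquot_lip t t' k b : t != 0 -> t' != 0 -> nm (b - a) < r / 2 ->
  nm t * nm k <= r / 8 -> nm t' * nm k <= r / 8 ->
  nm (dquot t k b - dquot t' k b) <= 64 * M / r ^+ 2 * nm k ^+ 2 * nm (t - t').
Proof.
have r0 := rp; move=> t0 t'0 br tk t'k.
have [->|k0] := eqVneq k 0.
  by rewrite /dquot !scaler0 addr0 subrr !scaler0 subrr !nm0 expr0n mulr0 mul0r.
have nk : 0 < nm k by rewrite nm_gt0.
set K := _ * nm (t - t').
have K0 : 0 <= K.
  by rewrite /K !mulr_ge0 ?invr_ge0 ?sqr_ge0 ?nm_ge0.
apply: (nm_le_of_dot dot_norm) K0.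
set y := dquot t k b - _.
pose psi s := dot (dquot s k b) y.
pose s := r / (2 * nm k).
have s0 : 0 < s by rewrite divr_gt0// mulr_gt0.
have ins (u : C) : nm u < s -> nm u * nm k < r / 2.
  by rewrite ltr_pdivlMr ?mulr_gt0//; lra.
have dpsi u : nm u < s -> u != 0 -> exists d, cder psi u d.
  move=> /ins us u0; have inu : nm (b + u *: k - a) < r by apply: sub => //; rewrite nmZ.
  have [d' vd] := cderV (cder_id u) u0.
  have := cderM vd (cderB (fder_scalar dot_norm y (FD inu)) (cder_cst (dot (F b) y) u)).
  set d := (X in cder _ _ X) => dd; exists d; move: dd; rewrite /psi /dquot.
  by under eq_fun do rewrite -(dotBl dot) -(dotZl dot).
have psiM u : nm u < s -> u != 0 -> nm (psi u) <= 4 * M / r * nm k * nm y.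
  move=> /ins us u0; apply: (le_trans (cauchy_schwarz dot_norm _ _)).
  by rewrite ler_wpM2r ?nm_ge0//; exact: dquot_le.
have ts (u : C) : nm u * nm k <= r / 8 -> nm u <= s / 4.
  move=> h; rewrite /s; have -> : r / (2 * nm k) / 4 = r / 8 / nm k by field; rewrite gt_eqF.
  by rewrite ler_pdivlMr.
have := lipschitz_punctured s0 dpsi psiM (ts _ tk) (ts _ t'k) t0 t'0.
rewrite /psi -dotBl -/y => /le_trans; apply.
rewrite le_eqVlt; apply/orP; left; apply/eqP; rewrite /K /s; field.
by rewrite !gt_eqF.
Qed.

(** Differentiates [dquot_lip] in b: the difference of two difference quotients is
    a bounded holomorphic mapping of b with a small bound, so its derivative is small
    as well. *)
Lemma Dquot_lip t t' k h : t != 0 -> t' != 0 ->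
  nm t * nm k <= r / 8 -> nm t' * nm k <= r / 8 ->
  nm (t^-1 *: (D (a + t *: k) h - D a h) - t'^-1 *: (D (a + t' *: k) h - D a h))
    <= 256 * M / r ^+ 3 * nm k ^+ 2 * nm h * nm (t - t').
Proof.
have r0 := rp; move=> t0 t'0 tk t'k.
pose G b := dquot t k b - dquot t' k b.
have r20 : 0 < r / 2 by lra.
have dG b : nm (b - a) < r / 2 -> fder G b
    (fun h => t^-1 *: (D (b + t *: k) h - D b h) - t'^-1 *: (D (b + t' *: k) h - D b h)).
  move=> br; have bar : nm (b - a) < r by lra.
  have step (u : C) : nm u * nm k <= r / 8 ->
      fder (dquot u k) b (fun h => u^-1 *: (D (b + u *: k) h - D b h)).
    move=> uk; apply: fderZ; apply: fderB (FD bar); apply: fder_shift; apply: FD.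
    by apply: sub => //; rewrite nmZ; lra.
  by apply: fderB; exact: step.
have [GL lL _] : fder G a (fun h => t^-1 *: (D (a + t *: k) h - D a h)
    - t'^-1 *: (D (a + t' *: k) h - D a h)) by apply: dG; rewrite subrr nm0.
have dG' b : nm (b - a) < r / 2 -> exists L, fder G b L by move=> /dG; eexists; eauto.
have GM b : nm (b - a) < r / 2 -> nm (G b) <= 64 * M / r ^+ 2 * nm k ^+ 2 * nm (t - t').
  by move=> br; exact: dquot_lip.
have inc := increment_le dot_norm r20 dG' GM.
apply: (le_trans (hasd_bound r20 GL lL inc h)).
by rewrite le_eqVlt; apply/orP; left; apply/eqP; field; rewrite gt_eqF.
Qed.

(** Compares the second difference of F with the first difference of DF.  The
    comparison is uniform, so the symmetry of the second difference in (k, h) passes to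
    the second derivative. *)
Lemma second_difference_le s t k h : s != 0 -> t != 0 ->
  nm s * nm k < r / 2 -> nm t * nm h <= r / 8 ->
  nm ((s * t)^-1 *: (F (a + s *: k + t *: h) - F (a + s *: k) - F (a + t *: h) + F a)
      - s^-1 *: (D (a + s *: k) h - D a h))
    <= 256 * M / r ^+ 3 * nm h ^+ 2 * nm k * nm t.
Proof.
have r0 := rp; move=> s0 t0 sk th.
have r20 : 0 < r / 2 by lra.
have ns : 0 < nm s by rewrite nm_gt0.
pose E t' b := dquot t h b - dquot t' h b.
have incE t' : t' != 0 -> nm t' * nm h <= r / 8 ->
    nm (E t' (a + s *: k) - E t' a) <=
    256 * M / r ^+ 3 * nm h ^+ 2 * nm (t - t') * (nm s * nm k).
  move=> t'0 t'h.
  have dE b : nm (b - a) < r / 2 -> exists L, fder (E t') b L.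
    move=> br; eexists; apply: fderB; apply: fderZ; apply: fderB (FD (_ : nm (b - a) < r));
      try lra; apply: fder_shift; apply: FD; apply: sub => //; rewrite nmZ; lra.
  have EM b : nm (b - a) < r / 2 -> nm (E t' b) <= 64 * M / r ^+ 2 * nm h ^+ 2 * nm (t - t').
    by move=> br; exact: dquot_lip.
  have skr : nm (s *: k) < r / 2 by rewrite nmZ.
  apply: (le_trans (increment_le dot_norm r20 dE EM skr)).
  by rewrite nmZ le_eqVlt; apply/orP; left; apply/eqP; field; rewrite gt_eqF.
set K := 256 * M / r ^+ 3 * nm h ^+ 2.
have K0 : 0 <= K.
  apply: mulr_ge0 (sqr_ge0 _); apply: divr_ge0; first exact: mulr_ge0.
  by rewrite exprn_ge0// ltW.
have [-> | h0] := eqVneq h 0.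
  have [_ l1 _] : fder F (a + s *: k) (D (a + s *: k)).
    by apply: FD; rewrite addrAC subrr add0r nmZ; lra.
  have [_ l2 _] : fder F a (D a) by apply: FD; rewrite subrr nm0.
  rewrite scaler0 !addr0 (lin0 l1) (lin0 l2) subrr sub0r addNr subrr !scaler0 subrr nm0.
  by apply: mulr_ge0 (nm_ge0 _); apply: mulr_ge0 (nm_ge0 _).
have nh : 0 < nm h by rewrite nm_gt0.
have [|H1 _ _] := FD (b := a + s *: k); first by rewrite addrAC subrr add0r nmZ; lra.
have [|H2 _ _] := FD (b := a); first by rewrite subrr nm0.
apply/ler_addgt0Pr => e e0.
pose e1 := e * nm s / (4 * nm h).
have e10 : 0 < e1 by rewrite divr_gt0// mulr_gt0.
have [d1 d10 d1P] := H1 _ e10; have [d2 d20 d2P] := H2 _ e10.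
pose W := K * nm k + 1.
have W0 : 0 < W by rewrite /W; have := mulr_ge0 K0 (nm_ge0 k); lra.
pose m := Num.min (Num.min (d1 / 2) (d2 / 2)) (Num.min (r / 8) (e / (4 * W) * nm h)).
have m0 : 0 < m.
  by rewrite !lt_min !divr_gt0//= mulr_gt0// divr_gt0// mulr_gt0.
pose t' : C := (m / nm h)%:C.
have nt' : nm t' = m / nm h by rewrite nm_real gtr0_norm// divr_gt0.
have t'h : nm t' * nm h = m by rewrite nt'; field; rewrite gt_eqF.
have t'0 : t' != 0 by rewrite -nm_gt0 nt' divr_gt0.
have [m1 m2 m3 m4] : [/\ m <= d1 / 2, m <= d2 / 2, m <= r / 8 & m <= e / (4 * W) * nm h].
  by split; rewrite !ge_min lexx ?orbT.
have := incE t' t'0 _; rewrite t'h -/K => /(_ m3) inc.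
have q1 : nm (t' *: h) < d1 by rewrite nmZ t'h; lra.
have q2 : nm (t' *: h) < d2 by rewrite nmZ t'h; lra.
have [_ l1 _] : fder F (a + s *: k) (D (a + s *: k)).
  by apply: FD; rewrite addrAC subrr add0r nmZ; lra.
have [_ l2 _] : fder F a (D a) by apply: FD; rewrite subrr nm0.
(* the inner step t' is taken so small that dquot t' is the derivative up to e *)
have dl b : hasd F b (D b) -> linear (D b) -> (forall x, nm x < d1 -> nm x < d2 ->
      nm (F (b + x) - F b - D b x) <= e1 * nm x) -> nm (dquot t' h b - D b h) <= e1 * nm h.
  move=> _ lb /(_ _ q1 q2); rewrite (linZ t' h lb) nmZ => bb.
  have -> : dquot t' h b - D b h = t'^-1 *: (F (b + t' *: h) - F b - t' *: D b h).
    by rewrite /dquot [RHS]scalerBr scalerA mulVf// scale1r.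
  by rewrite nmZ nmV ler_pdivrMl ?nm_gt0// mulrCA.
have a1 := dl _ H1 l1 (fun x u _ => d1P x u).
have a2 := dl _ H2 l2 (fun x _ u => d2P x u).
have -> : (s * t)^-1 *: (F (a + s *: k + t *: h) - F (a + s *: k) - F (a + t *: h) + F a)
      - s^-1 *: (D (a + s *: k) h - D a h) =
  s^-1 *: (E t' (a + s *: k) - E t' a) +
  s^-1 *: ((dquot t' h (a + s *: k) - D (a + s *: k) h) - (dquot t' h a - D a h)).
  rewrite -scalerDr invfM -scalerA -scalerBr; congr (_ *: _).
  have -> : t^-1 *: (F (a + s *: k + t *: h) - F (a + s *: k) - F (a + t *: h) + F a) =
      dquot t h (a + s *: k) - dquot t h a.
    by rewrite /dquot -scalerBr opprB addrA addrAC.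
  by rewrite /E (subACA (dquot t h _)) [RHS]addrACA -opprD !subrKA subACA.
apply: (le_trans (nmD _ _)); rewrite !nmZ nmV.
have tt' : nm (t - t') <= nm t + nm t' by apply: (le_trans (nmD _ _)); rewrite nmN.
rewrite mulrC [X in _ + X]mulrC -mulrDl ler_pdivrMr//.
have b1 : nm (dquot t' h (a + s *: k) - D (a + s *: k) h - (dquot t' h a - D a h)) <=
    e * nm s / 2.
  apply: (le_trans (nmD _ _)); rewrite nmN.
  have -> : e * nm s / 2 = e1 * nm h + e1 * nm h by rewrite /e1; field; rewrite gt_eqF.
  exact: lerD.
have b2 : K * nm t' * (nm s * nm k) <= e * nm s / 2.
  have wk : K * nm k <= W by rewrite /W; lra.
  have tw : nm t' * W <= e / 4.
    by rewrite nt' mulrAC ler_pdivrMr// -ler_pdivlMr//; apply: (le_trans m4); rewrite le_eqVlt;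
       apply/orP; left; apply/eqP; field; rewrite gt_eqF.
  have : nm t' * (K * nm k) <= e / 4.
    by apply: le_trans tw; rewrite ler_wpM2l ?nm_ge0.
  move=> /(ler_wpM2l (ltW ns)).
  have -> : K * nm t' * (nm s * nm k) = nm s * (nm t' * (K * nm k)) by ring.
  have : 0 <= nm s * e by rewrite mulr_ge0// ltW.
  lra.
have b3 : K * nm (t - t') * (nm s * nm k) <= K * nm t * (nm s * nm k) + e * nm s / 2.
  apply: le_trans (lerD (lexx _) b2).
  rewrite -mulrDl -mulrDr ler_wpM2r ?mulr_ge0 ?nm_ge0// ler_wpM2l//.
have : K * nm k * nm t * nm s = K * nm t * (nm s * nm k) by ring.
lra.
Qed.

End Ball.
End SecondDerivative.

(** * Second derivatives and the derivative of an inverse *)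

Section Holomorphic.
Context {R : realType} {X : completeNormedModType R[i]}.
Context (dot : {dot X for conjC}) (dot_norm : forall x : X, dot x x = `|x| ^+ 2).
Local Notation C := R[i].
Implicit Types (F G : X -> X) (D : X -> X -> X) (a b h k x y z : X) (s t : C).

(** The second derivative with a quadratic remainder: Cauchy estimates
    provide this rate, and it is uniform in the second argument. *)
Definition second_der D a (A : X -> X -> X) :=
  [/\ forall k, linear (A k), forall h, linear (A^~ h), forall k h, A k h = A h k,
      exists B : R, forall k h, nm (A k h) <= B * nm k * nm h &
      exists2 d : R, 0 < d & exists K : R, forall k h, nm k <= d ->
        nm (D (a + k) h - D a h - A k h) <= K * nm k ^+ 2 * nm h].

(** The quotients (DF(a + t k) h - DF(a) h)/t are Lipschitz in t and converge as
    t -> 0.  Their limit is linear in h because the quotients are, and symmetric because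
    both orders of differentiation are limits of the same second difference. *)
Lemma second_der_exists F D a (r M : R) : 0 < r ->
  (forall b, nm (b - a) < r -> fder F b (D b)) ->
  (forall b, nm (b - a) < r -> nm (F b) <= M) ->
  exists A, second_der D a A.
Proof.
move=> r0 FD FM.
have M0 : 0 <= M by apply: le_trans (nm_ge0 _) (FM a _); rewrite subrr nm0.
have r3 : 0 < r ^+ 3 by rewrite exprn_gt0.
pose K0 := 256 * M / r ^+ 3.
have K00 : 0 <= K0 by apply: divr_ge0 (ltW r3); exact: mulr_ge0.
pose Q k h t := t^-1 *: (D (a + t *: k) h - D a h).
have aa : nm (a - a) < r by rewrite subrr nm0.
have [_ la [Ba BaP]] := FD a aa.
have inr k t : nm t * nm k <= r / 8 -> nm (a + t *: k - a) < r.
  by move=> tk; rewrite addrAC subrr add0r nmZ; lra.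
have Aex (kh : X * X) : exists v, forall t, t != 0 -> nm t * nm kh.1 <= r / 8 ->
    nm (Q kh.1 kh.2 t - v) <= K0 * nm kh.1 ^+ 2 * nm kh.2 * nm t.
  case: kh => k h /=; have [->|k0] := eqVneq k 0.
    by exists 0 => t _ _; rewrite /Q scaler0 addr0 subrr scaler0 subrr !nm0 expr0n/= mulr0 !mul0r.
  have nk : 0 < nm k by rewrite nm_gt0.
  have tr t : (nm t <= r / 8 / nm k) = (nm t * nm k <= r / 8) by rewrite ler_pdivlMr.
  have rk0 : 0 < r / 8 / nm k by rewrite !divr_gt0.
  have [t t' t0 t'0|v vP] := @punctured_limit _ _ (Q k h) _ (K0 * nm k ^+ 2 * nm h) rk0.
    by rewrite !tr => h1 h2; exact: (Dquot_lip dot_norm r0 FD FM).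
  by exists v => t t0; rewrite -tr; exact: vP.
have [A0 A0P] := choice Aex; pose A k h := A0 (k, h).
have AP k h t : t != 0 -> nm t * nm k <= r / 8 ->
    nm (Q k h t - A k h) <= K0 * nm k ^+ 2 * nm h * nm t by exact: (A0P (k, h)).
pose rk k := r / 8 / (nm k + 1).
have nk1 k : 0 < nm k + 1 by have := nm_ge0 k; lra.
have rk0 k : 0 < rk k by rewrite /rk !divr_gt0.
have tr k (t : C) : nm t <= rk k -> nm t * nm k <= r / 8.
  rewrite /rk ler_pdivlMr// => h1; apply: le_trans h1.
  by rewrite ler_wpM2l ?nm_ge0//; lra.
have linh k : linear (A k).
  move=> c x y.
  apply: (@punctured_limit_unique _ _ (Q k (c *: x + y)) (rk k) (K0 * nm k ^+ 2 * nm (c *: x + y))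
    (nm c * (K0 * nm k ^+ 2 * nm x) + K0 * nm k ^+ 2 * nm y)) => // t t0 /tr tk.
    exact: AP.
  have [_ lt _] := FD _ (inr k t tk).
  have -> : Q k (c *: x + y) t = c *: Q k x t + Q k y t.
    rewrite /Q lt la scalerA mulrC -scalerA -scalerDr; congr (_ *: _).
    by rewrite opprD addrACA scalerBr.
  rewrite opprD addrACA -scalerBr; apply: (le_trans (nmD _ _)); rewrite nmZ mulrDl.
  by apply: lerD; [rewrite -mulrA; apply: ler_wpM2l (nm_ge0 _) _ _ _|]; exact: AP.
have sym k h : A k h = A h k.
  pose q t := (t * t)^-1 *: (F (a + t *: k + t *: h) - F (a + t *: k) - F (a + t *: h) + F a).
  have half k' h' t : t != 0 -> nm t <= Num.min (rk k') (rk h') ->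
      nm ((t * t)^-1 *: (F (a + t *: k' + t *: h') - F (a + t *: k') - F (a + t *: h') + F a)
        - A k' h') <= (K0 * nm h' ^+ 2 * nm k' + K0 * nm k' ^+ 2 * nm h') * nm t.
    rewrite le_min => t0 /andP[/tr t1 /tr t2].
    apply: (le_trans (nm_tri _ (Q k' h' t) _)); rewrite mulrDl; apply: lerD; last exact: AP.
    by apply: (second_difference_le dot_norm r0 FD FM) => //; lra.
  have m0 : 0 < Num.min (rk k) (rk h) by rewrite lt_min !rk0.
  apply: (punctured_limit_unique m0 (half k h)) => t t0 tm.
  have := half h k t t0; rewrite minC => /(_ tm).
  by rewrite (addrAC a (t *: h)) (addrAC (F _) (- F (a + t *: h))); exact.
have linl h : linear (A^~ h).
  by move=> c x y; rewrite /= sym (sym x) (sym y) linh.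
exists A; split => //.
- have Db b h : nm (b - a) < r / 2 -> nm (D b h) <= 4 * M / r * nm h.
    move=> br; have r20 : 0 < r / 2 by lra.
    have inb c : nm (c - b) < r / 2 -> nm (c - a) < r.
      by move=> cb; have := nm_tri c b a; lra.
    have dF c : nm (c - b) < r / 2 -> exists L, fder F c L by move=> /inb/FD; exists (D c).
    have Fb c : nm (c - b) < r / 2 -> nm (F c) <= M by move=> /inb/FM.
    have [HL lL _] := FD b ltac:(lra).
    apply: (le_trans (hasd_bound r20 HL lL (increment_le dot_norm r20 dF Fb) h)).
    by rewrite le_eqVlt; apply/orP; left; apply/eqP; field; rewrite gt_eqF.
  exists (96 * M / r ^+ 2) => k h; have [->|k0] := eqVneq k 0.
    by rewrite (lin0 (linl h)) !nm0 mulr0 mul0r.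
  have nk : 0 < nm k by rewrite nm_gt0.
  pose t : C := (r / 8 / nm k)%:C.
  have nt : nm t = r / 8 / nm k by rewrite nm_real gtr0_norm// !divr_gt0.
  have t0 : t != 0 by rewrite -nm_gt0 nt !divr_gt0.
  have tk : nm t * nm k = r / 8 by rewrite nt; field; rewrite gt_eqF.
  have := AP k h t t0 _; rewrite tk => /(_ (lexx _)) h1.
  have h2 : nm (Q k h t) <= 64 * M / r ^+ 2 * nm k * nm h.
    rewrite /Q nmZ nmV nt.
    have -> : 64 * M / r ^+ 2 * nm k * nm h = (r / 8 / nm k)^-1 * (4 * M / r * nm h + 4 * M / r * nm h).
      by field; rewrite !gt_eqF.
    apply: ler_wpM2l; first by rewrite invr_ge0 !divr_ge0 ?nm_ge0// ltW.
    apply: (le_trans (nmD _ _)); rewrite nmN; apply: lerD; apply: Db.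
      by rewrite addrAC subrr add0r nmZ tk; lra.
    by rewrite subrr nm0; lra.
  have := nm_subl (A k h) (Q k h t); rewrite nmB.
  have : K0 * nm k ^+ 2 * nm h * nm t = 32 * M / r ^+ 2 * nm k * nm h.
    by rewrite nt /K0; field; rewrite !gt_eqF.
  have -> : 96 * M / r ^+ 2 * nm k * nm h = 64 * M / r ^+ 2 * nm k * nm h + 32 * M / r ^+ 2 * nm k * nm h.
    by field; rewrite gt_eqF.
  lra.
- exists (r / 8); first by lra.
  exists K0 => k h kr; have := AP k h 1 (oner_neq0 _); rewrite nm1 mul1r mulr1 => /(_ kr).
  by rewrite /Q invr1 !scale1r.
Qed.

Lemma second_der_fder D a A h : second_der D a A ->
  fder (fun b => D b h) a (fun k => A k h).
Proof.
move=> [_ Al _ [B AB] [d d0 [K AK]]]; split => //; last first.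
  by exists (B * nm h) => k; rewrite mulrAC; exact: AB.
move=> e e0; pose K' := Num.max K 0 * nm h + 1.
have Km : K <= Num.max K 0 /\ 0 <= Num.max K 0 by rewrite !le_max !lexx orbT.
have K'0 : 0 < K' by rewrite /K'; have := mulr_ge0 Km.2 (nm_ge0 h); lra.
exists (Num.min d (e / K')); first by rewrite lt_min d0 divr_gt0.
move=> k; rewrite lt_min => /andP[/ltW/(AK k h) kd ke].
apply: (le_trans kd); rewrite ltr_pdivlMr// in ke.
have -> : K * nm k ^+ 2 * nm h = (nm k * (K * nm h)) * nm k by ring.
apply: ler_wpM2r; first exact: nm_ge0.
apply: le_trans (ltW ke); apply: ler_wpM2l; first exact: nm_ge0.
by rewrite /K'; have := ler_wpM2r (nm_ge0 h) Km.1; lra.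
Qed.

Lemma fder_lip F a L : fder F a L -> exists2 r : R, 0 < r & exists2 K : R, 0 <= K &
  forall h, nm h < r -> nm (F (a + h) - F a) <= K * nm h.
Proof.
move=> [FL _ [B LB]]; have [r r0 rP] := hasd_lip FL LB.
exists r => //; exists (Num.max (B + 1) 0); first by rewrite le_max lexx orbT.
move=> h /rP hr; apply: (le_trans hr); rewrite ler_wpM2r ?nm_ge0//.
by rewrite le_max lexx.
Qed.

Definition holo F D := forall b, nm b < 1 -> fder F b (D b).

(** Differentiability makes F bounded near each point, which is all that the
    Cauchy estimates need. *)
Lemma holo_second_der F D : holo F D ->
  exists A : X -> X -> X -> X, forall a, nm a < 1 -> second_der D a (A a).
Proof.
move=> FD; have ex a : exists A, nm a < 1 -> second_der D a A.
  case: (boolP (nm a < 1)) => a1; last by exists (fun _ _ => 0).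
  have [r r0 [K K0 rK]] := fder_lip (FD a a1).
  pose s := Num.min r (1 - nm a).
  have s0 : 0 < s by rewrite lt_min r0 subr_gt0.
  have [sr sa] : s <= r /\ s <= 1 - nm a by rewrite !ge_min !lexx orbT.
  have [b bs|b bs|A AP] := @second_der_exists F D a s (nm (F a) + K * r) s0; last by exists A.
  - by apply: FD; have := nm_subl b a; lra.
  - have := rK (b - a) (lt_le_trans bs sr); rewrite (addrC a) subrK => h1.
    have := nm_subl (F b) (F a); have : K * nm (b - a) <= K * r by rewrite ler_wpM2l//; lra.
    lra.
have [A AP] := choice ex; by exists A.
Qed.

(** Differentiating D b (I b (u b)) = u b formally gives the derivative; the
    identity w (a + h) - w a = I a (u (a + h) - u a - (D (a + h) - D a) (w (a + h)))
    shows first that w is bounded near a, then Lipschitz at a, then differentiable. *)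
Lemma fder_inverse D a A (I : X -> X -> X) u U :
  nm a < 1 -> second_der D a A ->
  (forall b, nm b < 1 -> linear (D b)) ->
  linear (I a) -> (exists B : R, forall x, nm (I a x) <= B * nm x) ->
  (forall x, I a (D a x) = x) ->
  (forall b x, nm b < 1 -> D b (I b x) = x) ->
  fder u a U ->
  fder (fun b => I b (u b)) a (fun h => I a (U h - A h (I a (u a)))).
Proof.
move=> a1 DA lD lI [B IB] ID DI uU; set w := fun b => I b (u b).
have [Ar Al _ [BA AB] [d0 d00 [K AK]]] := DA.
have [HU lU [BU UB]] := uU.
have [Bp IBp] : exists2 B : R, 0 < B & forall x, nm (I a x) <= B * nm x.
  exists (Num.max B 1) => [|x]; first by rewrite lt_max ltr01 orbT.
  by apply: (le_trans (IB x)); rewrite ler_wpM2r ?nm_ge0// le_max lexx.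
move: {B IB}Bp IBp => B B0 IB.
have [r1 r10 [Ku Ku0 uK]] := fder_lip uU.
split; last first.
- exists (B * (Num.max BU 0 + Num.max BA 0 * nm (w a))) => h.
  apply: (le_trans (IB _)); rewrite -mulrA; apply: ler_wpM2l (ltW B0) _ _ _.
  apply: (le_trans (nmD _ _)); rewrite nmN mulrDl; apply: lerD.
    by apply: (le_trans (UB h)); rewrite ler_wpM2r ?nm_ge0// le_max lexx.
  apply: (le_trans (AB _ _)); rewrite mulrAC ler_wpM2r ?nm_ge0//.
  by rewrite ler_wpM2r ?nm_ge0// le_max lexx.
- move=> c x y; rewrite lU (Al (w a)) -lI; congr (I a _).
  by rewrite scalerBr opprD addrACA.
have {AK} [K2 K20 AK2] : exists2 K2 : R, 0 <= K2 & forall k h, nm k <= d0 ->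
    nm (D (a + k) h - D a h - A k h) <= K2 * nm k ^+ 2 * nm h.
  exists (Num.max K 0) => [|k h kd]; first by rewrite le_max lexx orbT.
  apply: (le_trans (AK k h kd)); rewrite -!mulrA.
  by apply: ler_wpM2r; rewrite ?mulr_ge0 ?nm_ge0// le_max lexx.
have {AB} [BA' BA0 AB'] : exists2 B' : R, 0 <= B' & forall k h, nm (A k h) <= B' * nm k * nm h.
  exists (Num.max BA 0) => [|k h]; first by rewrite le_max lexx orbT.
  apply: (le_trans (AB k h)); rewrite -!mulrA.
  by apply: ler_wpM2r; rewrite ?mulr_ge0 ?nm_ge0// le_max lexx.
pose K1 := BA' + K2 * d0.
have K10 : 0 <= K1 by rewrite addr_ge0 ?mulr_ge0// ltW.
have DK1 h x : nm h <= d0 -> nm (D (a + h) x - D a x) <= K1 * nm h * nm x.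
  move=> hd; apply: (le_trans (nm_subl _ (A h x))).
  rewrite /K1 !mulrDl; apply: lerD; first exact: AB'.
  apply: (le_trans (AK2 h x hd)); rewrite ler_wpM2r ?nm_ge0// expr2 mulrA.
  by rewrite ler_wpM2r ?nm_ge0// ler_wpM2l.
pose W := 2 * B * (nm (u a) + Ku * r1).
have W0 : 0 <= W.
  by apply: mulr_ge0; [rewrite mulr_ge0// ltW | rewrite addr_ge0 ?nm_ge0// mulr_ge0// ltW].
pose L1 := B * (Ku + K1 * W).
have L10 : 0 <= L1 by apply: mulr_ge0; [exact: ltW | rewrite addr_ge0// mulr_ge0].
pose S := K2 * W + BA' * L1 + 1.
have S0 : 0 < S by have := mulr_ge0 K20 W0; have := mulr_ge0 BA0 L10; rewrite /S; lra.
move=> e e0; have eB : 0 < e / (2 * B) by rewrite divr_gt0// mulr_gt0.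
have [r2 r20 uP] := HU _ eB.
have BK0 : 0 < 2 * B * K1 + 1 by have := mulr_ge0 (ltW B0) K10; lra.
exists (Num.min (Num.min (Num.min r1 r2) (Num.min d0 (1 - nm a)))
   (Num.min (1 / (2 * B * K1 + 1)) (e / (2 * B) / S))).
  rewrite !lt_min r10 r20 d00 subr_gt0 a1/=; apply/andP; split; exact: divr_gt0.
move=> h; rewrite !lt_min => /andP[/andP[/andP[h1 h2] /andP[h3 h4]] /andP[h5 h6]].
have ah1 : nm (a + h) < 1 by have := nmD a h; lra.
pose w' := w (a + h); pose E := D (a + h) w' - D a w'.
have Eb : nm E <= K1 * nm h * nm w' by apply: DK1; exact: ltW.
have w'E : w' = I a (u (a + h) - E).
  by rewrite /E /w' /w DI// opprB addrCA subrr addr0 ID.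
have wE : w' - w a = I a (u (a + h) - u a - E).
  rewrite (_ : w a = I a (u a))// {1}w'E -linB//; congr (I a _).
  by rewrite addrAC.
have w'W : nm w' <= W.
  have uh : nm (u (a + h)) <= nm (u a) + Ku * r1.
    have := nm_subl (u (a + h)) (u a); have := uK h h1.
    have : Ku * nm h <= Ku * r1 by rewrite ler_wpM2l// ltW.
    clear; lra.
  have q1 : nm w' <= B * (nm (u (a + h)) + K1 * nm h * nm w').
    rewrite {1}w'E; apply: (le_trans (IB _)); rewrite ler_pM2l//.
    by apply: (le_trans (nmD _ _)); rewrite nmN lerD2l.
  have q2 : nm h * (2 * B * K1 + 1) < 1 by rewrite -ltr_pdivlMr.
  have q3 : B * (K1 * nm h * nm w') <= 2^-1 * nm w'.
    rewrite !mulrA; apply: ler_wpM2r; first exact: nm_ge0.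
    by have := nm_ge0 h; clear -q2; lra.
  have := ler_wpM2l (ltW B0) uh; rewrite /W; clear -q1 q3; lra.
have wL : nm (w' - w a) <= L1 * nm h.
  rewrite wE; apply: (le_trans (IB _)); rewrite /L1 -mulrA ler_pM2l// mulrDl.
  apply: (le_trans (nmD _ _)); rewrite nmN; apply: lerD; first exact: uK.
  apply: (le_trans Eb); have -> : K1 * W * nm h = K1 * nm h * W by ring.
  by apply: ler_wpM2l w'W; rewrite mulr_ge0 ?nm_ge0.
have -> : w (a + h) - w a - I a (U h - A h (I a (u a))) =
    I a ((u (a + h) - u a - U h) - ((E - A h w') + A h (w' - w a))).
  rewrite -/w' [in LHS]wE -linB//; congr (I a _).
  rewrite (linB _ _ (Ar h)) [E - _ + _]addrA subrK.
  by rewrite [RHS]subACA.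
apply: (le_trans (IB _)); rewrite mulrC -ler_pdivlMr//.
apply: (le_trans (nmD _ _)); rewrite nmN.
have -> : e * nm h / B = e / (2 * B) * nm h + e / (2 * B) / S * (S * nm h).
  by field; rewrite !gt_eqF.
apply: lerD; first exact: uP.
have p1 : nm (E - A h w') <= K2 * W * nm h * nm h.
  apply: (le_trans (AK2 h w' (ltW h3))).
  have -> : K2 * W * nm h * nm h = K2 * nm h ^+ 2 * W by ring.
  by apply: ler_wpM2l w'W; rewrite mulr_ge0 ?sqr_ge0.
have p2 : nm (A h (w' - w a)) <= BA' * L1 * nm h * nm h.
  apply: (le_trans (AB' _ _)).
  have -> : BA' * L1 * nm h * nm h = BA' * nm h * (L1 * nm h) by ring.
  by apply: ler_wpM2l wL; rewrite mulr_ge0 ?nm_ge0.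
apply: (le_trans (nmD _ _)).
apply: (@le_trans _ _ (nm h * (S * nm h))).
  have : 0 <= nm h * nm h by rewrite mulr_ge0 ?nm_ge0.
  by rewrite /S; clear -p1 p2; lra.
by apply: ler_wpM2r (ltW h6); rewrite mulr_ge0 ?nm_ge0 ?ltW.
Qed.

End Holomorphic.

(** * Locally biholomorphic mappings *)

Section Bridge.
Context {R : realType} {X : completeNormedModType R[i]}.
Context (dot : {dot X for conjC}) (dot_norm : forall x : X, dot x x = `|x| ^+ 2).
Local Notation C := R[i].
Implicit Types (f g : X -> X) (a b h k x y z : X) (s t : C).

Lemma nearP (P : X -> Prop) a :
  (\forall x \near a, P x) <-> exists2 d : R, 0 < d & forall h, nm h < d -> P (a + h).
Proof.
split=> [/nbhs_normP[e /= /C_gt0[d d0 ->] dP]|[d d0 dP]].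
  exists d => // h hd; apply: dP => /=.
  by rewrite opprD addrA subrr add0r normrN nmE ltcR.
apply/nbhs_normP; exists d%:C; first by rewrite /= ltcR.
move=> y /=; rewrite nmE ltcR nmB => yd.
by have := dP (y - a) yd; rewrite addrC subrK.
Qed.

Lemma differentiable_fder f z : differentiable f z -> fder f z ('d f z).
Proof.
move=> df; have dc : continuous ('d f z) by exact: diff_continuous.
split.
- move=> e e0; have := diff_locally df => /eqaddoP/(_ e%:C); rewrite ltcR => /(_ e0).
  move=> /nearP[d d0 dP]; exists d => // h hd.
  have E : nm (f (h + z) - (f z + 'd f z h)) <= e * nm h.
    by rewrite -lecR rmorphM/= -!nmE; have := dP h hd; rewrite add0r; exact.
  by move: E; rewrite opprD addrA (addrC h).
- by move=> t x y; rewrite linearP.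
- have [M M0 MP] := linear_lipschitz dc; have [B B0 MB] := C_gt0 M0.
  by exists B => h; have := MP h; rewrite MB !nmE -rmorphM lecR.
Qed.

Lemma in_unit_ball z : unit_ball z <-> nm z < 1.
Proof. by rewrite /unit_ball/= nmE -(ltcR _ 1). Qed.

(** The chain rule for g o f = id and f o g = id. *)
Lemma biholomorphic_inverse f V z : open V -> V z -> biholomorphic_on V f ->
  exists J : X -> X, [/\ linear J, exists B : R, forall x, nm (J x) <= B * nm x,
    forall x, J ('d f z x) = x & forall x, 'd f z (J x) = x].
Proof.
move=> oV Vz [hf ofV [g [hg gf]]].
have [Hf lf [Bf fB]] := differentiable_fder (hf z Vz).
have fVz : (f @` V) (f z) by exists z.
have [Hg lg [Bg gB]] := differentiable_fder (hg _ fVz).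
have lid : linear (fun x : X => x) by [].
have hid a : hasd (fun x : X => x) a (fun x => x).
  by move=> e e0; exists 1 => // h _; rewrite (addrC a) addrK subrr nm0 mulr_ge0 ?nm_ge0 ?ltW.
exists ('d g (f z)); split => //; first by exists Bg.
- have gfz : hasd (g \o f) z ('d g (f z) \o 'd f z).
    by apply: hasd_comp Hg Hf _ gB fB => x y; rewrite linB.
  have /nearP[d d0 dP] : \forall x \near z, V x by exact: open_nbhs_nbhs.
  have gfid : hasd (fun x => x) z ('d g (f z) \o 'd f z).
    by apply: hasd_near d0 _ gfz => h /dP Vh /=; exact: gf.
  apply: (hasd_unique gfid (hid z)) => //.
  by move=> t x y /=; rewrite lf lg.
- have gz : g (f z) = z by exact: gf.
  have fgz : hasd (f \o g) (f z) ('d f z \o 'd g (f z)).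
    by apply: hasd_comp; [rewrite gz; exact: Hf|exact: Hg|by move=> x y; rewrite linB|exact: fB|exact: gB].
  have /nearP[d d0 dP] : \forall x \near f z, (f @` V) x by exact: open_nbhs_nbhs.
  have fgid : hasd (fun x => x) (f z) ('d f z \o 'd g (f z)).
    by apply: hasd_near d0 _ fgz => h /dP[x Vx] /= <-; rewrite gf.
  apply: (hasd_unique fgid (hid (f z))) => //.
  by move=> t x y /=; rewrite lg lf.
Qed.

Lemma diff_invP f z : locally_biholomorphic unit_ball f -> nm z < 1 ->
  [/\ linear (diff_inv f z), exists B : R, forall x, nm (diff_inv f z x) <= B * nm x,
    forall x, diff_inv f z ('d f z x) = x & forall x, 'd f z (diff_inv f z x) = x].
Proof.
move=> [hf lb] /in_unit_ball z1; have [V [oV Vz _ bV]] := lb z z1.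
have [J [lJ BJ Jd dJ]] := biholomorphic_inverse oV Vz bV.
suff -> : diff_inv f z = J by [].
apply/funext => y; rewrite /diff_inv -{1}(dJ y); apply: pinvKV; rewrite ?in_setT//.
by move=> u v _ _ uv; rewrite -(Jd u) uv Jd.
Qed.

(** Any operator satisfying the defining property of the second derivative is the
    derivative of b |-> Df(b) x for each x, hence unique; [diff2] is therefore
    the operator found by Cauchy estimates. *)
Lemma diff2P f z A : locally_biholomorphic unit_ball f -> nm z < 1 ->
  second_der (fun b => 'd f b) z A -> forall h x, diff2 f z h x = A h x.
Proof.
move=> [hf _] z1 DA; have [Ar Al _ [B AB] [d d0 [K AK]]] := DA.
have is2 : is_diff2 f z A.
  split => //.
  - apply/nearP; exists (1 - nm z); first by rewrite subr_gt0.
    by move=> h hz; apply/hf/in_unit_ball; have := nmD z h; lra.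
  - exists B%:C => h x; rewrite !nmE -!rmorphM lecR; exact: AB.
  move=> e /C_gt0[r r0 ->]; pose K' := Num.max K 1.
  have K'0 : 0 < K' by rewrite lt_max ltr01 orbT.
  apply/nearP; exists (Num.min d (r / K')); first by rewrite lt_min d0 divr_gt0.
  move=> h; rewrite add0r lt_min => /andP[/ltW/(AK h) hd hK] x.
  rewrite !nmE -!rmorphM lecR; apply: (le_trans (hd x)).
  rewrite ltr_pdivlMr// in hK; rewrite ler_wpM2r ?nm_ge0// expr2 mulrA ler_wpM2r ?nm_ge0//.
  apply: le_trans (ltW hK); rewrite mulrC; apply: ler_wpM2l; first exact: nm_ge0.
  by rewrite le_max lexx.
have d2 : is_diff2 f z (diff2 f z) := getI is2.
have hder B' : is_diff2 f z B' -> forall x, hasd (fun b => 'd f b x) z (B'^~ x).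
  move=> [_ _ _ _ small] x e e0; pose e' := e / (nm x + 1).
  have x1 : 0 < nm x + 1 by have := nm_ge0 x; lra.
  have e'0 : 0 < e' by exact: divr_gt0.
  have := small e'%:C; rewrite ltcR => /(_ e'0)/nearP[r r0 rP].
  exists r => // h /rP; rewrite add0r => /(_ x); rewrite !nmE -!rmorphM lecR => hx.
  apply: (le_trans hx); rewrite mulrAC; apply: ler_wpM2r; first exact: nm_ge0.
  by rewrite /e' mulrAC ler_pdivrMr// ler_pM2l//; lra.
move=> h x; apply: (hasd_unique (hder _ d2 x) (hder _ is2 x)); last exact: Al.
by case: d2 => _ _ l2 _ _; exact: l2.
Qed.

End Bridge.

(** * Consequences of convexity of order alpha *)

Section ConvexMaps.
Context {R : realType} {X : completeNormedModType R[i]}.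
Context (dot : {dot X for conjC}) (dot_norm : forall x : X, dot x x = `|x| ^+ 2).
Local Notation C := R[i].
Implicit Types (f : X -> X) (h k x y z Y : X) (s t e : C).

(** All that the argument retains of a convex mapping f of order alpha:
    w z stands for Df(z)^-1 f(z) and Q z x y for Df(z)^-1 D2f(z)(x, y). *)
Record convex_data (alpha : R) (w : X -> X) (Q : X -> X -> X -> X) : Prop := {
  w_zero : w 0 = 0;
  w_fder : forall z, nm z < 1 -> fder w z (fun x => x - Q z x (w z));
  Q_linl : forall z y, nm z < 1 -> linear ((Q z)^~ y);
  Q_linr : forall z x, nm z < 1 -> linear (Q z x);
  Q_sym : forall z x y, nm z < 1 -> Q z x y = Q z y x;
  Q_fder : forall z x y, nm z < 1 -> exists L, fder (fun z => Q z x y) z L;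
  Q_convex : forall z x, nm z < 1 -> z != 0 -> x != 0 -> complex.Re (dot x z) = 0 ->
    alpha * nm x ^+ 2 < nm x ^+ 2 - complex.Re (dot (Q z x x) z)
}.

(** Both derivative formulas are instances of [fder_inverse]; the holomorphy of
    z |-> Q z x y uses a third derivative of f, namely the second derivative of the
    holomorphic mapping b |-> Df(b) y. *)
Lemma class_K_data (alpha : R) f : class_K dot alpha f ->
  exists Q, convex_data alpha (fun z => diff_inv f z (f z)) Q.
Proof.
move=> [[lb fK] [f0 Df0]]; pose D z : X -> X := 'd f z.
have fD : holo f D by move=> z /in_unit_ball z1; exact/differentiable_fder/lb.1.
have [A DA] := holo_second_der dot_norm fD.
have inv z (Hz : nm z < 1) := diff_invP lb Hz.
have lD b : nm b < 1 -> linear (D b) by move=> /fD[].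
have fI u U z : nm z < 1 -> fder u z U ->
    fder (fun b => diff_inv f b (u b)) z
      (fun h => diff_inv f z (U h - A z h (diff_inv f z (u z)))).
  move=> z1 uU; have [lI BI ID _] := inv z z1.
  apply: (fder_inverse z1 (DA z z1) lD lI BI ID _ uU) => b x b1.
  by have [_ _ _ DI] := inv b b1; exact: DI.
exists (fun z x y => diff_inv f z (A z x y)); split.
- have z1 : nm (0 : X) < 1 by rewrite nm0.
  by have [lI _ _ _] := inv 0 z1; rewrite f0 lin0.
- move=> z z1; have := fI _ _ z z1 (fD z z1).
  have [lI _ ID _] := inv z z1.
  set L := (X in fder _ _ X) => fL; set L' := (X in fder _ _ X).
  suff -> : L' = L by [].
  by apply/funext => h; rewrite /L /L' linB// ID.
- move=> z y z1; have [lI _ _ _] := inv z z1; have [_ l2 _ _ _] := DA z z1.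
  by move=> t u v; rewrite /= (l2 y) lI.
- move=> z y z1; have [lI _ _ _] := inv z z1; have [l2 _ _ _ _] := DA z z1.
  by move=> t u v; rewrite /= (l2 y) lI.
- by move=> z x y z1; have [_ _ -> _ _] := DA z z1.
- move=> z x y z1.
  have Dy : holo (fun b => D b y) (fun b h => A b h y).
    by move=> b b1; exact: second_der_fder (DA b b1).
  have [A' DA'] := holo_second_der dot_norm Dy.
  by eexists; exact: fI z1 (second_der_fder x (DA' z z1)).
- move=> z x z1 z0 x0 xz.
  have := fK z x; rewrite !in_unit_ball => /(_ z1 z0 x0).
  rewrite -!complexRe xz => /(_ erefl); rewrite (diff2P lb z1 (DA z z1)).
  by rewrite !nmE -!rmorphXn -rmorphM -rmorphB/= ltcR.
Qed.

Section Improved.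
Context (alpha : R) (w : X -> X) (Q : X -> X -> X -> X).
Context (wQ : convex_data alpha w Q) (alt1 : alpha < 1).

Lemma Q_scale z t Y : nm z < 1 -> Q z (t *: Y) (t *: Y) = t ^+ 2 *: Q z Y Y.
Proof.
move=> z1; rewrite (linZ t Y (Q_linr wQ _ z1)) (linZ t Y (Q_linl wQ _ z1)).
by rewrite scalerA -expr2.
Qed.

(** The convexity condition at t z for the vector i conj(u) t Y with u^2 = e: this
    rotation of Y is what makes its real inner product with t z vanish. *)
Lemma convex_halfplane z Y e t : nm e = 1 -> nm t * nm z < 1 ->
  dot Y z = e * (dot Y z)^*%C ->
  - ((1 - alpha) * nm Y ^+ 2) <= complex.Re (e^*%C * (t * dot (Q (t *: z) Y Y) z)).
Proof.
move=> e1 tz dY; have a1 := alt1.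
have [->|Y0] := eqVneq Y 0.
  have tz1 : nm (t *: z) < 1 by rewrite nmZ.
  by rewrite (lin0 (Q_linr wQ 0 tz1)) (dot0l dot) !mulr0 nm0 expr0n/= mulr0 oppr0.
have C0 : 0 <= (1 - alpha) * nm Y ^+ 2 by rewrite mulr_ge0 ?sqr_ge0//; lra.
have [->|t0] := eqVneq t 0; first by rewrite mul0r mulr0 oppr_le0.
have [->|z0] := eqVneq z 0; first by rewrite (dot0r dot) !mulr0 oppr_le0.
have tz1 : nm (t *: z) < 1 by rewrite nmZ.
pose u := sqrtc e; have uu : u ^+ 2 = e by exact: sqr_sqrtc.
have nu : nm u = 1.
  by apply/eqP; rewrite -(@eqrXn2 _ 2)// ?nm_ge0// -nmX uu e1 expr1n.
have uJ : u * u^*%C = 1 by rewrite -nm_sqrJ nu expr1n.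
pose c := 'i%C * u^*%C * t; pose x := c *: Y.
have i1 : nm ('i%C : C) = 1 by rewrite /nm/= expr0n expr1n add0r sqrtr1.
have nc : nm c = nm t by rewrite /c !nmM nmJ nu i1 !mul1r.
have x0 : x != 0 by rewrite -nm_gt0 nmZ mulr_gt0 ?nm_gt0// -nm_gt0 nc nm_gt0.
have udr : complex.Im (u^*%C * dot Y z) = 0.
  have E : (u^*%C * dot Y z)^*%C = u^*%C * dot Y z.
    rewrite rmorphM/= conjcK [in RHS]dY -uu expr2 !mulrA (mulrC u^*%C) uJ mul1r //.
  by have := congr1 (@complex.Im R) E; rewrite cImJ; lra.
have xz : complex.Re (dot x (t *: z)) = 0.
  rewrite /x (dotZl dot) (dotZr dot).
  have -> : c * (t^*%C * dot Y z) = 'i%C * ((nm t ^+ 2)%:C * (u^*%C * dot Y z)).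
    by rewrite nm_sqrJ /c; ring.
  move: (u^*%C * dot Y z) udr => q udr.
  by rewrite !cReM !cImM/= udr; ring.
have tz0 : t *: z != 0 by rewrite -nm_gt0 nmZ mulr_gt0 ?nm_gt0.
have := Q_convex wQ tz1 tz0 x0 xz.
rewrite /x (Q_scale c Y tz1) (dotZl dot) (dotZr dot) nmZ nc.
have -> : c ^+ 2 * (t^*%C * dot (Q (t *: z) Y Y) z) =
   - ((nm t ^+ 2)%:C * (e^*%C * (t * dot (Q (t *: z) Y Y) z))).
  rewrite nm_sqrJ -uu rmorphXn /c /=; have := sqr_i R; set i := 'i%C => ii.
  have -> : (i * u^*%C * t) ^+ 2 = i ^+ 2 * (u^*%C * t) ^+ 2 by ring.
  by rewrite ii; ring.
set S := e^*%C * _; rewrite cReN cReM/= mul0r subr0 opprK exprMn.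
have nt : 0 < nm t ^+ 2 by rewrite exprn_gt0// nm_gt0.
move=> h; rewrite -(ler_pM2l nt); lra.
Qed.

(** By [convex_halfplane] the holomorphic function S t = conj(e) <t Q (t z) Y Y, z>
    maps the disc of radius 1/|z| into a half plane and vanishes at 0.  The Schwarz lemma
    for its Cayley transform, at t = 1, sharpens the constant 1 - alpha by a factor
    2|z|/(1 + |z|) < 1 and bounds |<Q z Y Y, z>| itself. *)
Lemma convex_improved z Y e : nm e = 1 -> nm z < 1 ->
  dot Y z = e * (dot Y z)^*%C ->
  - (2 * (1 - alpha) * nm Y ^+ 2 * nm z) <= complex.Re (e^*%C * dot (Q z Y Y) z) * (1 + nm z) /\
  nm (dot (Q z Y Y) z) * (1 - nm z) <= 2 * (1 - alpha) * nm Y ^+ 2 * nm z.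
Proof.
move=> e1 z1 dY; have a1 := alt1.
have [->|Y0] := eqVneq Y 0.
  by rewrite (lin0 (Q_linr wQ 0 z1)) (dot0l dot) !mulr0 !nm0 expr0n/= !mulr0 !mul0r oppr0.
have [->|z0] := eqVneq z 0.
  by rewrite (dot0r dot) !mulr0 !nm0 !mulr0 !mul0r oppr0.
have nz : 0 < nm z by rewrite nm_gt0.
pose K := (1 - alpha) * nm Y ^+ 2.
have K0 : 0 < K by rewrite mulr_gt0 ?exprn_gt0 ?nm_gt0//; lra.
pose S t := e^*%C * (t * dot (Q (t *: z) Y Y) z).
have inb t : nm t < (nm z)^-1 -> nm t * nm z < 1.
  by rewrite -{1}(mul1r (nm z)^-1) ltr_pdivlMr.
have SK t : nm t < (nm z)^-1 -> - K <= complex.Re (S t).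
  by move=> /inb tz; exact: convex_halfplane.
have dS t : nm t < (nm z)^-1 -> exists d, cder S t d.
  move=> /inb tz; have tz1 : nm (0 + t *: z) < 1 by rewrite add0r nmZ.
  have [L QL] := Q_fder wQ Y Y tz1.
  have := cderM (cder_cst e^*%C t) (cderM (cder_id t) (fder_scalar dot_norm z QL)).
  set d := (X in cder _ _ X) => dd; exists d; move: dd; rewrite /S.
  by under eq_fun do rewrite add0r.
(* the Cayley transform of the half plane Re S >= - K with fixed point 0 *)
pose g t := S t / (S t + (2 * K)%:C).
have den t : nm t < (nm z)^-1 -> 0 < complex.Re (S t + (2 * K)%:C).
  by move=> /SK; rewrite cReD/=; lra.
have den0 t : nm t < (nm z)^-1 -> S t + (2 * K)%:C != 0.
  by move=> /den; apply: contraTneq => ->; rewrite ltxx.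
have dg t : nm t < (nm z)^-1 -> exists d, cder g t d.
  move=> ts; have [d Sd] := dS t ts.
  have [d' vd] := cderV (cderD Sd (cder_cst (2 * K)%:C t)) (den0 t ts).
  by eexists; exact: cderM Sd vd.
have g1 t : nm t < (nm z)^-1 -> nm (g t) <= 1.
  move=> ts; rewrite /g nmM nmV ler_pdivrMr ?nm_gt0 ?den0// mul1r.
  rewrite -(@ler_pXn2r _ 2)// ?nnegrE ?nm_ge0// !nm_sqr cReD cImD/= addr0 lerD2r.
  have := SK t ts; set x := complex.Re _ => h.
  have : 0 <= K * (x + K) by apply: mulr_ge0; lra.
  by rewrite !expr2; lra.
have g0 : g 0 = 0 by rewrite /g /S mul0r mulr0 mul0r.
have one : nm (1 : C) < (nm z)^-1 by rewrite nm1 invf_gt1.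
have := schwarz (_ : 0 < (nm z)^-1) dg g1 g0 one; rewrite invr_gt0 => /(_ nz).
rewrite nm1 mulr1 ler_pdivrMr// mul1r /g nmM nmV ler_pdivrMr ?nm_gt0 ?den0//.
have -> : S 1 = e^*%C * dot (Q z Y Y) z by rewrite /S mul1r scale1r.
have -> : nm (dot (Q z Y Y) z) = nm (e^*%C * dot (Q z Y Y) z) by rewrite nmM nmJ e1 mul1r.
have := SK 1 one; rewrite {1}/S mul1r scale1r; set T := e^*%C * _ => TK h.
have K2 : nm ((2 * K)%:C : C) = 2 * K by rewrite nm_real gtr0_norm//; lra.
split.
- have h2 : nm T ^+ 2 <= nm z ^+ 2 * nm (T + (2 * K)%:C) ^+ 2.
    by rewrite -exprMn lerXn2r// nnegrE ?mulr_ge0 ?nm_ge0.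
  move: h2; rewrite !nm_sqr cReD cImD/= addr0.
  set x := complex.Re T in TK *; set y := complex.Im T => h2.
  have x2 : x ^+ 2 <= (nm z * (x + 2 * K)) ^+ 2.
    rewrite exprMn; have : 0 <= (1 - nm z ^+ 2) * y ^+ 2.
      rewrite mulr_ge0 ?sqr_ge0// subr_ge0 -(expr1n _ 2) lerXn2r ?nnegrE ?nm_ge0//; exact: ltW.
    by move: h2; rewrite mulrDr mulrBl mul1r; lra.
  have p0 : 0 <= nm z * (x + 2 * K) by rewrite mulr_ge0 ?nm_ge0//; lra.
  have : `|x| <= nm z * (x + 2 * K).
    by rewrite -(@ler_pXn2r _ 2)// ?nnegrE ?normr_ge0// real_normK ?num_real.
  have -> : 2 * (1 - alpha) * nm Y ^+ 2 * nm z = 2 * K * nm z by rewrite /K; ring.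
  by rewrite ler_norml; lra.
- have := nmD T (2 * K)%:C; rewrite K2 => /(ler_wpM2l (nm_ge0 z)).
  have -> : 2 * (1 - alpha) * nm Y ^+ 2 * nm z = 2 * K * nm z by rewrite /K; ring.
  by move: h; rewrite mulrC; lra.
Qed.

Lemma phase_exists (d : C) : exists2 e, nm e = 1 & d = e * d^*%C.
Proof.
have [->|d0] := eqVneq d 0; first by exists 1; rewrite ?nm1// conjc0 mulr0.
have dJ : d^*%C != 0 by rewrite conjc_eq0.
exists (d / d^*%C); last by rewrite divfK.
by rewrite nmM nmV nmJ divff// gt_eqF// nm_gt0.
Qed.

(** Every Y satisfies the phase condition of [convex_improved] for some e. *)
Lemma Q_quadratic_le z Y (r : R) : r < 1 -> nm z <= r ->
  nm (dot (Q z Y Y) z) <= 2 * (1 - alpha) / (1 - r) * nm z * nm Y ^+ 2.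
Proof.
move=> r1 zr; have a1 := alt1; have z1 : nm z < 1 by lra.
have [e e1 dY] := phase_exists (dot Y z).
have [_ h] := convex_improved e1 z1 dY.
have : nm (dot (Q z Y Y) z) * (1 - r) <= nm (dot (Q z Y Y) z) * (1 - nm z).
  by apply: ler_wpM2l; [exact: nm_ge0 | lra].
move=> /le_trans/(_ h); rewrite -ler_pdivlMr; last by lra.
move=> h2; apply: (le_trans h2); rewrite le_eqVlt; apply/orP; left; apply/eqP.
by field; rewrite gt_eqF; lra.
Qed.

(** Polarisation and the parallelogram law, for unit vectors. *)
Lemma Q_bilinear_le z x y (r : R) : r < 1 -> nm z <= r ->
  nm (dot (Q z x y) z) <= 2 * (1 - alpha) / (1 - r) * nm z * nm x * nm y.
Proof.
move=> r1 zr; have z1 : nm z < 1 by lra.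
have [->|x0] := eqVneq x 0.
  by rewrite (lin0 (Q_linl wQ y z1)) (dot0l dot) !nm0 mulr0 mul0r.
have [->|y0] := eqVneq y 0.
  by rewrite (lin0 (Q_linr wQ x z1)) (dot0l dot) !nm0 mulr0.
have nx : 0 < nm x by rewrite nm_gt0.
have ny : 0 < nm y by rewrite nm_gt0.
set K := 2 * (1 - alpha) / (1 - r) * nm z.
pose u := (nm x)^-1%:C *: x; pose v := (nm y)^-1%:C *: y.
have nu : nm u = 1 by rewrite nmZ nm_real gtr0_norm ?invr_gt0// mulVf// gt_eqF.
have nv : nm v = 1 by rewrite nmZ nm_real gtr0_norm ?invr_gt0// mulVf// gt_eqF.
have xu : x = (nm x)%:C *: u.
  by rewrite /u scalerA -rmorphM divff ?gt_eqF// scale1r.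
have yv : y = (nm y)%:C *: v.
  by rewrite /v scalerA -rmorphM divff ?gt_eqF// scale1r.
rewrite {1}xu {1}yv (linZ _ v (Q_linr wQ _ z1)) (linZ _ u (Q_linl wQ _ z1)) scalerA.
rewrite (dotZl dot) nmM nmM !nm_real !gtr0_norm// mulrC.
suff : nm (dot (Q z u v) z) <= K.
  move=> h; have -> : K * nm x * nm y = K * (nm y * nm x) by ring.
  by rewrite ler_wpM2r// mulr_ge0 ?nm_ge0.
have pol : dot (Q z u v) z * 4%:R = dot (Q z (u + v) (u + v)) z - dot (Q z (u - v) (u - v)) z.
  rewrite !(linD _ _ (Q_linr wQ _ z1)) !(linN _ (Q_linr wQ _ z1)).
  rewrite (linD _ _ (Q_linl wQ u z1)) (linD _ _ (Q_linl wQ v z1)).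
  rewrite (linB _ _ (Q_linl wQ u z1)) (linB _ _ (Q_linl wQ v z1)).
  by rewrite (Q_sym wQ v u z1) opprB !(dotDl dot) !(dotNl dot); ring.
have n4 : nm (4%:R : C) = 4 by rewrite -(rmorph_nat (real_complex R)) nm_real ger0_norm.
have h1 := Q_quadratic_le (u + v) r1 zr; have h2 := Q_quadratic_le (u - v) r1 zr.
have par : nm (u + v) ^+ 2 + nm (u - v) ^+ 2 = 4.
  by rewrite !(nm_sqr_dotD dot_norm) nmN nu nv (dotNr dot) cReN; ring.
have := nmD (dot (Q z (u + v) (u + v)) z) (- dot (Q z (u - v) (u - v)) z).
rewrite -pol nmM n4 nmN -/K in h1 h2 *.
move=> h3; have : nm (dot (Q z u v) z) * 4 <= K * 4.
  by apply: (le_trans h3); rewrite -par mulrDr; exact: lerD.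
by rewrite ler_pM2r.
Qed.

End Improved.
End ConvexMaps.

(** * Nearest points of closed sets from perturbed centres *)

Section NearestPoint.
Context {R : realType} {X : completeNormedModType R[i]}.
Context (dot : {dot X for conjC}) (dot_norm : forall x : X, dot x x = `|x| ^+ 2).
Local Notation C := R[i].
Implicit Types (x y z c : X) (S : set X).

Definition tends_to (u : nat -> X) (l : X) :=
  forall e : R, 0 < e -> exists N, forall n, (N <= n)%N -> nm (u n - l) < e.

(** Completeness for sequences with geometrically decreasing steps. *)
Lemma geometric_cvg (u : nat -> X) (K : R) :
  (forall n, nm (u n.+1 - u n) <= K * 2^-1 ^+ n) ->
  exists2 l, tends_to u l & nm (l - u 0%N) <= 2 * K.
Proof.
move=> uK.
have p0 n : 0 < (2^-1 : R) ^+ n by rewrite exprn_gt0// invr_gt0.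
have K0 : 0 <= K by have := le_trans (nm_ge0 _) (uK 0%N); rewrite expr0 mulr1.
have dist n m : nm (u (n + m)%N - u n) <= 2 * K * 2^-1 ^+ n * (1 - 2^-1 ^+ m).
  elim: m => [|m IH]; first by rewrite addn0 subrr nm0 expr0 subrr mulr0.
  rewrite addnS; apply: (le_trans (nm_tri _ (u (n + m)%N) _)).
  have := uK (n + m)%N; rewrite exprD exprS.
  have -> : 2 * K * 2^-1 ^+ n * (1 - 2^-1 * 2^-1 ^+ m) =
    K * (2^-1 ^+ n * 2^-1 ^+ m) + 2 * K * 2^-1 ^+ n * (1 - 2^-1 ^+ m) :> R by field.
  by move=> h; exact: lerD.
have dist2 n m : (n <= m)%N -> nm (u m - u n) <= 2 * K * 2^-1 ^+ n.
  move=> nmle; rewrite -(subnKC nmle); apply: (le_trans (dist _ _)).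
  rewrite -[leRHS]mulr1; apply: ler_wpM2l; first by rewrite !mulr_ge0// ltW.
  by rewrite lerBlDr lerDl ltW.
have [e e0|l ul] := @complete_seq _ _ u.
  have K4 : 0 < 4 * K + 1 by lra.
  have [|n nP] := @exp_small R 2^-1 (e / (4 * K + 1)) _ (divr_gt0 e0 K4).
    by rewrite invr_ge0 ler0n/= invf_lt1// ltr1n.
  exists n => i j ni nj; apply: (le_lt_trans (nm_tri _ (u n) _)).
  have := dist2 _ _ ni; have := dist2 _ _ nj; rewrite (nmB (u j) (u n)).
  move: nP; rewrite ltr_pdivlMr; last by lra.
  have := p0 n; lra.
exists l => //; apply/ler_addgt0Pr => e e0; have [N NP] := ul e e0.
have := nm_tri l (u N) (u 0%N); rewrite (nmB l (u N)).
have := dist2 0%N N (leq0n _); rewrite expr0 mulr1; have := NP N (leqnn _); lra.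
Qed.

Lemma approx_minimum (T : Type) (S : T -> Prop) (f : T -> R) (z : T) (e : R) :
  0 < e -> S z -> (forall v, S v -> 0 <= f v) ->
  exists2 z', S z' /\ f z' <= f z & forall v, S v -> f z' <= f v + e.
Proof.
move=> e0 Sz f0.
pose V : set R := [set f v | v in [set v | S v]].
have hV : has_inf V.
  by split; [exists (f z), z | exists 0 => _ [v Sy <-]; exact: f0].
have [_ [v Sy <-] ylt] := inf_adherent e0 hV.
have yP v2 : S v2 -> f v <= f v2 + e.
  move=> Sv; have : inf V <= f v2 by apply: ge_inf; [exact: hV.2 | exists v2].
  lra.
have [yz|zy] := lerP (f v) (f z); first by exists v.
by exists z => // v2 /yP; move=> ?; apply: le_trans (ltW zy) _.
Qed.

(** Starting from c = 0, move the centre repeatedly by a small fraction tau of the way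
    towards an almost nearest point.  In the Hilbert norm
        |y - c'|^2 = (1 - tau)|y - c|^2 + tau |y - z|^2 - tau (1 - tau)|z - c|^2
    for c' = c + tau (z - c), so points far from z become worse and the almost nearest
    points form a Cauchy sequence, while the centre moves by at most eps in total. *)
Lemma nearest_point S (eps : R) z : 0 < eps -> S z ->
  (forall y, S y -> nm y <= 1) ->
  (forall u l, (forall n, S (u n)) -> tends_to u l -> S l) ->
  exists c z0, [/\ nm c <= eps, S z0 & forall y, S y -> nm (z0 - c) <= nm (y - c)].
Proof.
move=> eps0 Sz S1 Scl.
(* the centre moves by at most 2 * d * 2^-n at step n, and almost nearest means up to
   tau n * 4^-n *)
pose d := Num.min (eps / 4) 2^-1.
have d0 : 0 < d by rewrite lt_min divr_gt0//= invr_gt0.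
have [d1 d2] : d <= eps / 4 /\ d <= 2^-1 by rewrite !ge_min !lexx orbT.
pose p n : R := 2^-1 ^+ n.
have p0 n : 0 < p n by rewrite exprn_gt0// invr_gt0.
have p1 n : p n <= 1 by rewrite exprn_ile1 ?invr_ge0 ?ler0n// invf_le1// ler1n.
pose tau n := d * p n; pose eta n := tau n * p n ^+ 2.
have tau0 n : 0 < tau n by rewrite mulr_gt0.
have eta0 n : 0 < eta n by rewrite mulr_gt0// exprn_gt0.
have tau1 n : tau n <= 2^-1.
  by apply: le_trans d2; rewrite /tau -[leRHS]mulr1 ler_pM2l.
pose f c y := nm (y - c) ^+ 2.
pose good n (cz : X * X) := S cz.2 /\ forall y, S y -> f cz.1 cz.2 <= f cz.1 y + eta n.
pose nextc n (cz : X * X) := cz.1 + (tau n)%:C *: (cz.2 - cz.1).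
have step (nc : nat * (X * X)) : exists cz', good nc.1 nc.2 ->
    [/\ good nc.1.+1 cz', cz'.1 = nextc nc.1 nc.2 & f cz'.1 cz'.2 <= f cz'.1 nc.2.2].
  case: nc => n [c y] /=; case: (pselect (S y)) => [Sy|nSy]; last by exists (c, y) => -[].
  have [z' [Sz' z'y] z'P] := approx_minimum (eta0 n.+1) Sy (fun v _ => sqr_ge0 (nm (v - nextc n (c, y)))).
  by exists (nextc n (c, y), z') => _; split.
have [nx nxP] := choice step.
have [z1 [Sz1 _] z1P] := approx_minimum (eta0 0%N) Sz (fun v _ => sqr_ge0 (nm (v - 0))).
pose s := fix s n := if n is m.+1 then nx (m, s m) else ((0 : X), z1).
have gs n : good n (s n).
  by elim: n => [|n IH] //=; have [] := nxP (n, s n) IH.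
have sS n : (s n.+1).1 = nextc n (s n) /\ f (s n.+1).1 (s n.+1).2 <= f (s n.+1).1 (s n).2.
  by have [_ ? ?] := nxP (n, s n) (gs n).
have nz n : nm (s n).2 <= 1 by apply: S1; exact: (gs n).1.
have nc n : nm (s n).1 <= 1.
  elim: n => [|n IH]; first by rewrite /= nm0.
  rewrite (sS n).1 /nextc.
  have -> : (s n).1 + (tau n)%:C *: ((s n).2 - (s n).1) =
      (1 - tau n)%:C *: (s n).1 + (tau n)%:C *: (s n).2.
    by rewrite scalerBr rmorphB rmorph1 scalerBl scale1r addrA addrAC.
  have t1 : 0 <= 1 - tau n by have := tau1 n; lra.
  apply: (le_trans (nmD _ _)); rewrite !nmZ !nm_real (ger0_norm t1) gtr0_norm//.
  have := ler_wpM2l (ltW (tau0 n)) (nz n); have := ler_wpM2l t1 IH; lra.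
have stepz n : nm ((s n.+1).2 - (s n).2) <= 1 * 2^-1 ^+ n.
  rewrite mul1r -/(p n); have [Sn minn] := gs n; have [cn lt] := sS n.
  have Sn1 : S (s n.+1).2 := (gs n.+1).1.
  move: lt; rewrite cn /f /nextc; set c := (s n).1; set v := (s n).2; set v' := (s n.+1).2.
  have E y : nm (y - (c + (tau n)%:C *: (v - c))) ^+ 2 =
      (1 - tau n) * nm (y - c) ^+ 2 + tau n * nm (y - v) ^+ 2 - tau n * (1 - tau n) * nm (v - c) ^+ 2.
    have -> : y - (c + (tau n)%:C *: (v - c)) = (y - c) - (tau n)%:C *: (v - c) by rewrite opprD addrA.
    have -> : y - v = (y - c) - (v - c) by rewrite opprB addrA subrK.
    move: (y - c) (v - c) => y1 y2.
    rewrite !(nm_sqr_dotD dot_norm) !(dotNr dot) (dotZr dot) !nmN nmZ nm_real ger0_norm ?ltW//.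
    by rewrite conjc_real !cReN cReM/= mul0r subr0; ring.
  rewrite !E subrr nm0 expr0n/= mulr0 addr0.
  have := minn _ Sn1; rewrite /f -/c -/v -/v' /eta => h1 h2.
  rewrite -(@ler_pXn2r _ 2)// ?nnegrE ?nm_ge0 ?(ltW (p0 n))// -(ler_pM2l (tau0 n)).
  have t01 : 0 <= 1 - tau n by have := tau1 n; lra.
  have := ler_wpM2l t01 h1.
  have : 0 <= tau n * (tau n * p n ^+ 2) by rewrite !mulr_ge0 ?sqr_ge0// ltW.
  lra.
have stepc n : nm ((s n.+1).1 - (s n).1) <= (2 * d) * 2^-1 ^+ n.
  rewrite (sS n).1 /nextc addrAC subrr add0r nmZ nm_real gtr0_norm//.
  have : nm ((s n).2 - (s n).1) <= 2.
    by apply: (le_trans (nmD _ _)); rewrite nmN; have := nc n; have := nz n; lra.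
  by move=> /(ler_wpM2l (ltW (tau0 n))); rewrite /tau -/(p n); lra.
have [z0 zz0 _] := geometric_cvg stepz.
have [c cc cd] := geometric_cvg stepc.
exists c, z0; split.
- by move: cd; rewrite /= subr0; lra.
- by apply: (Scl (fun n => (s n).2)) => // n; exact: (gs n).1.
move=> y Sy; rewrite leNgt; apply/negP => lt.
pose g := nm (z0 - c) - nm (y - c); have g0 : 0 < g by rewrite subr_gt0.
have g8 : 0 < g / 8 by rewrite divr_gt0.
have [N1 N1P] := zz0 _ g8; have [N2 N2P] := cc _ g8.
have g28 : 0 < Num.min 1 (g ^+ 2 / 8) by rewrite lt_min ltr01 divr_gt0// exprn_gt0.
have [|N3 N3P] := @exp_small R 2^-1 (Num.min 1 (g ^+ 2 / 8)) _ g28.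
  by rewrite invr_ge0 ler0n/= invf_lt1// ltr1n.
pose n := maxn N1 (maxn N2 N3).
have h1 : nm ((s n).2 - z0) < g / 8 by apply: N1P; rewrite /n leq_max leqnn.
have h2 : nm ((s n).1 - c) < g / 8 by apply: N2P; rewrite /n !leq_max leqnn orbT.
have h3 : p n < g ^+ 2 / 8.
  apply: (@le_lt_trans _ _ (2^-1 ^+ N3)).
    rewrite /p; apply: ler_wiXn2l; rewrite ?invr_ge0 ?ler0n ?invf_le1 ?ler1n//.
    by rewrite /n !leq_max leqnn !orbT.
  by apply: (lt_le_trans N3P); rewrite ge_min lexx orbT.
have h4 : eta n <= p n.
  rewrite /eta; have := tau1 n; have := p1 n; have := p0 n => q0 q1 q2.
  have q3 : p n ^+ 2 <= p n by rewrite expr2 -[leRHS]mulr1 ler_pM2l.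
  have := ler_wpM2l (ltW (tau0 n)) q3; have := ler_wpM2r (ltW q0) q2; lra.
have := (gs n).2 y Sy; rewrite /f.
set a := nm ((s n).2 - (s n).1); set b := nm (y - (s n).1) => h5.
have ha : nm (z0 - c) - g / 4 <= a.
  have := nm_tri z0 (s n).2 c; have := nm_tri (s n).2 (s n).1 c; rewrite (nmB z0 (s n).2) /a; lra.
have hb : b <= nm (y - c) + g / 8.
  by have := nm_tri y c (s n).1; rewrite (nmB c (s n).1) /b; lra.
have b0 : 0 <= b by exact: nm_ge0.
have ab : b + g / 2 <= a by have g0' := g0; rewrite /g in ha hb g0' *; clear -ha hb g0'; lra.
have : (b + g / 2) ^+ 2 <= a ^+ 2.
  by rewrite lerXn2r// nnegrE; clear -b0 g0 ab; lra.
have : 0 <= b * g by rewrite mulr_ge0// ltW.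
have : 0 < g ^+ 2 by rewrite exprn_gt0.
clear -h5 h4 h3; rewrite !expr2; lra.
Qed.

End NearestPoint.

(** * Right derivatives *)

Section RightDerivative.
Context {R : realType}.
Local Notation C := R[i].
Implicit Types (f g : R -> C) (d e : C).

(** Derivatives at 0 of functions of a real parameter s > 0; they serve to
    differentiate expressions involving complex conjugates and norms along a ray. *)
Definition rder f d := forall e : R, 0 < e -> exists2 r : R, 0 < r &
  forall s, 0 < s < r -> nm (f s - f 0 - s%:C * d) <= e * s.

Lemma rder_cst d : rder (fun=> d) 0.
Proof.
by move=> e e0; exists 1 => // s /andP[s0 _]; rewrite subrr mulr0 subrr nm0 mulr_ge0 ?ltW.
Qed.

Lemma rder_id : rder (fun s => s%:C) 1.
Proof.
by move=> e e0; exists 1 => // s /andP[s0 _]; rewrite subr0 mulr1 subrr nm0 mulr_ge0 ?ltW.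
Qed.

Lemma rderD f g d e : rder f d -> rder g e -> rder (fun s => f s + g s) (d + e).
Proof.
move=> fd ge q q0; have q20 : 0 < q / 2 by lra.
have [r r0 rP] := fd _ q20; have [r' r'0 r'P] := ge _ q20.
exists (Num.min r r') => [|s]; first by rewrite lt_min r0.
rewrite lt_min => /andP[s0 /andP[sr sr']].
have -> : f s + g s - (f 0 + g 0) - s%:C * (d + e) =
  (f s - f 0 - s%:C * d) + (g s - g 0 - s%:C * e) by ring.
apply: (le_trans (nmD _ _)).
have := rP s; have := r'P s; rewrite s0 sr sr' => /(_ isT) ? /(_ isT) ?; lra.
Qed.

Lemma rderJ f d : rder f d -> rder (fun s => (f s)^*%C) d^*%C.
Proof.
move=> fd q /fd[r r0 rP]; exists r => // s /rP; rewrite -nmJ !rmorphB rmorphM/=.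
by rewrite oppr0.
Qed.

Lemma rder_lip f d : rder f d -> exists2 r : R, 0 < r &
  forall s, 0 < s < r -> nm (f s - f 0) <= (nm d + 1) * s.
Proof.
move=> /(_ 1 ltr01)[r r0 rP]; exists r => // s sr; have /andP[s0 _] := sr.
have := rP s sr; have := nm_subl (f s - f 0) (s%:C * d).
by rewrite nmM nm_real gtr0_norm//; lra.
Qed.

Lemma rderM f g d e : rder f d -> rder g e -> rder (fun s => f s * g s) (d * g 0 + f 0 * e).
Proof.
move=> fd ge q q0.
pose S := nm (f 0) + nm (g 0) + 1; pose K := (nm d + 1) * (nm e + 1).
have S0 : 0 < S by rewrite /S; have := nm_ge0 (f 0); have := nm_ge0 (g 0); lra.
have K0 : 0 < K by rewrite mulr_gt0// ltr_wpDl ?nm_ge0.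
have e1 : 0 < q / (2 * S) by rewrite divr_gt0// mulr_gt0.
have [r1 r10 r1P] := fd _ e1; have [r2 r20 r2P] := ge _ e1.
have [r3 r30 r3P] := rder_lip fd; have [r4 r40 r4P] := rder_lip ge.
exists (Num.min (Num.min r1 r2) (Num.min (Num.min r3 r4) (q / (2 * K)))).
  by rewrite !lt_min r10 r20 r30 r40 divr_gt0// mulr_gt0.
move=> s; rewrite !lt_min => /andP[s0 /andP[/andP[h1 h2] /andP[/andP[h3 h4] h5]]].
have /r1P a1 : 0 < s < r1 by rewrite s0.
have /r2P a2 : 0 < s < r2 by rewrite s0.
have /r3P a3 : 0 < s < r3 by rewrite s0.
have /r4P a4 : 0 < s < r4 by rewrite s0.
have -> : f s * g s - f 0 * g 0 - s%:C * (d * g 0 + f 0 * e) =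
  (f s - f 0 - s%:C * d) * g 0 + f 0 * (g s - g 0 - s%:C * e) + (f s - f 0) * (g s - g 0) by ring.
apply: (le_trans (nmD _ _)).
have -> : q * s = q / (2 * S) * s * S + q / (2 * K) * (K * s).
  by field; rewrite !gt_eqF.
apply: lerD.
  apply: (le_trans (nmD _ _)); rewrite !nmM.
  have := ler_wpM2r (nm_ge0 (g 0)) a1; have := ler_wpM2l (nm_ge0 (f 0)) a2.
  have : 0 <= q / (2 * S) * s by rewrite mulr_ge0// ltW.
  by rewrite /S; lra.
rewrite nmM; apply: (le_trans (ler_pM (nm_ge0 _) (nm_ge0 _) a3 a4)).
have -> : (nm d + 1) * s * ((nm e + 1) * s) = s * (K * s) by rewrite /K; ring.
by apply: ler_wpM2r (ltW h5); rewrite mulr_ge0 ?ltW.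
Qed.

(** A function that is nonnegative at 0 and nonpositive to the right of 0 cannot
    increase. *)
Lemma rder_Re_le0 f d (r : R) : rder f d -> 0 < r -> 0 <= complex.Re (f 0) ->
  (forall s, 0 < s < r -> complex.Re (f s) <= 0) -> complex.Re d <= 0.
Proof.
move=> fd r0 f0 fs; rewrite leNgt; apply/negP => dp.
have dp2 : 0 < complex.Re d / 2 by lra.
have [r' r'0 rP] := fd _ dp2.
pose s := Num.min r r' / 2.
have m0 : 0 < Num.min r r' by rewrite lt_min r0.
have [m1 m2] : Num.min r r' <= r /\ Num.min r r' <= r' by rewrite !ge_min !lexx orbT.
have s0 : 0 < s by rewrite divr_gt0.
have := rP s; have := fs s; rewrite s0 /= => /(_ ltac:(rewrite /s; lra)) h1 /(_ ltac:(rewrite /s; lra)) h2.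
have := Re_le_nm (f s - f 0 - s%:C * d); rewrite !cReB cReM/= mul0r subr0 ler_norml => /andP[h3 _].
have : 0 < s * complex.Re d by rewrite mulr_gt0.
lra.
Qed.

End RightDerivative.

(** * The multiplier at a touching point *)

Section Touching.
Context {R : realType} {X : completeNormedModType R[i]}.
Context (dot : {dot X for conjC}) (dot_norm : forall x : X, dot x x = `|x| ^+ 2).
Local Notation C := R[i].
Implicit Types (c h n v x y z Y : X).

Lemma cder_rder (g : C -> C) (d : C) : cder g 0 d -> rder (fun s => g s%:C) d.
Proof.
move=> gd e /gd[r r0 rP]; exists r => // s /andP[s0 sr].
have := rP s%:C; rewrite nm_real gtr0_norm// => /(_ sr).
by rewrite add0r.
Qed.

(** A real linear functional that is nonpositive on the open half space Re <x, n> < 0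
    vanishes on its boundary, hence is a nonnegative multiple of Re <., n>. *)
Lemma lagrange (d : X -> R) n : n != 0 ->
  (forall x y, d (x + y) = d x + d y) -> (forall (s : R) x, d (s%:C *: x) = s * d x) ->
  (forall x, complex.Re (dot x n) < 0 -> d x <= 0) ->
  exists2 t : R, 0 <= t & forall x, d x = t * complex.Re (dot x n).
Proof.
move=> n0 dD dZ dneg; have nn : 0 < nm n ^+ 2 by rewrite exprn_gt0// nm_gt0.
have dN x : d (- x) = - d x.
  have := dZ (-1) x; rewrite mulN1r => <-; congr d.
  by rewrite rmorphN rmorph1 scaleN1r.
have Rnn : complex.Re (dot n n) = nm n ^+ 2 by rewrite (dot_sqr dot_norm).
have dn0 : 0 <= d n.
  have := dneg (- n); rewrite (dotNl dot) cReN Rnn oppr_lt0 nn => /(_ isT).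
  by rewrite dN; lra.
have perp x : complex.Re (dot x n) = 0 -> d x <= 0.
  move=> xn; apply/ler_addgt0Pr => e e0; rewrite add0r.
  pose s := e / (d n + 1); have s0 : 0 < s by rewrite divr_gt0//; lra.
  have := dneg (x - s%:C *: n).
  rewrite (dotBl dot) (dotZl dot) cReB cReM/= xn Rnn mul0r subr0 sub0r oppr_lt0 mulr_gt0//.
  move=> /(_ isT); rewrite dD dN dZ.
  have : s * d n <= e by rewrite /s mulrAC ler_pdivrMr; [rewrite ler_pM2l//; lra | lra].
  by lra.
exists (d n / nm n ^+ 2) => [|x]; first by rewrite divr_ge0// ltW.
pose s := complex.Re (dot x n) / nm n ^+ 2.
have xs : complex.Re (dot (x - s%:C *: n) n) = 0.
  rewrite (dotBl dot) (dotZl dot) cReB cReM/= Rnn mul0r subr0 /s; field.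
  by rewrite gt_eqF// nm_gt0.
have h1 := perp _ xs.
have h2 := perp (- (x - s%:C *: n)); rewrite (dotNl dot) cReN xs oppr0 in h2.
have := h2 erefl; rewrite dN; move: h1; rewrite dD dN dZ.
have -> : d n / nm n ^+ 2 * complex.Re (dot x n) = s * d n by rewrite /s; ring.
by lra.
Qed.

Context (alpha : R) (w : X -> X) (Q : X -> X -> X -> X).
Context (wQ : convex_data dot alpha w Q).
Context (k : R) (k12 : 2^-1 < k) (k1 : k <= 1).

Definition radial_pairing z : C := dot (w z) z.
(** Negative exactly where the strict inequality of starlikeness holds; unlike
    that inequality it is a polynomial in <w z, z> and |z|^2, so it can be
    differentiated along rays. *)
Definition starlike_defect z : R :=
  nm (radial_pairing z) ^+ 2 - 2 * k * nm z ^+ 2 * complex.Re (radial_pairing z).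

Definition pairing_derivative z x : C := dot (x - Q z x (w z)) z + dot (w z) x.
Definition defect_derivative z x : R :=
  2 * complex.Re (((radial_pairing z)^*%C - (k * nm z ^+ 2)%:C) * pairing_derivative z x)
  - 4 * k * complex.Re (dot x z) * complex.Re (radial_pairing z).

Lemma rder_dot_w z x y : nm z < 1 ->
  rder (fun s => dot (w (z + s%:C *: x)) y) (dot (x - Q z x (w z)) y).
Proof.
move=> z1; have z0 : nm (z + 0 *: x) < 1 by rewrite scale0r addr0.
have := cder_rder (fder_scalar dot_norm y (w_fder wQ z0)).
by rewrite /= scale0r addr0.
Qed.

Lemma pairing_rder z x : nm z < 1 ->
  rder (fun s => radial_pairing (z + s%:C *: x)) (pairing_derivative z x).
Proof.
move=> z1; have := rderD (rder_dot_w x z z1) (rderM (@rder_id R) (rder_dot_w x x z1)).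
rewrite mul0r addr0 mul1r scale0r addr0 /pairing_derivative.
suff -> : (fun s : R => dot (w (z + s%:C *: x)) z + s%:C * dot (w (z + s%:C *: x)) x)
   = (fun s => radial_pairing (z + s%:C *: x)) by [].
by apply/funext => s; rewrite /radial_pairing (dotDr dot) (dotZr dot) conjc_real.
Qed.

Lemma defect_rder z x : nm z < 1 ->
  rder (fun s => (starlike_defect (z + s%:C *: x))%:C) (defect_derivative z x)%:C.
Proof.
move=> z1; have dE := pairing_rder x z1.
pose N s : C := dot z z + s%:C * (dot x z + dot z x) + s%:C * (s%:C * dot x x).
have dN : rder N (dot x z + dot z x).
  have := rderD (rderD (rder_cst (dot z z)) (rderM (@rder_id R) (rder_cst (dot x z + dot z x))))
    (rderM (@rder_id R) (rderM (@rder_id R) (rder_cst (dot x x)))).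
  by rewrite !(mul0r, mulr0, addr0, add0r, mul1r).
have NE s : N s = (nm (z + s%:C *: x) ^+ 2)%:C.
  rewrite -(dot_sqr dot_norm) (dotDl dot) !(dotDr dot) !(dotZl dot) !(dotZr dot) conjc_real /N.
  by ring.
have N0 : N 0 = (nm z ^+ 2)%:C by rewrite NE scale0r addr0.
have E0 : radial_pairing (z + (0 : R)%:C *: x) = radial_pairing z by rewrite scale0r addr0.
have := rderD (rderM dE (rderJ dE)) (rderM (rder_cst (- k%:C)) (rderM dN (rderD dE (rderJ dE)))).
rewrite N0 E0.
set d := (X in rder _ X) => fd.
have -> : (defect_derivative z x)%:C = d.
  rewrite /d /defect_derivative (dotC dot z x).
  move: (radial_pairing z) (pairing_derivative z x) (dot x z) (nm z ^+ 2) => a b u r.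
  by apply: C_eqP; rewrite !Cex/=; ring.
suff -> : (fun s => (starlike_defect (z + s%:C *: x))%:C) =
  (fun x0 : R => radial_pairing (z + x0%:C *: x) * (radial_pairing (z + x0%:C *: x))^*%C +
   - k%:C * (N x0 * (radial_pairing (z + x0%:C *: x) + (radial_pairing (z + x0%:C *: x))^*%C))) by [].
apply/funext => s; rewrite NE /starlike_defect.
move: (radial_pairing _) (nm (z + _) ^+ 2) => a r.
by rewrite nm_sqr; apply: C_eqP; rewrite !Cex/=; ring.
Qed.

(** Dw(0) is the identity because w 0 = 0. *)
Lemma w_near0 (d : R) : 0 < d -> exists2 r : R, 0 < r &
  forall z, nm z < r -> nm (w z - z) <= d * nm z.
Proof.
move=> d0; have z1 : nm (0 : X) < 1 by rewrite nm0.
have [H _ _] := w_fder wQ z1; have [r r0 rP] := H d d0.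
exists r => // z /rP; rewrite (w_zero wQ) add0r (lin0 (Q_linr wQ z z1)) !subr0.
by [].
Qed.

Lemma defect_lt0P z : z != 0 ->
  (nm (radial_pairing z - (k * nm z ^+ 2)%:C) < k * nm z ^+ 2) = (starlike_defect z < 0).
Proof.
move=> z0; have kp : 0 < k by have := k12; lra.
have kz : 0 < k * nm z ^+ 2 by rewrite mulr_gt0// exprn_gt0// nm_gt0.
rewrite -(@ltr_pXn2r _ 2)// ?nnegrE ?nm_ge0 ?(ltW kz)// -subr_lt0.
congr (_ < _); rewrite /starlike_defect !nm_sqr !Cex/=; ring.
Qed.

Lemma defect_near0 : exists2 r : R, 0 < r &
  forall z, z != 0 -> nm z < r -> starlike_defect z < 0.
Proof.
have d0 : 0 < (2 * k - 1) / 2 by have := k12; lra.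
have [r r0 rP] := w_near0 d0; exists r => // z z0 /rP zr.
have nz : 0 < nm z by rewrite nm_gt0.
have nz2 : 0 < nm z ^+ 2 by rewrite exprn_gt0.
rewrite -defect_lt0P//.
have -> : radial_pairing z - (k * nm z ^+ 2)%:C = dot (w z - z) z + ((1 - k) * nm z ^+ 2)%:C.
  rewrite (dotBl dot) (dot_sqr dot_norm) /radial_pairing -addrA; congr (_ + _).
  by rewrite mulrBl mul1r rmorphB/= addrA addNr add0r.
apply: (le_lt_trans (nmD _ _)); rewrite nm_real ger0_norm; last first.
  by rewrite mulr_ge0 ?sqr_ge0// subr_ge0.
have := cauchy_schwarz dot_norm (w z - z) z.
have := ler_wpM2r (ltW nz) zr.
have -> : (2 * k - 1) / 2 * nm z * nm z = (2 * k - 1) * nm z ^+ 2 / 2 by ring.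
have := k12; have : 0 < (2 * k - 1) * nm z ^+ 2 by rewrite mulr_gt0//; have := k12; lra.
by move=> *; lra.
Qed.

Section TouchingPoint.
Context (c z0 : X) (z0nz : z0 != 0) (z0lt1 : nm z0 < 1) (nnz : z0 - c != 0).
Context (def0 : 0 <= starlike_defect z0).
Context (outside : forall z, z != 0 -> nm (z - c) < nm (z0 - c) -> nm z < 1 /\ starlike_defect z < 0).

Let n := z0 - c.
Let r2 : R := nm z0 ^+ 2.

(** A ray with Re <x, n> < 0 starts inside the ball around c through z0. *)
Lemma inward_direction x : complex.Re (dot x n) < 0 -> exists2 r : R, 0 < r &
  forall s : R, 0 < s < r -> starlike_defect (z0 + s%:C *: x) < 0.
Proof.
move=> xn; have zp : 0 < nm z0 by rewrite nm_gt0.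
pose K := nm x ^+ 2 + 1; have K0 : 0 < K by rewrite /K; have := sqr_ge0 (nm x); lra.
exists (Num.min (nm z0 / (nm x + 1)) (- complex.Re (dot x n) / K)).
  rewrite lt_min !divr_gt0//; first by rewrite oppr_gt0.
  by have := nm_ge0 x; lra.
move=> s /andP[s0]; rewrite lt_min !ltr_pdivlMr//; last by have := nm_ge0 x; lra.
move=> /andP[s1 s2]; apply: (outside _ _).2.
  apply: contraTneq s1 => zs; rewrite -leNgt.
  have -> : nm z0 = nm (s%:C *: x).
    by rewrite -(nmN (s%:C *: x)); congr nm; apply/eqP; rewrite -addr_eq0 zs.
  by rewrite nmZ nm_real gtr0_norm// ler_pM2l//; lra.
rewrite addrAC -/n -(@ltr_pXn2r _ 2)// ?nnegrE ?nm_ge0// (nm_sqr_dotD dot_norm).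
rewrite nmZ nm_real gtr0_norm// (Re_dotC dot n) (dotZl dot) cReM/= mul0r subr0 exprMn.
have : s * (s * K) < s * (- complex.Re (dot x n)) by rewrite ltr_pM2l.
have : 0 < s * (- complex.Re (dot x n)) by rewrite mulr_gt0// oppr_gt0.
have : 0 < s * s by rewrite mulr_gt0.
rewrite /K !expr2; lra.
Qed.

Lemma defect_eq0 : starlike_defect z0 = 0.
Proof.
apply/eqP; rewrite eq_le def0 andbT.
have nn : 0 < nm n ^+ 2 by rewrite exprn_gt0// nm_gt0.
have neg : complex.Re (dot (- n) n) < 0.
  by rewrite (dotNl dot) cReN (dot_sqr dot_norm) oppr_lt0.
have [r r0 rP] := inward_direction neg.
have [r' r'0 r'P] := rder_lip (defect_rder (- n) z0lt1).
rewrite leNgt; apply/negP => dp.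
set K := nm _ + 1 in r'P; have K0 : 0 < K by rewrite ltr_wpDl ?nm_ge0.
pose m := Num.min (Num.min r r') (starlike_defect z0 / K).
have m0 : 0 < m by rewrite !lt_min r0 r'0 divr_gt0.
have [m1 m2 m3] : [/\ m <= r, m <= r' & m <= starlike_defect z0 / K] by split; rewrite !ge_min lexx ?orbT.
have s1 : 0 < m / 2 < r by lra.
have s2 : 0 < m / 2 < r' by lra.
have := rP _ s1; have := r'P _ s2; rewrite scale0r addr0.
set d := starlike_defect _; rewrite -rmorphB nm_real ler_norml => /andP[h1 _] h2.
rewrite ler_pdivlMr// in m3; have : 0 < K * m by rewrite mulr_gt0.
lra.
Qed.

(** The derivative of the defect at z0 is nonpositive in inward directions, so it is a
    nonnegative multiple of Re <x, n>.  Since the defect vanishes at z0, |e| = 1, and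
    the factor conj(pairing) - k |z0|^2 in the derivative is k |z0|^2 conj(e), so k |z0|^2
    can be divided out.  The left side of the last identity is complex linear in x, so its real part
    determines it. *)
Lemma multiplier (p e : C) : radial_pairing z0 = p * r2%:C -> p = k%:C * (1 + e) ->
  exists t : R, [/\ 0 <= t, nm e = 1,
  forall x, defect_derivative z0 x = 2 * k * r2 * t * complex.Re (dot x n) &
  forall x, e^*%C * dot (x - Q z0 x (w z0)) z0 + e * dot x (w z0)
    - 2 * (complex.Re p)%:C * dot x z0 = t%:C * dot x n].
Proof.
move=> Ep pe; have kp : 0 < k by have := k12; lra.
have r20 : 0 < r2 by rewrite exprn_gt0// nm_gt0.
have kC : k%:C != 0 :> C by rewrite -nm_gt0 nm_real gtr0_norm.
have rC : r2%:C != 0 :> C by rewrite -nm_gt0 nm_real gtr0_norm.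
have e1 : nm e = 1.
  have := defect_eq0; rewrite /starlike_defect Ep nmM nm_real gtr0_norm// exprMn -/r2.
  rewrite [complex.Re (p * _)]cReM/= mulr0 subr0 => h.
  have h2 : nm p ^+ 2 = 2 * k * complex.Re p.
    have : r2 ^+ 2 * (nm p ^+ 2 - 2 * k * complex.Re p) = 0 by rewrite -[RHS]h; ring.
    by move=> /eqP; rewrite mulf_eq0 expf_eq0/= gt_eqF//= subr_eq0 => /eqP.
  apply/eqP; rewrite -(@eqrXn2 _ 2)// ?nm_ge0// expr1n.
  move: h2; rewrite pe nmM nm_real gtr0_norm// exprMn !nm_sqr !Cex/= => h2.
  have h3 : k ^+ 2 * (complex.Re e ^+ 2 + complex.Im e ^+ 2 - 1) = 0.
    by move: h2; lra.
  by move/eqP: h3; rewrite mulf_eq0 expf_eq0/= gt_eqF//= subr_eq0.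
pose L x : C := e^*%C * dot (x - Q z0 x (w z0)) z0 + e * dot x (w z0)
    - 2 * (complex.Re p)%:C * dot x z0.
have dL x : defect_derivative z0 x = 2 * k * r2 * complex.Re (L x).
  rewrite /defect_derivative /L /pairing_derivative Ep -/r2 (dotC dot (w z0)).
  rewrite {1}pe.
  move: (dot (x - _) z0) (dot x (w z0)) (dot x z0) => a b u.
  have -> : complex.Re (p * r2%:C) = complex.Re p * r2 by rewrite cReM/= mulr0 subr0.
  by rewrite !Cex/=; ring.
have LD x y : L (x + y) = L x + L y.
  rewrite /L (linD x y (Q_linl wQ (w z0) z0lt1)) opprD addrACA !(dotDl dot); ring.
have LZ (s : C) x : L (s *: x) = s * L x.
  rewrite /L (linZ s x (Q_linl wQ (w z0) z0lt1)) -scalerBr !(dotZl dot); ring.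
have n0 : n != 0 by [].
have [|s x|x xn|t t0 tP] := @lagrange (fun x => complex.Re (L x)) n n0.
- by move=> x y; rewrite LD cReD.
- by rewrite LZ cReM/= mul0r subr0.
- have [r r0 rP] := inward_direction xn.
  have := rder_Re_le0 (defect_rder x z0lt1) r0; rewrite /= scale0r addr0 => /(_ def0).
  have : forall s, 0 < s < r -> starlike_defect (z0 + s%:C *: x) <= 0 by move=> s /rP/ltW.
  move=> h /(_ h); rewrite dL.
  have K0 : 0 < 2 * k * r2 by do 2![apply: mulr_gt0 => //].
  by rewrite (pmulr_rle0 _ K0).
exists t; split => //; first by move=> x; rewrite dL tP; ring.
move=> x; rewrite -/(L x); apply: C_eqP; first by rewrite tP cReM/= mul0r subr0.
(* the imaginary part at x is the real part at - i x *)
have := tP (- 'i%C *: x); rewrite LZ (dotZl dot) !Cex/=.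
by lra.
Qed.

End TouchingPoint.
End Touching.

(** * The boundary Schwarz-Pick inequality at a touching point *)

Section BoundaryPoint.
Context {R : realType} {X : completeNormedModType R[i]}.
Context (dot : {dot X for conjC}) (dot_norm : forall x : X, dot x x = `|x| ^+ 2).
Local Notation C := R[i].
Implicit Types (c h n v x y z Y : X).
Context (alpha : R) (w : X -> X) (Q : X -> X -> X -> X).
Context (wQ : convex_data dot alpha w Q).
Context (k : R) (k12 : 2^-1 < k).
Local Notation pairing := (radial_pairing dot w).
Local Notation defect := (starlike_defect dot w k).
Local Notation ddefect := (defect_derivative dot w Q k).

Lemma nm_one_subM (x y : C) :
  nm (1 - y^*%C * x) ^+ 2 - nm (x - y) ^+ 2 = (1 - nm y ^+ 2) * (1 - nm x ^+ 2).
Proof. by rewrite !nm_sqr !Cex/=; ring. Qed.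

Lemma norm2_rder z x :
  rder (fun s : R => (nm (z + s%:C *: x) ^+ 2)%:C) (dot x z + dot z x).
Proof.
have := rderD (rderD (rder_cst (dot z z)) (rderM (@rder_id R) (rder_cst (dot x z + dot z x))))
    (rderM (@rder_id R) (rderM (@rder_id R) (rder_cst (dot x x)))).
rewrite !(mul0r, mulr0, addr0, add0r, mul1r).
set f := (X in rder X _) => fd.
suff -> : (fun s : R => (nm (z + s%:C *: x) ^+ 2)%:C) = f by [].
apply/funext => s; rewrite -(dot_sqr dot_norm) (dotDl dot) !(dotDr dot) !(dotZl dot) !(dotZr dot).
by rewrite conjc_real /f; ring.
Qed.

(** The restriction of <w z, z> / (k |z|^2) - 1 to the complex line through z, written
    as a holomorphic function of the parameter l <> 0; its modulus is less than 1
    exactly where the defect is negative ([defect_slice]). *)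
Definition slice z (l : C) : C := dot (w (l *: z)) z / (l * (k * nm z ^+ 2)%:C) - 1.

Lemma slice_cder z l : z != 0 -> l != 0 -> nm (l *: z) < 1 -> exists d, cder (slice z) l d.
Proof.
move=> z0 l0 lz1; have kp : 0 < k by have := k12; lra.
have lz : nm (0 + l *: z) < 1 by rewrite add0r.
have h1 := fder_scalar dot_norm z (w_fder wQ lz).
have kz : (k * nm z ^+ 2)%:C != 0 :> C.
  by rewrite -nm_gt0 nm_real gtr0_norm mulr_gt0// exprn_gt0// nm_gt0.
have [|d' vd] := cderV (cderM (cder_id l) (cder_cst (k * nm z ^+ 2)%:C l)) _.
  by rewrite mulf_neq0.
have := cderB (cderM h1 vd) (cder_cst 1 l).
set d := (X in cder _ _ X) => dd; exists d; move: dd; rewrite /slice.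
by under eq_fun do rewrite add0r.
Qed.

Lemma pairing_slice z l : z != 0 -> l != 0 ->
  pairing (l *: z) = (nm l ^+ 2 * (k * nm z ^+ 2))%:C * (1 + slice z l).
Proof.
move=> z0 l0; have kp : 0 < k by have := k12; lra.
have kz : (k * nm z ^+ 2)%:C != 0 :> C.
  by rewrite -nm_gt0 nm_real gtr0_norm mulr_gt0// exprn_gt0// nm_gt0.
have -> : (nm l ^+ 2 * (k * nm z ^+ 2))%:C = l * l^*%C * (k * nm z ^+ 2)%:C.
  by rewrite -nm_sqrJ -rmorphM.
rewrite /radial_pairing /slice (dotZr dot).
move: kz (dot _ z) l^*%C; set q := (k * _)%:C => qn u lJ; clearbody q.
by field; rewrite l0 qn.
Qed.

Lemma defect_slice z l : z != 0 -> l != 0 ->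
  defect (l *: z) = (nm l ^+ 2 * (k * nm z ^+ 2)) ^+ 2 * (nm (slice z l) ^+ 2 - 1).
Proof.
move=> z0 l0; rewrite /starlike_defect pairing_slice// nmZ.
set a := nm l ^+ 2 * _; have a0 : 0 <= a.
  rewrite /a mulr_ge0 ?sqr_ge0// mulr_ge0 ?sqr_ge0//; have := k12; lra.
have -> : 2 * k * (nm l * nm z) ^+ 2 = 2 * a by rewrite /a; ring.
clearbody a; rewrite nmM nm_real ger0_norm// cReM/= mul0r subr0 exprMn.
by move: (slice z l) => e; rewrite !nm_sqr !Cex/=; ring.
Qed.

Context (c z0 : X) (z0nz : z0 != 0) (z0lt1 : nm z0 < 1) (nnz : z0 - c != 0).
Context (def0 : 0 <= defect z0).
Context (outside : forall z, z != 0 -> nm (z - c) < nm (z0 - c) -> nm z < 1 /\ defect z < 0).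
Context (p e : C) (t : R).
Let r2 : R := nm z0 ^+ 2.
Let sg : C := dot z0 c / r2%:C.
Context (Ep : pairing z0 = p * r2%:C) (pe : p = k%:C * (1 + e)).
Context (mult : forall x, ddefect z0 x = 2 * k * r2 * t * complex.Re (dot x (z0 - c))).

Let kp : 0 < k. Proof. by have := k12; lra. Qed.
Let r20 : 0 < r2. Proof. by rewrite exprn_gt0// nm_gt0. Qed.
Let rC : r2%:C != 0 :> C. Proof. by rewrite -nm_gt0 nm_real gtr0_norm. Qed.
Let dzc : dot z0 c = sg * r2%:C. Proof. by rewrite /sg divfK. Qed.
Let dzn : dot z0 (z0 - c) = r2%:C * (1 - sg).
Proof. by rewrite (dotBr dot) (dot_sqr dot_norm) dzc -/r2; ring. Qed.

(** The touching ball meets the complex line through z0 in the disc with centre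
    conj(sg) whose boundary passes through 1. *)
Lemma in_touching_disc (l : C) : nm (l - sg^*%C) < nm (1 - sg) ->
  nm (l *: z0 - c) < nm (z0 - c).
Proof.
have E (m : C) : nm (m *: z0 - c) ^+ 2 = r2 * (nm (m - sg^*%C) ^+ 2 - nm sg ^+ 2) + nm c ^+ 2.
  rewrite (nm_sqr_dotD dot_norm) nmN (dotNr dot) (dotZl dot) dzc nmZ exprMn -/r2.
  by move: sg => u; rewrite !nm_sqr !Cex/=; ring.
move=> h; rewrite -(@ltr_pXn2r _ 2)// ?nnegrE ?nm_ge0//.
rewrite -[z0 in X in _ < X]scale1r !E ltrD2r ltr_pM2l// ltrD2r.
have -> : nm (1 - sg^*%C) = nm (1 - sg) by rewrite -[RHS]nmJ rmorphB rmorph1.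
by rewrite ltr_pXn2r ?nnegrE ?nm_ge0.
Qed.

(** The disc with centre b and boundary point 1 lies inside the touching disc, where
    the slice has modulus less than 1.  The Schwarz-Pick inequality relative to b
    becomes an equality at l = 1, so along the radius ending there the difference of
    its two sides has a sign; its derivative at l = 1 is the stated
    inequality, the derivative of the defect being given by the multiplier.  The
    point l = 0 lies in the disc, whence the punctured form of the Schwarz lemma. *)
Lemma boundary_schwarz (q : R) (b : C) : 0 < q <= 1 -> sg != 1 ->
  b = 1 - q%:C * (1 - sg^*%C) -> b != 0 -> nm b < nm (1 - b) ->
  let e1 := slice z0 b in
  nm e1 < 1 /\
  k * nm (1 - e1^*%C * e) ^+ 2 <= (1 - nm e1 ^+ 2) * (t * q * nm (1 - sg) ^+ 2).
Proof.
move=> /andP[q0 q1] sg1 bE b0 b1; set x1 := slice z0 b => /=.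
have s1 : 0 < nm (1 - sg) by rewrite nm_gt0 subr_eq0 eq_sym.
have s1J : nm (1 - sg^*%C) = nm (1 - sg) by rewrite -[RHS]nmJ rmorphB rmorph1.
have bq : 1 - b = q%:C * (1 - sg^*%C) by rewrite bE; ring.
pose rho := nm (1 - b).
have rhoE : rho = q * nm (1 - sg) by rewrite /rho bq nmM nm_real gtr0_norm// s1J.
have rho0 : 0 < rho by rewrite rhoE mulr_gt0.
have inD (l : C) : l != 0 -> nm (l - b) < rho -> nm (l *: z0) < 1 /\ nm (slice z0 l) < 1.
  move=> l0 lb.
  have lsg : nm (l - sg^*%C) < nm (1 - sg).
    have bs : nm (b - sg^*%C) = (1 - q) * nm (1 - sg).
      have -> : b - sg^*%C = (1 - q)%:C * (1 - sg^*%C) by rewrite bE rmorphB rmorph1; ring.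
      by rewrite nmM nm_real s1J ger0_norm// subr_ge0.
    by have := nm_tri l b sg^*%C; rewrite bs rhoE in lb *; lra.
  have lz0 : l *: z0 != 0 by rewrite scaler_eq0 negb_or l0.
  have [-> dl] := outside lz0 (in_touching_disc lsg); split => //.
  move: dl; rewrite defect_slice//.
  set a := (X in X ^+ 2 * _); have a0 : 0 < a ^+ 2.
    rewrite exprn_gt0// !mulr_gt0 ?exprn_gt0 ?nm_gt0//.
  by rewrite pmulr_rlt0// subr_lt0 -[X in _ < X](expr1n _ 2) ltr_pXn2r// nnegrE ?nm_ge0.
have bb : nm (b - b) < rho by rewrite subrr nm0.
have [bz1 x1lt] := inD b b0 bb.
split => //.
have den l : l != 0 -> nm (l - b) < rho -> 1 - x1^*%C * slice z0 l != 0.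
  move=> l0 lb; have [_ sl] := inD l l0 lb.
  rewrite subr_eq0; apply/eqP => /(congr1 nm); rewrite nm1 nmM nmJ => E.
  have : nm x1 * nm (slice z0 l) <= nm x1 * 1 by rewrite ler_wpM2l ?nm_ge0// ltW.
  lra.
pose phi (m : C) := (slice z0 (b + m) - x1) / (1 - x1^*%C * slice z0 (b + m)).
have dphi m : nm m < rho -> m != - b -> exists d, cder phi m d.
  move=> mr mb; have l0 : b + m != 0 by rewrite addrC addr_eq0.
  have lb : nm (b + m - b) < rho by rewrite addrC addrA addNr add0r.
  have [lz _] := inD _ l0 lb.
  have l1 : b + m = b + 1 * m by rewrite mul1r.
  have [d sd] := slice_cder z0nz l0 lz; rewrite l1 in sd.
  have sd' := cder_comp_affine sd.
  have sd2 : cder (fun m => slice z0 (b + m)) m (1 * d).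
    by move: sd'; under eq_fun do rewrite mul1r.
  have [d' vd] := cderV (cderB (cder_cst 1 m) (cderM (cder_cst x1^*%C m) sd2)) (den _ l0 lb).
  by eexists; exact: cderM (cderB sd2 (cder_cst x1 m)) vd.
have phi1 m : nm m < rho -> m != - b -> nm (phi m) <= 1.
  move=> mr mb; have l0 : b + m != 0 by rewrite addrC addr_eq0.
  have lb : nm (b + m - b) < rho by rewrite addrC addrA addNr add0r.
  have [_ sl] := inD _ l0 lb.
  rewrite /phi nmM nmV ler_pdivrMr ?nm_gt0 ?den// mul1r.
  rewrite -(@ler_pXn2r _ 2)// ?nnegrE ?nm_ge0// -subr_ge0 nm_one_subM.
  by apply: mulr_ge0; rewrite subr_ge0 -[X in _ <= X](expr1n _ 2) lerXn2r ?nnegrE ?nm_ge0// ltW.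
have phi0 : phi 0 = 0 by rewrite /phi addr0 subrr mul0r.
have zb : (0 : C) != - b by rewrite eq_sym oppr_eq0.
have zr : nm (0 : C) < rho by rewrite nm0.
have [d pd] := dphi 0 zr zb; have [r r0 rP] := cder_lip pd.
have nb : nm (- b) < rho by rewrite nmN.
have near m : nm m < r -> m != - b -> nm (phi m) <= (nm d + 1) * nm m.
  by move=> /rP; rewrite add0r phi0 subr0.
have main := @schwarz_punctured _ phi rho 1 (- b) (nm d + 1) r rho0 r0 nb
  (fun m mr _ => dphi m mr) (fun m mr _ => phi1 m mr) near.
(* approach the touching point along the radius of the disc *)
pose x := - (1 - b) *: z0.
pose l (s : R) : C := 1 - s%:C * (1 - b).
have lz s : z0 + s%:C *: x = l s *: z0.
  by rewrite /l /x scalerA scalerBl scale1r mulrN scaleNr.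
pose N (s : R) : C := (nm (z0 + s%:C *: x) ^+ 2)%:C.
pose G s : C := k%:C * N s * (1 + x1^*%C) - x1^*%C * pairing (z0 + s%:C *: x).
pose f s : C := (1 - nm x1 ^+ 2)%:C * (defect (z0 + s%:C *: x))%:C
   + (2 * s%:C - s%:C * s%:C) * (G s * (G s)^*%C).
have dG : exists d, rder G d.
  eexists; apply: rderD (rderM (rderM (rder_cst k%:C) (norm2_rder z0 x)) (rder_cst (1 + x1^*%C))) _.
  have := rderM (rder_cst (- x1^*%C)) (pairing_rder dot_norm wQ x z0lt1).
  set dd := (X in rder _ X) => h;
  suff -> : (fun x2 : R => - (x1^*%C * pairing (z0 + x2%:C *: x))) =
     (fun s => - x1^*%C * pairing (z0 + s%:C *: x)) by exact: h.
  by apply/funext => s; rewrite mulNr.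
have [d' Gd] := dG.
have df : rder f ((1 - nm x1 ^+ 2)%:C * (ddefect z0 x)%:C + 2 * (G 0 * (G 0)^*%C)).
  have h1 := rderM (rder_cst (1 - nm x1 ^+ 2)%:C) (defect_rder dot_norm wQ k x z0lt1).
  have h2 : rder (fun s : R => 2 * s%:C - s%:C * s%:C : C) 2.
    have := rderD (rderM (rder_cst 2) (@rder_id R)) (rderM (rder_cst (-1)) (rderM (@rder_id R) (@rder_id R))).
    rewrite !(mul0r, mulr0, addr0, add0r, mulr1).
    set ff := (X in rder X _) => h; suff -> : (fun s : R => 2 * s%:C - s%:C * s%:C : C) = ff by [].
    by apply/funext => s; rewrite /ff mulN1r.
  have := rderD h1 (rderM h2 (rderM Gd (rderJ Gd))).
  have -> : 2 * (0 : R)%:C - (0 : R)%:C * (0 : R)%:C = 0 :> C by rewrite mulr0 mul0r subrr.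
  by rewrite !(mul0r, add0r, addr0).
have f0 : 0 <= complex.Re (f 0).
  rewrite /f scale0r addr0 (defect_eq0 dot_norm wQ z0nz z0lt1 nnz def0 outside).
  have -> : 2 * (0 : R)%:C - (0 : R)%:C * (0 : R)%:C = 0 :> C by rewrite mulr0 mul0r subrr.
  by rewrite mulr0 mul0r addr0.
have fneg s : 0 < s < Num.min 1 (2 * rho)^-1 -> complex.Re (f s) <= 0.
  rewrite lt_min => /andP[s0 /andP[sl1 sl2]].
  have l0 : l s != 0.
    rewrite /l subr_eq0; apply/eqP => /(congr1 nm); rewrite nm1 nmM nm_real gtr0_norm// -/rho => E.
    by move: sl2; rewrite -[X in _ < X]div1r ltr_pdivlMr ?mulr_gt0//; lra.
  have lb : l s = b + (1 - s)%:C * (1 - b) by rewrite /l rmorphB rmorph1; ring.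
  have mn : nm ((1 - s)%:C * (1 - b)) = (1 - s) * rho by rewrite nmM nm_real ger0_norm//; lra.
  have mr : nm ((1 - s)%:C * (1 - b)) < rho.
    by rewrite mn -[X in _ < X]mul1r ltr_pM2r//; lra.
  have m0 : (1 - s)%:C * (1 - b) != 0 by rewrite -nm_gt0 mn mulr_gt0//; lra.
  have mb : (1 - s)%:C * (1 - b) != - b.
    by apply: contraNneq l0 => E; rewrite lb E subrr.
  have := main _ mr m0 mb; rewrite mn mul1r ler_pM2r// /phi -lb.
  have lbr : nm (l s - b) < rho by rewrite lb addrC addrA addNr add0r.
  set u := slice z0 (l s); rewrite nmM nmV ler_pdivrMr ?nm_gt0; last exact: (den _ l0 lbr).
  move=> h; have h2 : nm (u - x1) ^+ 2 <= (1 - s) ^+ 2 * nm (1 - x1^*%C * u) ^+ 2.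
    by rewrite -exprMn lerXn2r ?nnegrE ?mulr_ge0 ?nm_ge0//; lra.
  have := nm_one_subM u x1 => h3.
  rewrite /f lz defect_slice//.
  have GE : G s = (nm (l s) ^+ 2 * (k * r2))%:C * (1 - x1^*%C * u).
    rewrite /G /N lz nmZ exprMn -/r2 pairing_slice// -/r2 -/u !rmorphM/=; ring.
  rewrite -[G s * _]nm_sqrJ GE -/u -/r2; set a := nm (l s) ^+ 2 * _.
  have a0 : 0 < a by rewrite !mulr_gt0 ?exprn_gt0 ?nm_gt0.
  clearbody a; rewrite nmM nm_real gtr0_norm// !Cex/=.
  have : 0 <= a ^+ 2 * ((1 - s) ^+ 2 * nm (1 - x1^*%C * u) ^+ 2 - nm (u - x1) ^+ 2).
    by rewrite mulr_ge0 ?sqr_ge0// subr_ge0.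
  have -> : nm (u - x1) ^+ 2 = nm (1 - x1^*%C * u) ^+ 2 - (1 - nm x1 ^+ 2) * (1 - nm u ^+ 2).
    by rewrite -h3; ring.
  rewrite -[X in _ -> X <= _]opprK oppr_le0; move=> H; apply: (le_trans H).
  by rewrite le_eqVlt; apply/orP; left; apply/eqP; ring.
have m1 : 0 < Num.min 1 (2 * rho)^-1 by rewrite lt_min ltr01 invr_gt0 mulr_gt0.
have := rder_Re_le0 df m1 f0 fneg.
rewrite -nm_sqrJ mult /x (dotZl dot) dzn bq.
have -> : G 0 = (k * r2)%:C * (1 - x1^*%C * e).
  by rewrite /G /N scale0r addr0 -/r2 Ep pe !rmorphM/=; ring.
have kr0 : 0 < k * r2 := mulr_gt0 kp r20.
rewrite nmM nm_real (gtr0_norm kr0) exprMn.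
have -> : complex.Re (- (q%:C * (1 - sg^*%C)) * (r2%:C * (1 - sg))) = - (q * r2 * nm (1 - sg) ^+ 2).
  by move: sg => u; rewrite !nm_sqr !Cex/=; ring.
rewrite !Cex/= => h.
have K0 : 0 < 2 * k * r2 ^+ 2 by apply: mulr_gt0; [apply: mulr_gt0|apply: exprn_gt0].
rewrite -(ler_pM2l K0); move: h.
rewrite -[X in X <= 0]opprK oppr_le0 => h; rewrite -subr_ge0.
by apply: (le_trans h); rewrite le_eqVlt; apply/orP; left; apply/eqP; ring.
Qed.

End BoundaryPoint.

(** * The multiplier equations and the convexity inequality *)

Section Curvature.
Context {R : realType} {X : completeNormedModType R[i]}.
Context (dot : {dot X for conjC}) (dot_norm : forall x : X, dot x x = `|x| ^+ 2).
Local Notation C := R[i].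
Implicit Types (c h n v x y z Y : X).
Context (alpha : R) (w : X -> X) (Q : X -> X -> X -> X).
Context (wQ : convex_data dot alpha w Q) (alt1 : alpha < 1).
Context (k : R) (k12 : 2^-1 < k).
Local Notation pairing := (radial_pairing dot w).

(** The constant of [convex_improved], made uniform on the ball of radius r1. *)
Lemma convex_uniform (r1 : R) z Y (e : C) : r1 < 1 -> nm z <= r1 -> nm e = 1 ->
  dot Y z = e * (dot Y z)^*%C ->
  - (2 * (1 - alpha) * r1 / (1 + r1) * nm Y ^+ 2) <= complex.Re (e^*%C * dot (Q z Y Y) z).
Proof.
move=> r11 zr e1 Ye; have a1 := alt1; have z1 : nm z < 1 by lra.
have z0 := nm_ge0 z; have [h _] := convex_improved dot_norm wQ a1 e1 z1 Ye.
have K0 : 0 <= 2 * (1 - alpha) * nm Y ^+ 2 by rewrite mulr_ge0 ?sqr_ge0//; lra.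
set S := complex.Re _ in h *.
have h1 : - (2 * (1 - alpha) * nm Y ^+ 2 * (nm z / (1 + nm z))) <= S.
  by rewrite mulrA -mulNr ler_pdivrMr//; lra.
apply: le_trans h1; rewrite lerN2.
have -> : 2 * (1 - alpha) * r1 / (1 + r1) * nm Y ^+ 2 = 2 * (1 - alpha) * nm Y ^+ 2 * (r1 / (1 + r1)) by ring.
apply: ler_wpM2l => //.
rewrite ler_pdivrMr; last by lra.
rewrite mulrAC ler_pdivlMr; lra.
Qed.

(** The weight (1 - f)/2 is chosen so that, with u = w z the vector of the multiplier
    equations, <Q z Y Y, z> is a combination of the known values <Q z z u, z> and <Q z v u, z>
    up to a multiple of <Q z v v, z> that [convex_uniform] controls. *)
Lemma Q_blend z v (p e f : C) : nm z < 1 -> e * f = 1 ->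
  let u := p *: z + v in let Y := p *: z + ((1 - f) / 2) *: v in
  f * dot (Q z Y Y) z = f * p * dot (Q z z u) z - f ^+ 2 * dot (Q z v u) z
    + (2 + e + f) / 4 * (f ^+ 2 * dot (Q z v v) z).
Proof.
move=> z1 ef /=; have lr x := Q_linr wQ x z1; have ll y := Q_linl wQ y z1.
rewrite !(linD _ _ (lr _)) !(linZ _ _ (lr _)) !(linD _ _ (ll _)) !(linZ _ _ (ll _)).
rewrite (Q_sym wQ z v z1) !(dotDl dot) !(dotZl dot) !(dotDl dot) !(dotZl dot).
move: (dot (Q z z z) z) (dot (Q z v z) z) (dot (Q z v v) z) => q1 q2 q3.
have -> : (2 + e + f) / 4 * (f ^+ 2 * q3) = (2 * f ^+ 2 + (e * f) * f + f ^+ 3) / 4 * q3.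
  by field.
by rewrite ef; field.
Qed.

Context (c z0 : X) (r1 : R) (z0nz : z0 != 0) (z0r1 : nm z0 <= r1) (r11 : r1 < 1).
Context (p e : C) (t : R) (t0 : 0 <= t).
Let r2 : R := nm z0 ^+ 2.
Let sg : C := dot z0 c / r2%:C.
Let v : X := w z0 - p *: z0.
Let a : R := 1 - 2 * (1 - alpha) * r1 / (1 + r1).
Context (Ep : pairing z0 = p * r2%:C) (pe : p = k%:C * (1 + e)) (e1 : nm e = 1).
Context (multC : forall x, e^*%C * dot (x - Q z0 x (w z0)) z0 + e * dot x (w z0)
    - 2 * (complex.Re p)%:C * dot x z0 = t%:C * dot x (z0 - c)).

Let kp : 0 < k. Proof. by have := k12; lra. Qed.
Let r20 : 0 < r2. Proof. by rewrite exprn_gt0// nm_gt0. Qed.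
Let rC : r2%:C != 0 :> C. Proof. by rewrite -nm_gt0 nm_real gtr0_norm. Qed.
Let z01 : nm z0 < 1. Proof. by have := z0r1; have := r11; lra. Qed.
Let dzc : dot z0 c = sg * r2%:C. Proof. by rewrite /sg divfK. Qed.
Let dzz : dot z0 z0 = r2%:C. Proof. by rewrite (dot_sqr dot_norm). Qed.
Let vz : dot v z0 = 0.
Proof. by rewrite /v (dotBl dot) (dotZl dot) dzz -Ep subrr. Qed.
Let zv : dot z0 v = 0.
Proof. by rewrite (dotC dot) vz conjc0. Qed.
Let wE : w z0 = p *: z0 + v. Proof. by rewrite /v addrC subrK. Qed.
Let eJ : e * e^*%C = 1. Proof. by rewrite -nm_sqrJ e1 expr1n. Qed.
Let pJ : e * p^*%C = p.
Proof.
have -> : p^*%C = k%:C * (1 + e^*%C) by rewrite pe; apply: C_eqP; rewrite !Cex/=; ring.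
by rewrite mulrCA mulrDr mulr1 eJ pe addrC.
Qed.
Let Jp : e^*%C * p = p^*%C.
Proof. by rewrite -[in LHS]pJ mulrA [e^*%C * e]mulrC eJ mul1r. Qed.
Let Re2 : 2 * (complex.Re p)%:C = p + p^*%C.
Proof. by apply: C_eqP; rewrite !Cex/=; ring. Qed.

(** The multiplier identity in the direction z0. *)
Lemma radial_equation :
  e^*%C * (1 - dot (Q z0 z0 (w z0)) z0 / r2%:C - p) = t%:C * (1 - sg).
Proof.
have zw : dot z0 (w z0) = p^*%C * r2%:C.
  by rewrite wE (dotDr dot) (dotZr dot) zv addr0 dzz.
have := multC z0; rewrite !(dotBl dot) (dotBr dot) dzc dzz zw Re2.
rewrite mulrA pJ; move: Jp rC.
move: (dot (Q _ _ _) _) r2%:C e^*%C p^*%C sg => q s eJ' pJ' u Jp' s0 h.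
apply: (mulIf s0).
have -> : eJ' * (1 - q / s - p) * s = eJ' * (s - q) - (eJ' * p) * s by field.
by rewrite Jp' -mulrA mulrBl mul1r -h; ring.
Qed.

(** The multiplier identity in the direction v, which is orthogonal to z0. *)
Lemma tangential_equation :
  dot (Q z0 v (w z0)) z0 = e ^+ 2 * (nm v ^+ 2)%:C + e * t%:C * dot v c.
Proof.
have vw : dot v (w z0) = (nm v ^+ 2)%:C.
  by rewrite wE (dotDr dot) (dotZr dot) vz mulr0 add0r (dot_sqr dot_norm).
have := multC v; rewrite (dotBl dot v) (dotBr dot v) vz vw.
move: (dot (Q _ _ _) _) (nm v ^+ 2)%:C (dot v c) => q s u h.
have -> : q = e * e^*%C * q by rewrite eJ mul1r.
have E : e^*%C * q = e * s + t%:C * u.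
  by apply/eqP; rewrite -subr_eq0; apply/eqP; move: h => /eqP; rewrite -subr_eq0 => /eqP h; rewrite -[RHS]oppr0 -h; ring.
by rewrite -mulrA E; ring.
Qed.

Let P := nm p.
Let V := nm v.

Lemma nm_p_sqr : P ^+ 2 = 2 * k * complex.Re p.
Proof.
have k0 := kp; have := e1 => /(congr1 (fun s => s ^+ 2)); rewrite expr1n nm_sqr => /(congr1 (fun s => k ^+ 2 * s)) h.
by rewrite /P pe nmM nm_real gtr0_norm// exprMn nm_sqr !Cex/=; lra.
Qed.

(** [convex_uniform] for Y = p z0 + (1 - conj e)/2 v, whose pairing with z0 has phase
    e, added to (1 + Re e)/2 times [convex_uniform] for v, which is orthogonal to z0 and so
    admits every phase, in particular - e^2.  The remaining values of Q come from the
    radial and tangential equations. *)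
Lemma curvature_inequality :
  a * V ^+ 2 <= r2 * (complex.Re p * (1 - 2 * k * a - t) + t * complex.Re (p * sg))
    + t * nm c * V.
Proof.
pose m : C := (1 - e^*%C) / 2; pose Y := p *: z0 + m *: v.
have a1E : dot (Q z0 z0 (w z0)) z0 = r2%:C * (1 - p - e * t%:C * (1 - sg)).
  have := radial_equation; move: eJ rC; move: (dot _ _) r2%:C e^*%C sg => q s f u ef s0 h.
  apply: (mulIf (_ : s^-1 != 0)); first by rewrite invr_eq0.
  have -> : s * (1 - p - e * t%:C * (1 - u)) / s = 1 - p - e * (t%:C * (1 - u)) by field.
  by rewrite -h mulrA ef; ring.
have a2E := tangential_equation.
have Yz : dot Y z0 = p * r2%:C.
  by rewrite /Y (dotDl dot) !(dotZl dot) vz mulr0 addr0 dzz.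
have Ye : dot Y z0 = e * (dot Y z0)^*%C.
  have -> : (dot Y z0)^*%C = p^*%C * r2%:C by rewrite Yz; apply: C_eqP; rewrite !Cex/=; ring.
  by rewrite Yz mulrA pJ.
have h1 := convex_uniform r11 z0r1 e1 Ye.
have e2 : nm (- (e ^+ 2)) = 1 by rewrite nmN nmX e1 expr1n.
have h2 : - (2 * (1 - alpha) * r1 / (1 + r1) * nm v ^+ 2) <=
   complex.Re ((- (e ^+ 2))^*%C * dot (Q z0 v v) z0).
  by apply: (convex_uniform r11 z0r1 e2); rewrite vz conjc0 mulr0.
set q3 := dot (Q z0 v v) z0 in h2.
have QY : e^*%C * dot (Q z0 Y Y) z0 = e^*%C * p * dot (Q z0 z0 (w z0)) z0
  - e^*%C ^+ 2 * dot (Q z0 v (w z0)) z0 + (2 + e + e^*%C) / 4 * (e^*%C ^+ 2 * q3).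
  by rewrite wE; exact: Q_blend.
have nY : nm Y ^+ 2 = P ^+ 2 * r2 + (1 - complex.Re e) / 2 * V ^+ 2.
  rewrite /Y (nm_sqr_dotD dot_norm) (dotZl dot) (dotZr dot) zv !mulr0 /= ?mulr0 addr0.
  rewrite !nmZ !exprMn -/P -/V; congr (_ + _ * _).
  rewrite /m nm_sqr Re_half Im_half !Cex/=.
  by move: e1 => /(congr1 (fun s => s ^+ 2)); rewrite expr1n nm_sqr; lra.
move: h1 h2; rewrite QY nY a1E a2E Jp.
have -> : p^*%C * (r2%:C * (1 - p - e * t%:C * (1 - sg))) =
   r2%:C * (p^*%C - (P ^+ 2)%:C - t%:C * (p * (1 - sg))).
  by rewrite nm_sqrJ -[X in t%:C * (X * _)]pJ; ring.
have -> : e^*%C ^+ 2 * (e ^+ 2 * (V ^+ 2)%:C + e * t%:C * dot v c) =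
   (V ^+ 2)%:C + t%:C * (e^*%C * dot v c).
  have -> : e^*%C ^+ 2 * (e ^+ 2 * (V ^+ 2)%:C + e * t%:C * dot v c) =
    (e * e^*%C) ^+ 2 * (V ^+ 2)%:C + (e * e^*%C) * (t%:C * (e^*%C * dot v c)) by ring.
  by rewrite eJ expr1n !mul1r.
have -> : (- (e ^+ 2))^*%C = - (e^*%C ^+ 2) by rewrite rmorphN rmorphXn.
have vc : - complex.Re (e^*%C * dot v c) <= V * nm c.
  rewrite -cReN; apply: (le_trans (Re_le _)); rewrite nmN nmM nmJ e1 mul1r.
  exact: cauchy_schwarz.
have c2 : complex.Re ((2 + e + e^*%C) / 4 * (e^*%C ^+ 2 * q3)) =
   (1 + complex.Re e) / 2 * complex.Re (e^*%C ^+ 2 * q3).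
  have -> : (2 + e + e^*%C) / 4 = ((1 + complex.Re e) / 2)%:C.
    have -> : (4 : C)^-1 = (4^-1 : R)%:C by rewrite fmorphV/= rmorph_nat.
    by apply: C_eqP; rewrite !Cex/=; field.
  by rewrite cReM/= mul0r subr0.
rewrite cReD c2 mulNr cReN; set T := complex.Re (e^*%C ^+ 2 * q3).
have ee : 0 <= (1 + complex.Re e) / 2.
  by have := Re_le_nm e; rewrite e1 ler_norml => /andP[]; lra.
have K : 2 * (1 - alpha) * r1 / (1 + r1) = 1 - a by rewrite /a; ring.
rewrite K lerN2 -/V => h1 h2.
have h3 := ler_wpM2l ee h2.
have tc : t * - complex.Re (e^*%C * dot v c) <= t * (V * nm c) by apply: ler_wpM2l vc.
move: h1 h3; rewrite nm_p_sqr.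
have -> : complex.Re (r2%:C * (p^*%C - (2 * k * complex.Re p)%:C - t%:C * (p * (1 - sg))) -
      ((V ^+ 2)%:C + t%:C * (e^*%C * dot v c))) =
  r2 * (complex.Re p - 2 * k * complex.Re p - t * (complex.Re p - complex.Re (p * sg)))
   - V ^+ 2 - t * complex.Re (e^*%C * dot v c).
  move: (e^*%C * _) => u; have -> : p * (1 - sg) = p - p * sg by ring.
  by move: (p * sg) => y; rewrite !Cex/=; ring.
move: tc; move: (complex.Re (e^*%C * dot v c)) (complex.Re (p * sg)) (complex.Re p) (complex.Re e) (V) (nm c).
move=> *; lra.
Qed.

End Curvature.

(** * Lower bound for the multiplier *)

Section ContactSlope.
Context {R : realType} {X : completeNormedModType R[i]}.
Context (dot : {dot X for conjC}) (dot_norm : forall x : X, dot x x = `|x| ^+ 2).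
Local Notation C := R[i].
Implicit Types (c h n v x y z Y : X).

(** The inequality for the squares makes P + V of order t eps, the next one bounds t,
    and the last hypothesis keeps P + V away from 0. *)
Lemma squeeze (a d k r2 rho m P V t eps K : R) :
  2^-1 < k -> k <= 1 -> 0 <= P -> 0 <= V -> 0 <= t -> 0 < eps -> 0 <= K ->
  0 < d -> 0 < m -> m <= a -> m <= rho ^+ 2 * d / 2 -> rho ^+ 2 <= r2 ->
  a * V ^+ 2 + r2 * d / (2 * k) * P ^+ 2 <= t * (eps * (P + V)) ->
  t <= 2 * (1 + (K + 1) * (P + V)) -> 1 <= (K + 5) * (P + V) ->
  m <= 8 * (K + 5) * eps.
Proof.
move=> k12 k1 P0 V0 t0 e0 K0 d0 m0 ma mr rr H1 H2 H3.
have S0 : 0 < P + V.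
  rewrite lt_def addr_ge0// andbT; apply: contraTneq H3 => ->.
  by rewrite mulr0 ler10.
have h1 : m * V ^+ 2 <= a * V ^+ 2 by rewrite ler_wpM2r ?sqr_ge0.
have h2 : m * P ^+ 2 <= r2 * d / (2 * k) * P ^+ 2.
  apply: ler_wpM2r; first exact: sqr_ge0.
  apply: (le_trans mr); apply: (@le_trans _ _ (r2 * d / 2)).
    by rewrite ler_wpM2r ?invr_ge0// ler_wpM2r// ltW.
  have r20 : 0 <= r2 by apply: le_trans (sqr_ge0 _) rr.
  rewrite ler_wpM2l ?mulr_ge0//; first exact: ltW.
  by rewrite lef_pV2 ?posrE; lra.
have h3 : 0 <= m * (P - V) ^+ 2 by rewrite mulr_ge0 ?sqr_ge0// ltW.
have h4 : m * (P + V) * (P + V) <= 2 * t * eps * (P + V) by move: h3; rewrite !expr2 in h1 h2 H1 *; lra.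
rewrite ler_pM2r// in h4.
have h5 := ler_wpM2r (ltW e0) H2.
have h6 : eps * 1 <= eps * ((K + 5) * (P + V)) by rewrite ler_wpM2l// ltW.
have h7 : 0 <= eps * (P + V) by rewrite mulr_ge0// ltW.
by rewrite -(ler_pM2r S0); lra.
Qed.

(** As d -> 0 the hypotheses give k E <= 1 - k, whence
    t >= k (1 - E)/(1 + E) >= k (2 k - 1); the powers of 1 + d/8 cost less than d. *)
Lemma slope_lower_bound (k d t E : R) : 2^-1 < k -> k <= 1 -> 0 < d -> d <= 1 -> 0 <= t ->
  k * E <= 1 - k + d / 8 -> k * (1 - E) <= (1 + E) * (t * (1 + d / 8) ^+ 2) ->
  k * (2 * k - 1) - d <= t.
Proof.
move=> k12 k1 d0 d1 t0 kE; set T := t * _ => h1.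
have k0 : 0 < k by lra.
have T0 : 0 <= T by rewrite mulr_ge0 ?sqr_ge0.
have h2 := ler_wpM2l (ltW k0) h1.
have h3 := ler_wpM2l (ltW k0) kE.
have h4 := ler_wpM2r T0 kE.
have h5 : k * d <= 1 * d by rewrite ler_wpM2r// ltW.
have h6 : k * (2 * k - 1) - d / 8 <= (1 + d / 8) * T by clearbody T; lra.
rewrite leNgt; apply/negP => lt.
have h7 : (1 + d / 8) ^+ 3 <= 1 + d / 2.
  have dd : d * d <= d * 1 by rewrite ler_wpM2l// ltW.
  have ddd : d * (d * d) <= d * 1 by rewrite ler_wpM2l ?(ltW d0)//; lra.
  have -> : (1 + d / 8) ^+ 3 = 1 + 3 / 8 * d + 3 / 64 * (d * d) + 1 / 512 * (d * (d * d)) by field.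
  lra.
have h8 : (1 + d / 8) * T <= (1 + d / 2) * t.
  have -> : (1 + d / 8) * T = (1 + d / 8) ^+ 3 * t by rewrite /T; ring.
  by rewrite ler_wpM2r.
have h9 : (1 + d / 2) * t < (1 + d / 2) * (k * (2 * k - 1) - d) by rewrite ltr_pM2l//; lra.
have kk : k * (2 * k - 1) <= 1 * 1 by apply: ler_pM => //; lra.
have h10 : d * (k * (2 * k - 1)) <= d * (1 * 1) by rewrite ler_wpM2l// ltW.
have h11 : 0 < d * d by rewrite mulr_gt0.
suff : t < t by rewrite ltxx.
by clearbody T; lra.
Qed.

Context (alpha : R) (w : X -> X) (Q : X -> X -> X -> X).
Context (wQ : convex_data dot alpha w Q).
Context (k : R) (k12 : 2^-1 < k) (k1 : k <= 1).
Local Notation pairing := (radial_pairing dot w).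
Local Notation defect := (starlike_defect dot w k).

Context (c z0 : X) (z0nz : z0 != 0) (z0lt1 : nm z0 < 1) (nnz : z0 - c != 0).
Context (def0 : 0 <= defect z0).
Context (outside : forall z, z != 0 -> nm (z - c) < nm (z0 - c) -> nm z < 1 /\ defect z < 0).
Let r2 : R := nm z0 ^+ 2.
Let sg : C := dot z0 c / r2%:C.
Let r20 : 0 < r2. Proof. by rewrite exprn_gt0// nm_gt0. Qed.
Let kp : 0 < k. Proof. by have := k12; lra. Qed.

(** Where w is close to the identity, the slice is close to 1/k - 1. *)
Lemma slice_near0 (b : C) (r d : R) :
  (forall z, nm z < r -> nm (w z - z) <= d * nm z) -> b != 0 -> nm b < r ->
  k * nm (slice dot w k z0 b) <= 1 - k + d.
Proof.
move=> wr b0 br; have nb : 0 < nm b by rewrite nm_gt0.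
have k0 := kp; have kC : k%:C != 0 :> C by rewrite -nm_gt0 nm_real gtr0_norm.
have rC : r2%:C != 0 :> C by rewrite -nm_gt0 nm_real gtr0_norm.
have zb : nm (b *: z0) < r.
  rewrite nmZ; apply: le_lt_trans br; rewrite -[X in _ <= X]mulr1.
  by rewrite ler_wpM2l ?nm_ge0// ltW.
set g := w (b *: z0) - b *: z0.
have -> : k * nm (slice dot w k z0 b) = nm (dot g z0 / (b * r2%:C) + (1 - k)%:C).
  have -> s : k * nm s = nm (k%:C * s) by rewrite nmM nm_real gtr0_norm.
  congr nm.
  rewrite /slice /g (dotBl dot) (dotZl dot) (dot_sqr dot_norm) -/r2.
  move: (dot _ _) => q; have -> : (k * r2)%:C = k%:C * r2%:C by rewrite rmorphM.
  rewrite rmorphB rmorph1/=; move: kC rC; move: k%:C r2%:C => k' r'.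
  by move=> k'0 r'0; field; rewrite b0 r'0.
apply: (le_trans (nmD _ _)); rewrite nm_real ger0_norm; last by have := k1; lra.
rewrite addrC lerD2l nmM nmV ler_pdivrMr; last by rewrite nm_gt0 mulf_neq0.
apply: (le_trans (cauchy_schwarz dot_norm _ _)).
rewrite [X in _ <= X](_ : _ = d * nm (b *: z0) * nm z0).
  by rewrite ler_wpM2r ?nm_ge0// wr.
by rewrite nmM nmZ nm_real gtr0_norm// /r2; ring.
Qed.

(** [boundary_schwarz] with b close to 0: the slice at b then has modulus at most
    about (1 - k)/k by [slice_near0], and |1 - conj(x1) e| >= 1 - |x1|. *)
Lemma contact_slope (p e : C) (t r d eta : R) :
  pairing z0 = p * r2%:C -> p = k%:C * (1 + e) -> nm e = 1 -> 0 <= t ->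
  (forall x, defect_derivative dot w Q k z0 x = 2 * k * r2 * t * complex.Re (dot x (z0 - c))) ->
  (forall z, nm z < r -> nm (w z - z) <= d / 8 * nm z) ->
  0 < d -> d <= 1 -> 0 < eta -> eta <= d / 8 -> 4 * eta <= r -> nm sg <= eta ->
  k * (2 * k - 1) - d <= t.
Proof.
move=> Ep pe e1 t0 mult wr d0 d1 eta0 eta8 etar sge.
(* the disc is shrunk by 2 * eta so that its centre b is small but not 0 *)
pose q := 1 - 2 * eta; pose b : C := 1 - q%:C * (1 - sg^*%C).
have q01 : 0 < q <= 1 by apply/andP; split; rewrite /q; lra.
have q0 : 0 < q by rewrite /q; lra.
have q1 : q <= 1 by rewrite /q; lra.
have qsg : nm (q%:C * sg^*%C) <= eta.
  rewrite nmM nmJ nm_real gtr0_norm//; apply: le_trans sge.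
  by rewrite -[X in _ <= X]mul1r ler_wpM2r ?nm_ge0.
have bE : b = (2 * eta)%:C + q%:C * sg^*%C.
  by rewrite /b /q rmorphB rmorph1; ring.
have n2 : nm ((2 * eta)%:C : C) = 2 * eta by rewrite nm_real gtr0_norm// mulr_gt0.
have b3 : nm b <= 3 * eta by have := nmD (2 * eta)%:C (q%:C * sg^*%C); rewrite -bE n2; lra.
have b0 : b != 0.
  rewrite -nm_gt0; have := nm_subl (2 * eta)%:C b.
  by rewrite {2}bE opprD addrA subrr add0r nmN n2; lra.
have b1 : nm b < nm (1 - b) by have := nm_subl 1 b; rewrite nm1; lra.
have sg1 : sg != 1 by apply: contraTneq sge => ->; rewrite nm1 -ltNge; lra.
have [x1lt H] := boundary_schwarz dot_norm wQ k12 z0nz z0lt1 nnz def0 outside Ep pe mult q01 sg1 erefl b0 b1.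
have br : nm b < r by lra.
have := slice_near0 wr b0 br.
move: x1lt H; rewrite -/b; set x1 := slice _ _ _ _ b; set E := nm x1 => E1 H kE.
have E0 : 0 <= E := nm_ge0 _.
have k0 := kp; have kl := k1; have kh := k12.
have far : 1 - E <= nm (1 - x1^*%C * e).
  by have := nm_subl 1 (x1^*%C * e); rewrite nm1 nmM nmJ e1 mulr1 -/E; lra.
have s1 : nm (1 - sg) <= 1 + d / 8 by have := nmD 1 (- sg); rewrite nm1 nmN; lra.
have T1 : t * q * nm (1 - sg) ^+ 2 <= t * (1 + d / 8) ^+ 2.
  apply: ler_pM; [exact: mulr_ge0 t0 (ltW q0)|exact: sqr_ge0| |].
    by rewrite -[X in _ <= X]mulr1; exact: ler_wpM2l.
  by rewrite lerXn2r ?nnegrE ?nm_ge0//; lra.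
set T := t * (1 + d / 8) ^+ 2 in T1.
have T0 : 0 <= T by rewrite mulr_ge0 ?sqr_ge0.
have h1 : (1 - E) * (k * (1 - E)) <= (1 - E) * ((1 + E) * T).
  apply: (@le_trans _ _ (k * nm (1 - x1^*%C * e) ^+ 2)).
    rewrite mulrCA ler_pM2l// -expr2 lerXn2r ?nnegrE ?nm_ge0//; lra.
  apply: (le_trans H); have -> : (1 - E) * ((1 + E) * T) = (1 - E ^+ 2) * T by ring.
  rewrite ler_wpM2l// subr_ge0 -(expr1n _ 2) lerXn2r ?nnegrE//; exact: ltW.
rewrite ler_pM2l in h1; last by lra.
by apply: slope_lower_bound h1; rewrite ?d0.
Qed.

End ContactSlope.

(** * No bad point touches a ball around a small centre *)

(** The hypotheses eps <= eta rho and eta <= d/8 make the errors in [contact_slope] small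
    compared with d = k (a - alpha), which is half the gap between 1 - 2 k a and
    k (2 k - 1).  The conclusion contradicts eps < m/(8 (K + 5)); a and m do not depend on
    eps. *)
Lemma touching_eps_ge (R : realType) (X : completeNormedModType R[i])
    (dot : {dot X for conjC}) (dot_norm : forall x : X, dot x x = `|x| ^+ 2)
    (alpha : R) (w : X -> X) (Q : X -> X -> X -> X)
    (wQ : convex_data dot alpha w Q) (alt1 : alpha < 1)
    (k : R) (k12 : 2^-1 < k) (k1 : k <= 1)
    (relation : 1 + k - 2 * k ^+ 2 - 2 * k * alpha = 0)
    (c z0 : X) (r1 rho d eta r eps m : R) :
  let defect := starlike_defect dot w k in
  z0 - c != 0 -> 0 <= defect z0 ->
  (forall z, z != 0 -> nm (z - c) < nm (z0 - c) -> nm z < 1 /\ defect z < 0) ->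
  let a := 1 - 2 * (1 - alpha) * r1 / (1 + r1) in
  let K := 2 * (1 - alpha) / (1 - r1) in
  0 < rho -> rho <= nm z0 -> nm z0 <= r1 -> r1 < 1 ->
  d = k * (a - alpha) -> 0 < d -> d <= 1 ->
  (forall z, nm z < r -> nm (w z - z) <= d / 8 * nm z) ->
  0 < eta -> eta <= d / 8 -> 4 * eta <= r ->
  0 < eps -> nm c <= eps -> eps <= eta * rho ->
  0 < m -> m <= a -> m <= rho ^+ 2 * d / 2 -> m <= 8 * (K + 5) * eps.
Proof.
move=> defect nnz def0 outside a K rho0 rhoz z0r1 r11 dE d0 d1 wr eta0 eta8 etar eps0 ceps epseta m0 ma md.
have kh := k12; have kl := k1; have k0 : 0 < k by lra.
have a1 := alt1; have z0p : 0 < nm z0 by lra.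
have z0nz : z0 != 0 by rewrite -nm_gt0.
have z0lt1 : nm z0 < 1 by lra.
have K0 : 0 <= K by rewrite divr_ge0//; lra.
pose r2 := nm z0 ^+ 2.
have r20 : 0 < r2 by rewrite exprn_gt0.
have rr : rho ^+ 2 <= r2 by rewrite lerXn2r ?nnegrE ?(ltW z0p) ?(ltW rho0).
have rC : r2%:C != 0 :> R[i] by rewrite -nm_gt0 nm_real gtr0_norm.
have kC : k%:C != 0 :> R[i] by rewrite -nm_gt0 nm_real gtr0_norm.
pose p : R[i] := radial_pairing dot w z0 / r2%:C; pose e : R[i] := p / k%:C - 1.
have Ep : radial_pairing dot w z0 = p * r2%:C by rewrite /p divfK.
have pe : p = k%:C * (1 + e) by rewrite /e addrC subrK mulrC divfK.
clearbody e p.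
have [t [t0 e1 mult multC]] := multiplier dot_norm wQ kh z0nz z0lt1 nnz def0 outside Ep pe.
pose sg : R[i] := dot z0 c / r2%:C.
have zc : nm (dot z0 c) <= nm z0 * eps.
  by apply: (le_trans (cauchy_schwarz dot_norm _ _)); rewrite ler_pM2l.
have sgr : r2 * nm sg <= nm z0 * eps.
  by rewrite /sg nmM nmV nm_real (gtr0_norm r20) mulrC divfK ?gt_eqF.
have sge : nm sg <= eta.
  rewrite -(ler_pM2l r20); apply: (le_trans sgr).
  have -> : r2 * eta = nm z0 * (eta * nm z0) by rewrite /r2; ring.
  by rewrite ler_pM2l//; apply: (le_trans epseta); rewrite ler_pM2l.
have slope := contact_slope dot_norm wQ kh kl z0nz z0lt1 nnz def0 outside Ep pe e1 t0 mult wr d0 d1 eta0 eta8 etar sge.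
have radial := radial_equation dot_norm z0nz Ep pe e1 multC.
have curv := curvature_inequality dot_norm wQ a1 kh z0nz z0r1 r11 t0 Ep pe e1 multC.
have psq := nm_p_sqr kh pe e1.
have Q0 := Q_bilinear_le dot_norm wQ a1 z0 (w z0) r11 z0r1.
clear mult multC outside def0; move: curv radial Q0; rewrite -/a -/r2 -/sg -/K.
set A := _ / r2%:C; set v := w z0 - p *: z0; set V := nm v; set P := nm p in psq *.
move=> curv radial Q0; clearbody a K.
have V0 : 0 <= V := nm_ge0 _; have P0 : 0 <= P := nm_ge0 _.
have wS : nm (w z0) <= P + V.
  have := nm_subl (w z0) (p *: z0); rewrite -/v -/V nmZ => h.
  have : P * nm z0 <= P * 1 by rewrite ler_wpM2l// ltW.
  by rewrite -/P in h; clear -h; lra.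
have AS : nm A <= K * (P + V).
  rewrite /A nmM nmV nm_real (gtr0_norm r20) ler_pdivrMr//.
  apply: (le_trans Q0).
  have -> : K * nm z0 * nm z0 * nm (w z0) = K * nm (w z0) * r2 by rewrite /r2; ring.
  by rewrite ler_wpM2r ?(ltW r20)// ler_wpM2l.
have H2 : t <= 2 * (1 + (K + 1) * (P + V)).
  have E : nm (1 - A - p) = t * nm (1 - sg).
    by have := congr1 nm radial; rewrite !nmM nmJ e1 mul1r nm_real ger0_norm.
  have h1 : 2^-1 <= nm (1 - sg).
    by have := nm_subl 1 sg; rewrite nm1; clear -sge eta8 d1; lra.
  have h2 := ler_wpM2l t0 h1.
  have h3 : nm (1 - A - p) <= 1 + nm A + P.
    have := nmD (1 - A) (- p); have := nmD 1 (- A); rewrite !nmN nm1 -/P; clear; lra.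
  by clear -E h2 h3 AS V0; lra.
have Rp : complex.Re p = k * (1 + complex.Re e) by rewrite pe !Cex/=; ring.
have H3 : 1 <= (K + 5) * (P + V).
  have h1 : 0 <= complex.Re (t%:C * (1 - sg)).
    rewrite cReM/= mul0r subr0 cReB/=; have := Re_le sg => h; rewrite mulr_ge0//; clear -h sge eta8 d1; lra.
  have h2 := Re_le (- (e^*%C * (A + p))).
  rewrite nmN nmM nmJ e1 mul1r in h2.
  have h3 := nmD A p; rewrite -/P in h3.
  have h4 := Re_le p; rewrite -/P Rp in h4.
  have h5 : 1 + complex.Re e <= 2 * P.
    have [le0|gt0] := leP (1 + complex.Re e) 0; first by clear -le0 P0; lra.
    have : 2^-1 * (1 + complex.Re e) <= k * (1 + complex.Re e) by rewrite ler_wpM2r// ltW.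
    by clear -h4; lra.
  rewrite -radial in h1.
  have h6 : complex.Re (e^*%C * (1 - A - p)) = complex.Re e + complex.Re (- (e^*%C * (A + p))).
    by rewrite !Cex/=; ring.
  have h7 : 0 <= K * (P + V) by rewrite mulr_ge0// addr_ge0.
  by rewrite h6 in h1; clear -h1 h2 h3 h5 h7 AS P0 V0; lra.
have H1 : a * V ^+ 2 + r2 * d / (2 * k) * P ^+ 2 <= t * (eps * (P + V)).
  have Rp0 : 0 <= complex.Re p.
    by rewrite -(pmulr_rge0 _ (_ : 0 < 2 * k)) -?psq ?sqr_ge0// mulr_gt0.
  have -> : r2 * d / (2 * k) * P ^+ 2 = r2 * (complex.Re p * d).
    by rewrite psq; field; rewrite gt_eqF.
  have h1 : complex.Re p * (1 - 2 * k * a - t) <= complex.Re p * - d.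
    apply: ler_wpM2l => //; have rel := relation.
    have kk : k * (2 * k - 1) = 1 - 2 * k * alpha by move: rel; rewrite expr2; clear; lra.
    have : 2 * d = 2 * k * a - 2 * k * alpha by rewrite dE; ring.
    by rewrite kk in slope; clear -slope; lra.
  have h2 := ler_wpM2l (ltW r20) h1.
  have h3 : r2 * complex.Re (p * sg) <= P * eps.
    apply: (@le_trans _ _ (P * (r2 * nm sg))).
      rewrite [X in _ <= X]mulrCA ler_pM2l//; apply: (le_trans (Re_le _)); by rewrite nmM.
    apply: ler_wpM2l => //; apply: (le_trans sgr).
    by rewrite -[X in _ <= X]mul1r ler_wpM2r// ltW.
  have h4 := ler_wpM2l t0 h3.
  have h5 : t * V * nm c <= t * V * eps by rewrite ler_wpM2l// mulr_ge0.
  by move: curv; clear -h2 h4 h5; lra.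
exact: squeeze kh kl P0 V0 t0 eps0 K0 d0 m0 ma md rr H1 H2 H3.
Qed.

(** * Starlikeness *)

Section DefectOpen.
Context {R : realType} {X : completeNormedModType R[i]}.
Context (dot : {dot X for conjC}) (dot_norm : forall x : X, dot x x = `|x| ^+ 2).
Local Notation C := R[i].
Implicit Types (c h n v x y z Y : X).

Context (alpha : R) (w : X -> X) (Q : X -> X -> X -> X).
Context (wQ : convex_data dot alpha w Q).
Context (k : R) (k12 : 2^-1 < k) (k1 : k <= 1).
Local Notation pairing := (radial_pairing dot w).
Local Notation defect := (starlike_defect dot w k).

(** Local Lipschitz continuity of <w z, z> and |z|^2, applied to the form of
    the condition in [defect_lt0P]. *)
Lemma defect_neg_open l : nm l < 1 -> l != 0 -> defect l < 0 ->
  exists2 r : R, 0 < r & forall h, nm h < r -> defect (l + h) < 0.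
Proof.
move=> l1 l0 dl; have kh := k12; have kl := k1; have k0 : 0 < k by lra.
have nl : 0 < nm l by rewrite nm_gt0.
have [wd _ [B LB]] := w_fder wQ l1.
have [s s0 sP] := hasd_lip wd LB.
have G0 : nm (pairing l - (k * nm l ^+ 2)%:C) < k * nm l ^+ 2 by rewrite (defect_lt0P _ _ kh).
set g := nm (pairing l - _) in G0.
pose L := `|B + 1|; pose M := nm (w l) + 2 * L + 6.
have L0 : 0 <= L := normr_ge0 _.
have M0 : 0 < M by rewrite /M; have := nm_ge0 (w l); lra.
pose r := Num.min (Num.min s 1) (Num.min (nm l) ((k * nm l ^+ 2 - g) / M)).
exists r => [|h]; first by rewrite !lt_min s0 ltr01 nl divr_gt0// subr_gt0.
rewrite !lt_min ltr_pdivlMr// => /andP[/andP[hs h1] /andP[hl hM]].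
have h0 := nm_ge0 h; have := sP h hs => wh.
have wL : nm (w (l + h) - w l) <= L * nm h.
  by apply: (le_trans wh); rewrite ler_wpM2r// ler_norm.
have lh0 : l + h != 0.
  by apply: contraTneq hl => /eqP; rewrite addr_eq0 => /eqP ->; rewrite nmN ltxx.
rewrite -(defect_lt0P _ _ kh)//.
have E : pairing (l + h) - pairing l = dot (w (l + h)) h + dot (w (l + h) - w l) l.
  by rewrite /radial_pairing (dotDr dot) (dotBl dot); ring.
have p1 : nm (pairing (l + h) - pairing l) <= (nm (w l) + 2 * L) * nm h.
  rewrite E; apply: (le_trans (nmD _ _)).
  have a1 := cauchy_schwarz dot_norm (w (l + h)) h.
  have a2 := cauchy_schwarz dot_norm (w (l + h) - w l) l.
  have a3 : nm (w (l + h)) <= nm (w l) + L.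
    have := nm_subl (w (l + h)) (w l); have : L * nm h <= L * 1 by rewrite ler_wpM2l// ltW.
    lra.
  have a4 := ler_wpM2r h0 a3.
  have a5 : nm (w (l + h) - w l) * nm l <= (L * nm h) * 1 by apply: ler_pM; rewrite ?nm_ge0// ltW.
  lra.
have q1 : `|nm (l + h) ^+ 2 - nm l ^+ 2| <= 3 * nm h.
  rewrite (nm_sqr_dotD dot_norm).
  have -> : nm l ^+ 2 + 2 * complex.Re (dot l h) + nm h ^+ 2 - nm l ^+ 2 = 2 * complex.Re (dot l h) + nm h ^+ 2 by ring.
  have b1 : `|complex.Re (dot l h)| <= 1 * nm h.
    apply: (le_trans (Re_le_nm _)); apply: (le_trans (cauchy_schwarz dot_norm _ _)).
    by rewrite ler_wpM2r// ltW.
  have b2 : nm h ^+ 2 <= 1 * nm h by rewrite expr2 ler_wpM2r// ltW.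
  by move: b1; rewrite !ler_norml => /andP[b3 b4]; have := sqr_ge0 (nm h); lra.
have kq : nm ((k * nm l ^+ 2)%:C - (k * nm (l + h) ^+ 2)%:C : C) <= 3 * nm h.
  rewrite -rmorphB nm_real -mulrBr normrM gtr0_norm// distrC -[X in _ <= X]mul1r.
  by apply: ler_pM => //; exact: ltW.
have t1 := nm_tri (pairing (l + h)) (pairing l) (k * nm (l + h) ^+ 2)%:C.
have t2 := nm_tri (pairing l) (k * nm l ^+ 2)%:C (k * nm (l + h) ^+ 2)%:C.
have kr : k * nm l ^+ 2 - k * nm (l + h) ^+ 2 <= 3 * nm h.
  by apply: le_trans kq; rewrite -rmorphB nm_real; exact: ler_norm.
rewrite -/g in t2; rewrite /M in hM.
move: p1 kq t1 t2 kr hM; move: (nm (pairing (l + h) - _)) (nm (pairing (l + h) - _)) (nm (_%:C - _)) => u1 u2 u3.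
move: (nm (pairing l - _)) => u4; lra.
Qed.

End DefectOpen.

(** Bad points of norm at most r1 = (1 + |z|)/2 and at least rho form a closed set to
    which [nearest_point] applies; every point strictly nearer to c than z0 is again of
    norm at most r1, because z itself is at least as far from c as z0. *)
Lemma defect_neg (R : realType) (X : completeNormedModType R[i])
    (dot : {dot X for conjC}) (dot_norm : forall x : X, dot x x = `|x| ^+ 2)
    (alpha : R) (w : X -> X) (Q : X -> X -> X -> X)
    (wQ : convex_data dot alpha w Q) (alt1 : alpha < 1) (al0 : 0 <= alpha)
    (k : R) (k12 : 2^-1 < k) (k1 : k <= 1)
    (relation : 1 + k - 2 * k ^+ 2 - 2 * k * alpha = 0) (z : X) :
  nm z < 1 -> z != 0 -> starlike_defect dot w k z < 0.
Proof.
set defect := starlike_defect dot w k; move=> z1 z0; rewrite ltNge; apply/negP => bad.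
have kh := k12; have kl := k1; have k0 : 0 < k by lra.
have a1 := alt1; have a0 := al0.
have zp : 0 < nm z by rewrite nm_gt0.
pose r1 := (1 + nm z) / 2; have r11 : r1 < 1 by rewrite /r1; lra.
have r10 : 0 < r1 by rewrite /r1; lra.
pose a := 1 - 2 * (1 - alpha) * r1 / (1 + r1).
pose K := 2 * (1 - alpha) / (1 - r1).
have K0 : 0 <= K by rewrite divr_ge0//; lra.
have aal : alpha < a.
  have : (1 - alpha) * (2 * r1 / (1 + r1)) < (1 - alpha) * 1.
    by rewrite ltr_pM2l ?ltr_pdivrMr; lra.
  by rewrite /a -!mulrA; lra.
have ale : a <= 1 by rewrite /a gerBl// divr_ge0 ?mulr_ge0//; lra.
pose d := k * (a - alpha).
have d0 : 0 < d by rewrite mulr_gt0// subr_gt0.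
have d1 : d <= 1.
  have : k * (a - alpha) <= 1 * 1 by apply: ler_pM => //; lra.
  by rewrite mulr1.
have [rho rho0 near0] := defect_near0 dot_norm wQ kh kl.
have d80 : 0 < d / 8 by rewrite divr_gt0.
have [r r0 wr] := w_near0 wQ d80.
pose eta := Num.min (d / 8) (r / 4).
have eta0 : 0 < eta by rewrite lt_min d80 divr_gt0.
have eta1 : eta <= d / 8 by rewrite ge_min lexx.
have eta2 : eta <= r / 4 by rewrite ge_min lexx orbT.
pose m := Num.min a (rho ^+ 2 * d / 2).
have ap : 0 < a by lra.
have m0 : 0 < m by rewrite lt_min ap divr_gt0// mulr_gt0// exprn_gt0.
have ma : m <= a by rewrite ge_min lexx.
have md : m <= rho ^+ 2 * d / 2 by rewrite ge_min lexx orbT.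
(* the three bounds keep the touching ball inside radius r1, make c small
   against rho, and contradict [touching_eps_ge] *)
pose eps := Num.min ((1 - nm z) / 8) (Num.min (eta * rho) (m / (16 * (K + 5)))).
have K5 : 0 < 16 * (K + 5) by lra.
have eps0 : 0 < eps by rewrite !lt_min !divr_gt0 ?mulr_gt0//; lra.
have eps1 : eps <= (1 - nm z) / 8 by rewrite ge_min lexx.
have eps2 : eps <= eta * rho by rewrite !ge_min lexx !orbT.
have eps3 : eps <= m / (16 * (K + 5)) by rewrite !ge_min lexx !orbT.
have epsrho : eps < rho.
  by apply: (le_lt_trans eps2); rewrite -[X in _ < X]mul1r ltr_pM2r//; lra.
pose S y := rho <= nm y <= r1 /\ 0 <= defect y.
have good y : y != 0 -> nm y < rho -> defect y < 0 by move=> *; exact: near0.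
have Sz : S z.
  split => //; apply/andP; split; last by rewrite /r1; lra.
  by rewrite leNgt; apply/negP => /(good _ z0); rewrite ltNge bad.
have S1 y : S y -> nm y <= 1 by move=> [/andP[_ yr] _]; clear -yr r11; lra.
have Scl (u : nat -> X) l : (forall i, S (u i)) -> tends_to u l -> S l.
  move=> Su ul.
  have range : rho <= nm l <= r1.
    apply/andP; split; apply/ler_addgt0Pr => e e0; have [N /(_ N (leqnn _)) uN] := ul e e0.
      by have [/andP[h _] _] := Su N; have := nm_subl (u N) l; clear -h uN; lra.
    by have [/andP[_ h] _] := Su N; have := nm_subl l (u N); rewrite nmB; clear -h uN; lra.
  split => //; rewrite leNgt; apply/negP => dl.
  have [/andP[l1 l2]] := range.
  have ln0 : l != 0 by rewrite -nm_gt0; clear -l1 rho0; lra.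
  have l1' : nm l < 1 by clear -l2 r11; lra.
  have [s s0 sP] := defect_neg_open dot_norm wQ k12 k1 l1' ln0 dl.
  have [N /(_ N (leqnn _)) uN] := ul s s0.
  by have := sP _ uN; rewrite addrC subrK ltNge (Su N).2.
have [c [y0 [ceps [/andP[y0r y0r1] dy0] ymin]]] := nearest_point dot_norm eps0 Sz S1 Scl.
have nnz : y0 - c != 0.
  by rewrite subr_eq0; apply: contraTneq ceps => <-; rewrite -ltNge; clear -y0r epsrho; lra.
have outside y : y != 0 -> nm (y - c) < nm (y0 - c) -> nm y < 1 /\ defect y < 0.
  move=> yn0 yc; have h1 := ymin z Sz.
  have h2 := nmD z (- c); rewrite nmN in h2; have h3 := nm_subl y c.
  have yr1 : nm y <= r1 by rewrite /r1; clear -z1 yc h1 h2 h3 ceps eps1; lra.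
  split; first by lra.
  rewrite ltNge; apply/negP => dy.
  have Sy : S y.
    by split => //; rewrite yr1 andbT leNgt; apply/negP => /(good _ yn0); rewrite ltNge dy.
  by have := ymin y Sy; rewrite leNgt yc.
have eta4 : 4 * eta <= r by clear -eta2; lra.
have := touching_eps_ge dot_norm wQ alt1 kh kl relation nnz dy0 outside
  rho0 y0r y0r1 r11 erefl d0 d1 wr eta0 eta1 eta4 eps0 ceps eps2 m0 ma md.
by move: eps3; rewrite ler_pdivlMr//= -/K; clear -m0; lra.
Qed.


(** With b = 2 beta, the defining quadratic of beta is b^2 = (2 alpha - 1) b + 2, and
    1 <= b < 2. *)
Lemma order_beta (R : realType) (alpha : R) : 0 <= alpha -> alpha < 1 ->
  let k := (2 * ((2 * alpha - 1 + Num.sqrt ((2 * alpha - 1) ^+ 2 + 8)) / 4))^-1 in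
  [/\ 2^-1 < k, k <= 1 & 1 + k - 2 * k ^+ 2 - 2 * k * alpha = 0].
Proof.
move=> a0 a1 k; set D := (2 * alpha - 1) ^+ 2 + 8 in k *.
have D0 : 0 <= D by rewrite addr_ge0 ?sqr_ge0.
pose s := Num.sqrt D; have s2 : s ^+ 2 = D by exact: sqr_sqrtr.
have s0 : 0 <= s := sqrtr_ge0 _.
have s3 : 3 - 2 * alpha <= s.
  rewrite -(@ler_pXn2r _ 2)// ?nnegrE//; last by lra.
  by rewrite s2 /D; rewrite !expr2; lra.
have s5 : s < 5 - 2 * alpha.
  rewrite -(@ltr_pXn2r _ 2)// ?nnegrE//; last by lra.
  by rewrite s2 /D; rewrite !expr2; lra.
pose b := (2 * alpha - 1 + s) / 2.
have kE : k = b^-1 by rewrite /k /b -/s; congr (_ ^-1); field.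
have b1 : 1 <= b by rewrite /b; lra.
have b2 : b < 2 by rewrite /b; lra.
have b0 : 0 < b by lra.
rewrite kE; split.
- by rewrite ltf_pV2 ?posrE.
- by rewrite invf_le1.
have bb : b ^+ 2 = (2 * alpha - 1) * b + 2.
  have -> : b ^+ 2 = ((2 * alpha - 1) ^+ 2 + 2 * (2 * alpha - 1) * s + s ^+ 2) / 4 by rewrite /b; field.
  by rewrite s2 /D /b; field.
have -> : 1 + b^-1 - 2 * b^-1 ^+ 2 - 2 * b^-1 * alpha = (b ^+ 2 + b - 2 - 2 * b * alpha) / b ^+ 2.
  by field; rewrite gt_eqF.
by rewrite bb (_ : _ - _ = 0) ?mul0r//; ring.
Qed.

Unset Implicit Arguments.
Local Close Scope complex_scope.

Theorem theorem4 (R : realType) (X : completeNormedModType R[i])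
    (dot : {dot X for conjC})
    (dot_norm : forall x : X, dot x x = `|x| ^+ 2)
    (alpha : R) (alpha_ge0 : 0 <= alpha) (alpha_lt1 : alpha < 1) :
  class_K dot alpha `<=`
  class_Sstar dot
    ((2 * alpha - 1 + Num.sqrt ((2 * alpha - 1) ^+ 2 + 8)) / 4).
Proof.
move=> f fK; have [Q wQ] := class_K_data dot_norm fK.
have [[lb _] nf] := fK; split => // z /in_unit_ball z1 z0.
have [k12 k1 rel] := order_beta alpha_ge0 alpha_lt1.
have := defect_neg dot_norm wQ alpha_lt1 alpha_ge0 k12 k1 rel z1 z0.
by rewrite -(defect_lt0P _ _ k12)// -ltcR rmorphM rmorphXn/= -!nmE.
Qed.
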